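(* Let $X$ be an indecomposable root system of type $A$, $D$ or $E$, let $L$ be the root lattice of $X$, and let $R$ be a commutative ring. Then the natural action of the Chevalley group $G(X,R)$ on the Lie algebra over $R$ with Chevalley basis of type $X$ (namely $R\otimes_{\mathbb Z}(IV_L)_1$) extends uniquely to an action of $G(X,R)$ by vertex algebra automorphisms on the vertex algebra $R\otimes_{\mathbb Z} IV_L$.
   Context: Commutative rings have an identity. A vertex algebra (VA) over $R$ is an $R$-module $V$ with a linear map $a\mapsto Y(a,z)=\sum_{i\in\mathbb Z}a_iz^{-i-1}\in \mathrm{End}(V)[[z,z^{-1}]]$, a linear map $T:V\to V$ and a vector $\mathbf 1$ such that: $Y(\mathbf 1,z)=\mathrm{id}_V$; $Y(a,z)\mathbf 1\in V[[z]]$ and $a_{-1}\mathbf 1=a$; $a_nb=0$ for $n$ sufficiently large; $T\mathbf 1=0$ and $[T,Y(a,z)]=Y(Ta,z)=\frac{d}{dz}Y(a,z)$; and the Borcherds identity $\sum_{i}\binom{m}{i}(a_{q+i}b)_{m+n-i}c=\sum_{i}(-1)^i\binom{q}{i}\big(a_{m+q-i}(b_{n+i}c)-(-1)^q b_{n+q-i}(a_{m+i}c)\big)$ holds for all $a,b,c\in V$ and $m,n,q\in\mathbb Z$. For an even lattice $L$, $V_L$ is the usual lattice vertex operator algebra over $\mathbb C$. For $\alpha\in L$ put $\exp\left(\sum_{n>0}\frac{\alpha(-n)}{n}z^n\right)=\sum_{n\ge 0}s_{\alpha,n}z^n$. The standard integral form $IV_L$ of $V_L$ is the $\mathbb Z$-span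 of all elements $s_{\alpha_1,n_1}\cdots s_{\alpha_k,n_k}\otimes e^{\alpha}$ with $\alpha_i,\alpha\in L$, $n_i>0$; it is a vertex algebra over $\mathbb Z$, so $R\otimes_{\mathbb Z}IV_L$ is a vertex algebra over $R$. Put $(IV_L)_n=IV_L\cap (V_L)_n$. When $L$ is a root lattice of type ADE, $(IV_L)_1$ is the $\mathbb Z$-span of a Chevalley basis of the Lie algebra $(V_L)_1$ (bracket $[a,b]=a_0b$). Let $e_\alpha$ denote the element of the Chevalley basis in the root space of the root $\alpha$. The Chevalley group $G(X,R)$ is the group of automorphisms of the Lie algebra $R\otimes (IV_L)_1$ generated by all $x_\alpha(t)=\exp(t\,\mathrm{ad}(e_\alpha))$, $\alpha$ a root, $t\in R$ (defined via the Chevalley $\mathbb Z$-form, which is stable under the divided powers of $\mathrm{ad}(e_\alpha)$). *)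

(* Defs.v *)
From HB Require Import structures.
From mathcomp Require Import all_boot all_order all_algebra.
From mathcomp Require Import finmap multiset monalg.
From mathcomp Require Import boolp classical_sets fsbigop reals complex.

Set Implicit Arguments.
Unset Strict Implicit.
Unset Printing Implicit Defensive.

Import GRing.Theory.
Local Open Scope quotient_scope.
Local Open Scope ring_scope.

(* Throughout, [\sum_(j \in [set: nat]) F j] is the sum of a family with only
   finitely many nonzero terms. *)

Record vertex_ops (V : Type) := VertexOps {
  vac : V;
  transl : V -> V;
  nprod : V -> int -> V -> V (* [nprod a n b] is a_n b *)
}.

(* Binomial coefficient m(m-1)...(m-i+1)/i! for an integer m; for a negative
   upper entry, binom(-(k+1), i) = (-1)^i binom(k+i, i). *)
Definition binz (m : int) (i : nat) : int :=
  match m with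
  | Posz k => 'C(k, i)%:Z
  | Negz k => (-1) ^+ i * 'C(k + i, i)%:Z
  end.

Section VertexAlgebra.
Variables (R : comPzRingType) (V : lmodType R) (S : vertex_ops V).
Local Notation "1v" := (vac S).
Local Notation T := (transl S).
Local Notation "a _[ n ] b" := (nprod S a n b)
  (at level 37, n at level 200, right associativity, format "a  _[ n ]  b").

Record is_vertex_algebra : Prop := IsVertexAlgebra {
  va_linearl : forall n b, linear (fun a => a _[n] b);
  va_linearr : forall a n, linear (fun b => a _[n] b);
  va_linearT : linear T;
  va_vacl : forall n b, 1v _[n] b = if n == -1 then b else 0;
  va_vacr : forall a (n : nat), a _[n%:Z] 1v = 0;
  va_create : forall a, a _[-1] 1v = a;
  va_trunc : forall a b, exists N : int, forall n, N <= n -> a _[n] b = 0;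
  va_Tvac : T 1v = 0;
  va_commT : forall a n b, T (a _[n] b) - a _[n] (T b) = (T a) _[n] b;
  va_Tderiv : forall a n b, (T a) _[n] b = - (a _[n - 1] b *~ n);
  va_borcherds : forall a b c (m n q : int),
    \sum_(i \in [set: nat])
       ((a _[q + i%:Z] b) _[m + n - i%:Z] c) *~ binz m i =
    \sum_(i \in [set: nat])
       (a _[m + q - i%:Z] (b _[n + i%:Z] c)
        - (b _[n + q - i%:Z] (a _[m + i%:Z] c)) *~ (-1) ^+ `|q|%N)
       *~ ((-1) ^+ i * binz q i)
}.

Record is_va_automorphism (phi : V -> V) : Prop := IsVAAutomorphism {
  vaut_linear : linear phi;
  vaut_bij : bijective phi;
  vaut_vac : phi 1v = 1v;
  vaut_T : forall a, phi (T a) = T (phi a);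
  vaut_nprod : forall a n b, phi (a _[n] b) = (phi a) _[n] (phi b)
}.

End VertexAlgebra.

Section Tensor.
Variables (R : comPzRingType) (M : zmodType).

(* [R (x)_Z M] is the set of formal sums of pure tensors modulo the congruence
   generated by biadditivity. *)
Inductive tens_rel : seq (R * M) -> seq (R * M) -> Prop :=
| TensRefl s : tens_rel s s
| TensSym s t : tens_rel s t -> tens_rel t s
| TensTrans s t u : tens_rel s t -> tens_rel t u -> tens_rel s u
| TensCat s1 s2 t1 t2 :
    tens_rel s1 t1 -> tens_rel s2 t2 -> tens_rel (s1 ++ s2) (t1 ++ t2)
| TensSwap s t : tens_rel (s ++ t) (t ++ s)
| TensDl r r' a : tens_rel [:: (r + r', a)] [:: (r, a); (r', a)]
| TensDr r a a' : tens_rel [:: (r, a + a')] [:: (r, a); (r, a')]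
| Tens0 a : tens_rel [:: (0, a)] [::].

Definition tens_eqv : rel (seq (R * M)) := fun s t => `[< tens_rel s t >].

Lemma tens_eqv_equiv : equiv_class_of tens_eqv.
Proof.
split=> [s|s t|s t u].
- by apply/asboolP; apply: TensRefl.
- by apply/asboolP/asboolP; apply: TensSym.
- by move=> /asboolP st /asboolP tu; apply/asboolP; apply: TensTrans st tu.
Qed.

Canonical tens_equiv := EquivRelPack tens_eqv_equiv.

Definition tensor := {eq_quot tens_eqv}.
HB.instance Definition _ := Choice.on tensor.
HB.instance Definition _ := EqQuotient.on tensor.

Lemma eq_tensP s t : \pi_tensor s = \pi_tensor t <-> tens_rel s t.
Proof.
split=> [/eqP|st]; first by rewrite eqmodE => /asboolP.
by apply/eqP; rewrite eqmodE; apply/asboolP.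
Qed.

Lemma repr_tens s : tens_rel (repr (\pi_tensor s)) s.
Proof. by apply/eq_tensP; rewrite reprK. Qed.

Definition tscale_seq (c : R) (s : seq (R * M)) := [seq (c * p.1, p.2) | p <- s].

Lemma tscale_seq_rel c s t :
  tens_rel s t -> tens_rel (tscale_seq c s) (tscale_seq c t).
Proof.
elim=> {s t} /=.
- by move=> s; apply: TensRefl.
- by move=> s t _; apply: TensSym.
- by move=> s t u _ st _; apply: TensTrans st.
- move=> s1 s2 t1 t2 _ h1 _ h2.
  by rewrite /tscale_seq !map_cat; apply: TensCat.
- by move=> s t; rewrite /tscale_seq !map_cat; apply: TensSwap.
- by move=> r r' a; rewrite mulrDr; apply: TensDl.
- by move=> r a a'; apply: TensDr.
- by move=> a; rewrite mulr0; apply: Tens0.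
Qed.

Definition tzero : tensor := \pi_tensor [::].
Definition tadd (x y : tensor) : tensor := \pi_tensor (repr x ++ repr y).
Definition tscale (c : R) (x : tensor) : tensor :=
  \pi_tensor (tscale_seq c (repr x)).
Definition topp (x : tensor) : tensor := tscale (-1) x.
Definition pure (r : R) (a : M) : tensor := \pi_tensor [:: (r, a)].

Lemma tadd_pi s t : tadd (\pi_tensor s) (\pi_tensor t) = \pi_tensor (s ++ t).
Proof. by apply/eq_tensP; apply: TensCat; apply: repr_tens. Qed.

Lemma tscale_pi c s : tscale c (\pi_tensor s) = \pi_tensor (tscale_seq c s).
Proof. by apply/eq_tensP/tscale_seq_rel/repr_tens. Qed.

Lemma tens_ind (P : tensor -> Prop) :
  (forall s, P (\pi_tensor s)) -> forall x, P x.
Proof. by move=> hP x; rewrite -[x]reprK. Qed.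

Lemma tens_pull p s t : tens_rel (s ++ p :: t) (p :: s ++ t).
Proof.
rewrite -[p :: t]/([:: p] ++ t) catA -[p :: s ++ t]/(([:: p] ++ s) ++ t).
by apply: TensCat; [apply: TensSwap | apply: TensRefl].
Qed.

Lemma taddA : associative tadd.
Proof.
elim/tens_ind=> s; elim/tens_ind=> t; elim/tens_ind=> u.
by rewrite !tadd_pi catA.
Qed.

Lemma taddC : commutative tadd.
Proof.
elim/tens_ind=> s; elim/tens_ind=> t; rewrite !tadd_pi.
exact/eq_tensP/TensSwap.
Qed.

Lemma tadd0 : left_id tzero tadd.
Proof. by elim/tens_ind=> s; rewrite tadd_pi. Qed.

Lemma taddN : left_inverse tzero topp tadd.
Proof.
elim/tens_ind=> s; rewrite /topp tscale_pi tadd_pi; apply/eq_tensP.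
elim: s => [|[r a] s IHs] /=; first exact: TensRefl.
apply: (@TensTrans _ ([:: (-1 * r, a); (r, a)] ++ (tscale_seq (-1) s ++ s))).
  apply: (@TensCat [:: _] _ [:: _]); first exact: TensRefl.
  exact: tens_pull.
apply: (@TensTrans _ ([::] ++ [::])); last exact: TensRefl.
apply: TensCat => //.
apply: TensTrans (TensSym (TensDl _ _ _)) _.
by rewrite mulN1r addNr; apply: Tens0.
Qed.

HB.instance Definition _ :=
  GRing.isZmodule.Build tensor taddA taddC tadd0 taddN.

Lemma tscaleA c d x : tscale c (tscale d x) = tscale (c * d) x.
Proof.
elim/tens_ind: x => s; rewrite !tscale_pi /tscale_seq -map_comp.
by congr (\pi_tensor _); apply: eq_map => p /=; rewrite mulrA.
Qed.

Lemma tscale1 : left_id 1 tscale.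
Proof.
elim/tens_ind=> s; rewrite tscale_pi; congr (\pi_tensor _).
by rewrite /tscale_seq -[RHS]map_id; apply: eq_map => -[r a]; rewrite mul1r.
Qed.

Lemma tscaleDr : right_distributive tscale +%R.
Proof.
move=> c; elim/tens_ind=> s; elim/tens_ind=> t.
by rewrite [_ + _]tadd_pi !tscale_pi [RHS]tadd_pi /tscale_seq map_cat.
Qed.

Lemma tscaleDl x : {morph tscale^~ x : c d / c + d}.
Proof.
move=> c d; elim/tens_ind: x => s; rewrite !tscale_pi [RHS]tadd_pi.
apply/eq_tensP; elim: s => [|[r a] s IHs] /=; first exact: TensRefl.
apply: (@TensTrans _ ([:: (c * r, a); (d * r, a)] ++
                      (tscale_seq c s ++ tscale_seq d s))).
  apply: (@TensCat [:: _] _ [:: _; _]) => //.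
  by rewrite mulrDl; apply: TensDl.
apply: (@TensCat [:: _] _ [:: _]); first exact: TensRefl.
exact/TensSym/tens_pull.
Qed.

HB.instance Definition _ :=
  GRing.Zmodule_isLmodule.Build R tensor tscaleA tscale1 tscaleDr tscaleDl.

(* The additive map out of the tensor product determined by its values
   [f r a] on pure tensors; meaningful when [f] is biadditive, in which case
   it does not depend on the representative ([tens_lift_pure]). *)
Definition tens_lift (W : zmodType) (f : R -> M -> W) (x : tensor) : W :=
  \sum_(p <- repr x) f p.1 p.2.

Section Lift.
Variables (W : zmodType) (f : R -> M -> W).
Hypothesis fDl : forall r r' a, f (r + r') a = f r a + f r' a.
Hypothesis fDr : forall r a a', f r (a + a') = f r a + f r a'.

Lemma tens_lift_pi s : tens_lift f (\pi_tensor s) = \sum_(p <- s) f p.1 p.2.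
Proof.
rewrite /tens_lift; move: (repr (\pi_tensor s)) (repr_tens s) => u us.
elim: us => {s u} //=.
- by move=> s t u _ -> _ ->.
- by move=> s1 s2 t1 t2 _ h1 _ h2; rewrite !big_cat /= h1 h2.
- by move=> s t; rewrite !big_cat /= addrC.
- by move=> r r' a; rewrite !big_cons !big_nil /= !addr0 fDl.
- by move=> r a a'; rewrite !big_cons !big_nil /= !addr0 fDr.
- move=> a; rewrite big_cons !big_nil addr0 /=.
  by apply: (@addrI _ (f 0 a)); rewrite -fDl !addr0.
Qed.

Lemma tens_lift_pure r a : tens_lift f (pure r a) = f r a.
Proof. by rewrite tens_lift_pi big_seq1. Qed.

Lemma tens_liftD : {morph tens_lift f : x y / x + y}.
Proof.
elim/tens_ind=> s; elim/tens_ind=> t.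
by rewrite [_ + _]tadd_pi !tens_lift_pi big_cat.
Qed.
End Lift.

End Tensor.

Arguments pure {R M} r a.

(* [id_R (x) f] for an additive map [f]. *)
Definition tens_map (R : comPzRingType) (M N : zmodType) (f : M -> N) :
    tensor R M -> tensor R N :=
  tens_lift (fun r a => pure r (f a)).

(* For a vertex algebra structure on the abelian group [M], the R-bilinear
   structure on [R (x) M] with (r (x) a)_n (s (x) b) = rs (x) a_n b. *)
Definition base_change (R : comPzRingType) (M : zmodType) (S : vertex_ops M) :
    vertex_ops (tensor R M) :=
  VertexOps (pure 1 (vac S)) (tens_map (transl S))
    (fun x n y =>
       tens_lift (fun r a => tens_lift (fun s b => pure (r * s) (nprod S a n b)) y)
         x).

Inductive zspan (V : zmodType) (P : V -> Prop) : V -> Prop :=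
| ZspanGen v : P v -> zspan P v
| Zspan0 : zspan P 0
| ZspanB u v : zspan P u -> zspan P v -> zspan P (u - v).

Record subz (V : zmodType) (S : zmodClosed V) :=
  Subz { subz_val : V; _ : subz_val \in S }.

Section SubZ.
Variables (V : zmodType) (S : zmodClosed V).
HB.instance Definition _ := [isSub for @subz_val V S].
HB.instance Definition _ := [Choice of subz S by <:].
HB.instance Definition _ := [SubChoice_isSubZmodule of subz S by <:].

(* [v] as an element of the subgroup [S] ([0] if [v] is not in [S]). *)
Definition to_sub (v : V) : subz S := insubd 0 v.
End SubZ.

Section Lattice.
Variables (K : fieldType) (l : nat) (A : 'M[int]_l).

(* The lattice is Z^l with Gram matrix [A]. *)
Local Notation L := 'rV[int]_l.
Definition lat_form (x y : L) : int := (x *m A *m y^T) 0 0.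
Definition simple (i : 'I_l) : L := delta_mx 0 i.

(* A 2-cocycle [L x L -> {1, -1}], written additively, normalized and with
   commutator map (-1)^(a, b). *)
Record is_cocycle (eps : L -> L -> bool) : Prop := IsCocycle {
  cocycle_0l : forall a, eps 0 a = false;
  cocycle_0r : forall a, eps a 0 = false;
  cocycleP : forall a b c,
    eps a b (+) eps (a + b) c = eps b c (+) eps a (b + c);
  cocycle_comm : forall a b, eps a b (+) eps b a = odd `|lat_form a b|%N
}.

(* The basis of [S(h^-) (x) K{L}]: the pair [(m, b)] is the product of the
   [alpha_i(- k - 1)] over the [(i, k)] in the multiset [m], tensored with
   [e^b]. *)
Definition osc := ('I_l * nat)%type.
Definition fock_index := ({mset osc}%mset * L)%type.
Definition VL := {malg K[fock_index]}.

HB.instance Definition _ := GRing.Lmodule.on VL.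

Definition bvec (b : fock_index) : VL := << b >>.
Definition expv (a : L) : VL := bvec (mset0, a).

Definition linext (W : lmodType K) (f : fock_index -> W) (v : VL) : W :=
  \sum_(b <- msupp v) v@_b *: f b.

(* The action of the operator [alpha_i(n)]: multiplication by a generator for
   [n < 0], and [n] times the derivation with
   [alpha_j(-n) |-> (alpha_i, alpha_j)] for [n > 0]. *)
Definition heis_basis (i : 'I_l) (n : int) (b : fock_index) : VL :=
  match n with
  | Negz k => bvec (msetD (msetn 1%N (i, k)) b.1, b.2)
  | Posz 0 => (lat_form (simple i) b.2)%:~R *: bvec b
  | Posz k.+1 =>
      \sum_(j < l) (A i j * (k.+1 * b.1 (j, k))%N%:Z)%:~R *:
        bvec (msetB b.1 (msetn 1%N (j, k)), b.2)
  end.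
Definition heis (i : 'I_l) (n : int) : VL -> VL := linext (heis_basis i n).

(* [alpha(n)] *)
Definition heisL (a : L) (n : int) (v : VL) : VL :=
  \sum_(i < l) (a 0 i)%:~R *: heis i n v.

(* [exp_coef D n] is the coefficient of [z^n] in [exp (\sum_(m > 0) D m z^m)],
   and [pow_coef D p n] that of the [p]-th power of the exponent. *)
Fixpoint pow_coef (D : nat -> VL -> VL) (p n : nat) (v : VL) : VL :=
  if p is p'.+1 then \sum_(1 <= m < n.+1) D m (pow_coef D p' (n - m) v)
  else if n == 0%N then v else 0.
Definition exp_coef (D : nat -> VL -> VL) (n : nat) (v : VL) : VL :=
  \sum_(0 <= p < n.+1) (p`!%:R)^-1 *: pow_coef D p n v.

(* Multiplication by [s_{alpha,n}]. *)
Definition schur (a : L) : nat -> VL -> VL :=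
  exp_coef (fun m v => m%:R^-1 *: heisL a (- m%:Z) v).

(* The coefficient of [z^(-n)] in [exp (- \sum_(m > 0) alpha(m)/m z^(-m))]. *)
Definition annih (a : L) : nat -> VL -> VL :=
  exp_coef (fun m v => - (m%:R^-1 *: heisL a m%:Z v)).

Variable eps : L -> L -> bool.

(* The modes of
   [Y(e^a, z) = exp (\sum_(m>0) a(-m)/m z^m) exp (- \sum_(m>0) a(m)/m z^(-m))
                e^a z^(a(0))];
   the terms [z^i] and [z^(-j)] of the exponentials contribute to
   [z^(-n-1)] on the [b]-component when [i - j + (a, b) = - n - 1]. *)
Definition Yexp_basis (a : L) (n : int) (b : fock_index) : VL :=
  (-1) ^+ eps a b.2 *:
  \sum_(j \in [set: nat])
    (if j%:Z - n - 1 - lat_form a b.2 is Posz i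
     then schur a i (annih a j (bvec (b.1, a + b.2))) else 0).
Definition Yexp (a : L) (n : int) : VL -> VL := linext (Yexp_basis a n).

(* The modes of the normally ordered product of
   [1/k! (d/dz)^k alpha_i(z)] with the field of modes [B]. *)
Definition normal_ordered (ik : osc) (B : int -> VL -> VL) : int -> VL -> VL :=
  fun m v => let: (i, k) := ik in
  \sum_(j \in [set: nat])
    (heis i (- (k + j).+1%:Z) (B (m + j%:Z) v)
     + (-1) ^+ k *: B (m - k.+1%:Z - j%:Z) (heis i j%:Z v)) *+ 'C(k + j, k).

Definition Y_basis (b : fock_index) : int -> VL -> VL :=
  foldr normal_ordered (Yexp b.2) (enum_mset b.1).

Definition VL_nprod (a : VL) (n : int) (v : VL) : VL :=
  linext (fun b => Y_basis b n v) a.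

(* In any vertex algebra the translation operator is [a |-> a_(-2) 1]. *)
Definition VL_ops : vertex_ops VL :=
  VertexOps (expv 0) (fun a => VL_nprod a (-2) (expv 0)) VL_nprod.

Definition conf_weight (b : fock_index) : int :=
  (\sum_(ik <- enum_mset b.1) ik.2.+1)%N%:Z + (lat_form b.2 b.2 %/ 2)%Z.

(* [v] lies in [(V_L)_n]. *)
Definition homog (n : int) (v : VL) : Prop :=
  forall b, b \in msupp v -> conf_weight b = n.

Definition IV_gen (v : VL) : Prop :=
  exists (s : seq (L * nat)) (a : L),
    all (fun p => 0 < p.2)%N s /\
    v = foldr (fun p => schur p.1 p.2) (expv a) s.

Definition IV_pred : {pred VL} := fun v => `[< zspan IV_gen v >].
Definition IV1_pred : {pred VL} :=
  fun v => `[< zspan IV_gen v /\ homog 1 v >].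

Lemma IV_closed : zmod_closed IV_pred.
Proof.
split=> [|u v /asboolP hu /asboolP hv]; apply/asboolP; first exact: Zspan0.
exact: ZspanB.
Qed.

Lemma IV1_closed : zmod_closed IV1_pred.
Proof.
split=> [|u v /asboolP[hu hu1] /asboolP[hv hv1]]; apply/asboolP; split.
- exact: Zspan0.
- by move=> b; rewrite msupp0.
- exact: ZspanB.
- move=> b /(fsubsetP (msuppB_le u v)); rewrite in_fsetU => /orP[].
    exact: hu1.
  exact: hv1.
Qed.

HB.instance Definition _ := GRing.isZmodClosed.Build VL IV_pred IV_closed.
HB.instance Definition _ := GRing.isZmodClosed.Build VL IV1_pred IV1_closed.

Definition IV := subz IV_pred.
HB.instance Definition _ := GRing.Zmodule.on IV.
Definition IV1 := subz IV1_pred.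
HB.instance Definition _ := GRing.Zmodule.on IV1.

(* IV_L is closed under the operations of V_L, so that these are their
   restrictions and [to_sub] never takes its default value. *)
Definition IV_ops : vertex_ops IV :=
  VertexOps (to_sub IV_pred (vac VL_ops))
    (fun a => to_sub IV_pred (transl VL_ops (\val a)))
    (fun a n b => to_sub IV_pred (nprod VL_ops (\val a) n (\val b))).

Definition IV1_incl (v : IV1) : IV := to_sub IV_pred (\val v).

Inductive is_root : L -> Prop :=
| RootSimple i : is_root (simple i)
| RootRefl a i : is_root a -> is_root (a - lat_form a (simple i) *: simple i).

(* [e] is the family of root vectors of a Chevalley basis of (V_L)_1 with
   simple coroots [alpha_i(-1) 1] and Z-span (IV_L)_1; only its values on roots
   matter. The structure constants are signs because all root strings have
   length at most two in the simply laced case. *)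
Record is_chevalley_basis (e : L -> VL) : Prop := IsChevalleyBasis {
  chev_root_space : forall a, is_root a ->
    homog 1 (e a) /\
    forall i, VL_nprod (heis i (-1) (expv 0)) 0 (e a) =
              (lat_form (simple i) a)%:~R *: e a;
  chev_coroot : forall a, is_root a ->
    VL_nprod (e a) 0 (e (- a)) = heisL a (-1) (expv 0);
  chev_sum : forall a b, is_root a -> is_root b -> is_root (a + b) ->
    exists s : bool, VL_nprod (e a) 0 (e b) = (-1) ^+ s *: e (a + b);
  chev_span : forall v,
    v \in IV1_pred <->
    zspan (fun w => (exists i, w = heis i (-1) (expv 0)) \/
                    (exists2 a, is_root a & w = e a)) v
}.

Variables (R : comPzRingType) (e : L -> VL).

(* (ad e_a)^k / k! for the bracket a_0 b; it preserves the Chevalley Z-form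
   (IV_L)_1, so [to_sub] never takes its default value. *)
Definition ad_divpow (a : L) (k : nat) (v : IV1) : IV1 :=
  to_sub IV1_pred ((k`!%:R)^-1 *: iter k (VL_nprod (e a) 0) (\val v)).

Definition x_root (a : L) (t : R) : tensor R IV1 -> tensor R IV1 :=
  tens_lift (fun r v =>
    \sum_(k \in [set: nat]) pure (t ^+ k * r) (ad_divpow a k v)).

Inductive chevalley_group : (tensor R IV1 -> tensor R IV1) -> Prop :=
| ChevGen a t : is_root a -> chevalley_group (x_root a t)
| ChevId : chevalley_group id
| ChevComp g h :
    chevalley_group g -> chevalley_group h -> chevalley_group (g \o h)
| ChevInv g h :
    chevalley_group g -> cancel g h -> cancel h g -> chevalley_group h.

Record is_extended_action
    (Phi : (tensor R IV1 -> tensor R IV1) -> tensor R IV -> tensor R IV) :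
    Prop := IsExtendedAction {
  ext_aut : forall g, chevalley_group g ->
    is_va_automorphism (base_change R IV_ops) (Phi g);
  ext_id : forall x, Phi id x = x;
  ext_comp : forall g h, chevalley_group g -> chevalley_group h ->
    forall x, Phi (g \o h) x = Phi g (Phi h x);
  ext_extends : forall g, chevalley_group g ->
    forall u, Phi g (tens_map IV1_incl u) = tens_map IV1_incl (g u)
}.

End Lattice.

Arguments IV_ops K {l} A eps.
Arguments is_chevalley_basis {K l} A eps e.
Arguments chevalley_group {K l} A eps R e g : rename.
Arguments is_extended_action {K l} A eps R e Phi.

Inductive ade_type := TypeA of nat | TypeD of nat | TypeE of nat.

Definition ade_rank (X : ade_type) : nat :=
  match X with TypeA n | TypeD n | TypeE n => n end.

Definition ade_wf (X : ade_type) : bool :=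
  match X with
  | TypeA n => 1 <= n
  | TypeD n => 4 <= n
  | TypeE n => 6 <= n <= 8
  end%N.

(* Edges [i -- j], [i < j], of the Dynkin diagram on [0, ..., n - 1]. Type A is
   a path; in types D and E the nodes [0, ..., n - 2] lat_form a path and the node
   [n - 1] is attached to the node [n - 3], resp. [2]. *)
Definition dynkin_edge (X : ade_type) (i j : nat) : bool :=
  match X with
  | TypeA _ => j == i.+1
  | TypeD n => if j == n.-1 then i == n - 3 else j == i.+1
  | TypeE n => if j == n.-1 then i == 2 else j == i.+1
  end%N.

Definition cartan (X : ade_type) : 'M[int]_(ade_rank X) :=
  \matrix_(i, j)
    if i == j then 2
    else if dynkin_edge X i j || dynkin_edge X j i then -1 else 0.

(* Main.v *)
(* The modes of Y(e^a, z) and of the Heisenberg fields are pairwise local and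
   covariant under a translation operator; by Dong's lemma and Goddard's
   uniqueness argument V_L satisfies the Borcherds identity. The recursion
   n s_(a,n) = sum_(0 < m <= n) a(-m) s_(a,n-m) for the Schur operators shows
   that the integral form is stable under all products and is generated by the
   e^(+-alpha_i); hence it is a vertex algebra over Z, and so is its base change.

   Uniqueness: an automorphism of R (x) IV_L is determined by its values on the
   weight one part, which contains the generators e^(+-alpha_i).

   Existence: comparing weights and coefficients, every Chevalley vector is
   e_a = +- e^a. The form is positive definite, for otherwise some
   alpha_i(-1)^n e^x would have weight one without being in the span of the
   Chevalley basis. So root strings are short, and the divided powers of the
   derivation (e_a)_0 preserve (IV_L)_1 and are locally nilpotent on the e^b,
   b a root; by the Leibniz rule they are so on all of IV_L. Thus
   sum_k t^k (e_a)_0^k / k! is an automorphism of R (x) IV_L extending x_a(t).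
   Extensions of generators extend to the whole group by composition and
   inversion, and uniqueness turns them into an action. *)
Require Import Defs.
From HB Require Import structures.
From mathcomp Require Import all_boot all_order all_algebra.
From mathcomp Require Import finmap multiset monalg.
From mathcomp Require Import boolp classical_sets cardinality fsbigop reals complex.
From mathcomp Require Import zify ring.

Set Implicit Arguments.
Unset Strict Implicit.
Unset Printing Implicit Defensive.

Import Order.TTheory GRing.Theory Num.Theory.
Local Open Scope ring_scope.

(** Fields are bare families of modes [int -> V -> V], and a product of two fields is a double
    family of coefficients on which multiplication by z - w is the difference operator [zmw].
    Locality, Dong's lemma and both sides of the Borcherds identity thus become statements about the
    two expansions [iota_zw] and [iota_wz] of (z - w)^q, which coincide once q is nonnegative.

    The main obstacle is division. R may have torsion, so the exponential of t e_a(0) makes sense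
    only through divided powers. These are formed over the field, where the Leibniz and binomial
    identities follow by cancelling factorials, and are transferred to R through the integral form
    that they preserve. The Schur operators are never expanded either: they enter through the
    recursion n E_n = sum d_m E_(n-m), and integrality comes from the integer binomial coefficients
    met when the two halves of a vertex operator are interchanged.

    The Chevalley vectors are known only through axioms; it is the coroot relation that forces their
    integer coefficients to be signs. *)

Local Notation fsum F := (\sum_(i \in [set: nat]) F i).

(** * Finitely supported sums and additive maps *)

Section FiniteSupportSums.
Variable V : zmodType.
Implicit Types F G : nat -> V.

Definition vanishing F := exists N, forall i, (N <= i)%N -> F i = 0.

Lemma fsumE N F :
  (forall i, (N <= i)%N -> F i = 0) -> fsum F = \sum_(0 <= i < N) F i.
Proof.
move=> F0; rewrite (fsbigTE [fset i in index_iota 0 N]%fset) => [|i].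
  apply: perm_big; apply: uniq_perm; rewrite ?fset_uniq ?iota_uniq // => i.
  by rewrite !inE.
by rewrite !inE mem_index_iota -leqNgt => /F0.
Qed.

Lemma fsum_ext F G : F =1 G -> fsum F = fsum G.
Proof. by move=> /funext ->. Qed.

Lemma fsum0 F : (forall i, F i = 0) -> fsum F = 0.
Proof. by move=> F0; rewrite (@fsumE 0) // big_geq. Qed.

Lemma fsum1 F j : (forall i, i != j -> F i = 0) -> fsum F = F j.
Proof.
move=> F0; rewrite (@fsumE j.+1) => [|i ji]; last by apply: F0; lia.
rewrite big_nat_recr //= big_nat big1 ?add0r // => i /andP[_ ij].
by apply: F0; lia.
Qed.

Lemma vanishingD F G :
  vanishing F -> vanishing G -> vanishing (fun i => F i + G i).
Proof.
move=> [N hN] [M hM]; exists (maxn N M) => i; rewrite geq_max => /andP[hi hj].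
by rewrite hN ?hM ?addr0.
Qed.

Lemma vanishingN F : vanishing F -> vanishing (fun i => - F i).
Proof. by move=> [N hN]; exists N => i hi; rewrite hN ?oppr0. Qed.

Lemma vanishingZ F (c : nat -> int) :
  vanishing F -> vanishing (fun i => F i *~ c i).
Proof. by move=> [N hN]; exists N => i hi; rewrite hN ?mul0rz. Qed.

Lemma vanishingS F : vanishing F -> vanishing (fun i => F i.+1).
Proof. by move=> [N hN]; exists N => i hi; rewrite hN //; lia. Qed.

Lemma fsumD F G : vanishing F -> vanishing G ->
  fsum (fun i => F i + G i) = fsum F + fsum G.
Proof.
move=> [N hN] [M hM]; rewrite !(@fsumE (maxn N M)) -?big_split //= => i;
  rewrite geq_max => /andP[hi hj]; by rewrite ?hN ?hM ?addr0.
Qed.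

(** Negation does not change the support, so both sums range over the same finite set; for an
    infinite support both are empty by convention. *)
Lemma fsumN F : fsum (fun i => - F i) = - fsum F.
Proof.
rewrite -sumrN; suff -> : finite_support 0 [set: nat] (fun i => - F i) =
  finite_support 0 [set: nat] F by [].
rewrite /finite_support; congr (locked_with _ (fset_set _)).
rewrite !setTI; apply/seteqP; split=> i /=; apply: contra_not.
  by move=> ->; rewrite oppr0.
by move/eqP; rewrite oppr_eq0 => /eqP.
Qed.

Lemma fsumB F G : vanishing F -> vanishing G ->
  fsum (fun i => F i - G i) = fsum F - fsum G.
Proof.
by move=> hF hG; rewrite fsumD ?fsumN //; apply: vanishingN.
Qed.

Lemma fsum_recl F : vanishing F -> fsum F = F 0%N + fsum (fun i => F i.+1).
Proof.
move=> [N hN]; rewrite (@fsumE N.+1); last by move=> i hi; apply: hN; lia.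
by rewrite big_nat_recl // (@fsumE N) // => i hi; apply: hN; lia.
Qed.

Lemma fsum_shift k F :
  (forall i, (i < k)%N -> F i = 0) -> vanishing F ->
  fsum F = fsum (fun i => F (i + k)%N).
Proof.
elim: k F => [|k IHk] F F0 hF; first by apply: fsum_ext => i; rewrite addn0.
rewrite fsum_recl // F0 // add0r IHk; last exact: vanishingS.
  by apply: fsum_ext => i; rewrite addnS.
by move=> i ik; apply: F0.
Qed.

Lemma zspan_fsum (P : V -> Prop) F :
  (forall i, zspan P (F i)) -> zspan P (fsum F).
Proof.
move=> hF; elim/big_ind: _ => // [|u v hu hv]; first exact: Zspan0.
rewrite -[v]opprK -[- v]sub0r; apply: ZspanB => //.
by apply: ZspanB => //; apply: Zspan0.
Qed.

End FiniteSupportSums.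

Section AdditiveFunctions.
Variables V W : zmodType.
Implicit Types phi : V -> W.

(* Unbundled additivity, as the operators below come as plain functions. *)
Definition addf phi := forall x y, phi (x - y) = phi x - phi y.

Variables (phi : V -> W) (hphi : addf phi).
Lemma addf0 : phi 0 = 0. Proof. by rewrite -[0]subr0 hphi !subrr. Qed.
Lemma addfN x : phi (- x) = - phi x.
Proof. by rewrite -sub0r hphi addf0 sub0r. Qed.
Lemma addfD x y : phi (x + y) = phi x + phi y.
Proof. by rewrite -[y]opprK hphi addfN !opprK. Qed.
Lemma addf_sum I (r : seq I) P (F : I -> V) :
  phi (\sum_(i <- r | P i) F i) = \sum_(i <- r | P i) phi (F i).
Proof. by apply: big_morph; [apply: addfD | apply: addf0]. Qed.
Lemma addfMn x n : phi (x *+ n) = phi x *+ n.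
Proof. by elim: n => [|n IHn]; rewrite ?addf0 // !mulrS addfD IHn. Qed.
Lemma addfMz x z : phi (x *~ z) = phi x *~ z.
Proof. by case: z => n; rewrite /intmul ?addfN addfMn. Qed.
Lemma addf_fsum F : vanishing F -> phi (fsum F) = fsum (fun i => phi (F i)).
Proof.
move=> [N hN]; rewrite !(@fsumE _ N) ?addf_sum // => i hi.
by rewrite hN ?addf0.
Qed.
Lemma vanishing_addf F : vanishing F -> vanishing (fun i => phi (F i)).
Proof. by move=> [N hN]; exists N => i hi; rewrite hN ?addf0. Qed.
End AdditiveFunctions.

Lemma addf_comp (U V W : zmodType) (f : V -> W) (g : U -> V) :
  addf f -> addf g -> addf (f \o g).
Proof. by move=> hf hg x y; rewrite /= hg hf. Qed.

(** * Integer binomial coefficients and the expansions of (z - w)^q *)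

Section Binomials.

Lemma binz0 q : binz q 0 = 1.
Proof. by case: q => k; rewrite /= bin0 ?mul1r. Qed.

Lemma binz_nat (k i : nat) : binz k%:Z i = 'C(k, i)%:Z.
Proof. by []. Qed.

Lemma binzS q i : binz (q + 1) i.+1 = binz q i.+1 + binz q i.
Proof.
case: q => k; first by rewrite -PoszD addn1 !binz_nat binS PoszD.
rewrite NegzE; case: k => [|k].
  (* q = -1 is the only place where q + 1 passes from [Negz] to [Posz]. *)
  have -> : (- 1%N%:Z + 1 : int) = 0%N by lia.
  rewrite binz_nat bin0n /= !add0n !binn !mulr1 exprS.
  by rewrite mulN1r addrC subrr.
have -> : (- k.+2%:Z + 1 : int) = Negz k by rewrite NegzE; lia.
rewrite -[- k.+2%:Z]/(Negz k.+1) /= !addnS !addSn (binS (k + i).+1) exprS.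
by rewrite PoszD; ring.
Qed.

(** The coefficient form of the derivative of (1 + x)^q. It is behind the compatibility of (z - w)^q
    with derivations and the recursion for the coefficients of (1 - x)^q. *)
Lemma binz_absorb q i : binz q i.+1 *+ i.+1 = (q - i%:Z) * binz q i.
Proof.
case: q => k; rewrite -mulr_natr natz /=.
  have [ik|ki] := leqP i k; last by rewrite !bin_small //; [rewrite mulr0 mul0r|lia].
  rewrite subzn // -!PoszM; congr Posz.
  by rewrite mulnC mul_bin_left.
have -> : (Negz k - i%:Z : int) = - (k + i).+1%:Z by rewrite NegzE; lia.
have h := mul_bin_diag (k + i).+1 i.
have : ('C(k + i.+1, i.+1) * i.+1 = (k + i).+1 * 'C(k + i, i))%N.
  by rewrite addnS mulnC -h.
move=> /(congr1 Posz); rewrite !PoszM => e.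
rewrite exprS; transitivity (-1 * (-1) ^+ i * ('C(k + i.+1, i.+1)%:Z * i.+1%:Z)).
  ring.
by rewrite e; ring.
Qed.

End Binomials.

(* The calculus of (z - w)^q: a family f m n stands for the formal
   distribution with these coefficients, multiplication by z (resp. w)
   being a shift of m (resp. n). *)
Section IotaCalculus.
Variable V : zmodType.
Implicit Types f g : int -> int -> V.

Definition zmw f : int -> int -> V := fun m n => f (m + 1) n - f m (n + 1).
Definition swap f : int -> int -> V := fun m n => f n m.
Definition sub2 f g : int -> int -> V := fun m n => f m n - g m n.

(* Multiplication by (z - w)^q expanded in nonnegative powers of w, resp. z. *)
Definition iota_zw (q : int) f : int -> int -> V := fun m n =>
  fsum (fun i : nat => f (m + q - i%:Z) (n + i%:Z) *~ ((-1) ^+ i * binz q i)).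
Definition iota_wz (q : int) f : int -> int -> V := fun m n =>
  iota_zw q (swap f) n m *~ (-1) ^+ `|q|%N.

(** Truncation in one index, uniformly in the other: this makes the sums of [iota_zw] finite, as
    [trunc1] does for [iota_wz]. *)
Definition trunc2 f := exists N : int, forall m n, N <= n -> f m n = 0.
Definition trunc1 f := trunc2 (swap f).

Lemma trunc2_vanishing f m n (c : nat -> int) : trunc2 f ->
  vanishing (fun i : nat => f (m - i%:Z) (n + i%:Z) *~ c i).
Proof.
move=> [N hN]; exists `|N - n|%N => i hi; rewrite hN ?mul0rz //; lia.
Qed.

Lemma trunc2_zmw f : trunc2 f -> trunc2 (zmw f).
Proof.
by move=> [N hN]; exists N => m n hn; rewrite /zmw !hN ?subr0 //; lia.
Qed.

Lemma trunc1_zmw f : trunc1 f -> trunc1 (zmw f).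
Proof.
move=> [N hN]; exists N => m n hn; rewrite /swap /zmw.
have h i j : N <= i -> f i j = 0 by apply: hN.
by rewrite !h ?subr0 //; lia.
Qed.

Lemma trunc2_iter k f : trunc2 f -> trunc2 (iter k zmw f).
Proof. by move=> hf; elim: k => //= k /trunc2_zmw. Qed.

Lemma trunc1_iter k f : trunc1 f -> trunc1 (iter k zmw f).
Proof. by move=> hf; elim: k => //= k /trunc1_zmw. Qed.

Lemma iota_zw0 f : iota_zw 0 f = f.
Proof.
apply/funext => m; apply/funext => n; rewrite /iota_zw.
rewrite (@fsum1 _ _ 0%N) => [|[//|i _]].
  by rewrite binz0 mulr1 mulr1z; congr f; lia.
by rewrite binz_nat bin0n mulr0 mulr0z.
Qed.

Lemma zmw_iota_zw q f : trunc2 f -> zmw (iota_zw q f) = iota_zw q (zmw f).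
Proof.
move=> hf; apply/funext => m; apply/funext => n; rewrite /zmw /iota_zw -fsumB.
- apply: fsum_ext => i; rewrite -mulrzBl; congr ((f _ _ - f _ _) *~ _); ring.
- exact: trunc2_vanishing.
- exact: trunc2_vanishing.
Qed.

(** (z - w)^(q+1) = (z - w)^q (z - w), by Pascal's rule for integer upper entries. *)
Lemma iota_zwS q f : trunc2 f -> iota_zw (q + 1) f = iota_zw q (zmw f).
Proof.
move=> hf; apply/funext => m; apply/funext => n.
rewrite /iota_zw fsum_recl; last exact: trunc2_vanishing.
have h1 : vanishing (fun i : nat => f (m + q + 1 - i%:Z) (n + i%:Z)
    *~ ((-1) ^+ i * binz q i)) by exact: trunc2_vanishing.
have h2 : vanishing (fun i : nat => f (m + q - i%:Z) (n + 1 + i%:Z)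
    *~ ((-1) ^+ i * binz q i)) by exact: trunc2_vanishing.
transitivity (fsum (fun i : nat => f (m + q + 1 - i%:Z) (n + i%:Z)
    *~ ((-1) ^+ i * binz q i)) - fsum (fun i : nat =>
    f (m + q - i%:Z) (n + 1 + i%:Z) *~ ((-1) ^+ i * binz q i))).
  rewrite [X in _ = X - _]fsum_recl // -[RHS]addrA !binz0.
  congr (f _ _ *~ _ + _); first lia.
  rewrite -fsumB //; last exact: (vanishingS h1).
  apply: fsum_ext => i; rewrite binzS exprS.
  have -> : m + (q + 1) - i.+1%:Z = m + q - i%:Z by lia.
  have -> : m + q + 1 - i.+1%:Z = m + q - i%:Z by lia.
  have -> : n + i.+1%:Z = n + 1 + i%:Z by lia.
  by rewrite -mulrzBr; congr (_ *~ _); ring.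
rewrite -fsumB //; apply: fsum_ext => i; rewrite -mulrzBl /zmw.
congr ((f _ _ - f _ _) *~ _); ring.
Qed.

Lemma iota_zw_iter q k f : trunc2 f ->
  iota_zw q (iter k zmw f) = iota_zw (q + k%:Z) f.
Proof.
elim: k q => [|k IHk] q hf; first by rewrite addr0.
rewrite iterS -iota_zwS; last exact: trunc2_iter.
by rewrite IHk // (_ : q + 1 + k%:Z = q + k.+1%:Z) //; lia.
Qed.

(** With [iota_wz_nat], this is where locality takes effect: a nonnegative power is a polynomial, so
    its two expansions are the same iterated difference. *)
Lemma iota_zw_nat (k : nat) f : trunc2 f -> iota_zw k%:Z f = iter k zmw f.
Proof.
by move=> hf; rewrite -[k%:Z]add0r -iota_zw_iter // iota_zw0.
Qed.

Lemma zmw_swap f : zmw (swap f) = fun m n => - swap (zmw f) m n.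
Proof.
by apply/funext => m; apply/funext => n; rewrite /zmw /swap opprB.
Qed.

Lemma iota_zwN q f m n : iota_zw q (fun m n => - f m n) m n = - iota_zw q f m n.
Proof.
by rewrite /iota_zw -fsumN; apply: fsum_ext => i; rewrite mulNrz.
Qed.

Lemma iota_wz0 f : iota_wz 0 f = f.
Proof.
by apply/funext => m; apply/funext => n; rewrite /iota_wz iota_zw0 mulr1z.
Qed.

Lemma signz (q : int) : (-1 : int) ^+ `|(q + 1)%R|%N = - (-1) ^+ `|q|%N.
Proof.
case: (leP 0 q) => hq.
  have -> : `|(q + 1)%R|%N = `|q|.+1 by lia.
  by rewrite exprS mulN1r.
have -> : `|q|%N = `|(q + 1)%R|.+1 by lia.
by rewrite exprS mulN1r opprK.
Qed.

Lemma zmw_iota_wz q f : trunc1 f -> zmw (iota_wz q f) = iota_wz q (zmw f).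
Proof.
move=> hf; apply/funext => m; apply/funext => n.
rewrite /zmw /iota_wz -mulrzBl; congr (_ *~ _).
have h : zmw (iota_zw q (swap f)) n m = iota_zw q (zmw (swap f)) n m.
  by rewrite zmw_iota_zw.
by rewrite -opprB [_ - _]h zmw_swap iota_zwN opprK.
Qed.

Lemma iota_wzS q f : trunc1 f -> iota_wz (q + 1) f = iota_wz q (zmw f).
Proof.
move=> hf; apply/funext => m; apply/funext => n; rewrite /iota_wz iota_zwS //.
rewrite zmw_swap iota_zwN signz mulrNz mulNrz opprK //.
Qed.

Lemma iota_wz_iter q k f : trunc1 f ->
  iota_wz q (iter k zmw f) = iota_wz (q + k%:Z) f.
Proof.
elim: k q => [|k IHk] q hf; first by rewrite addr0.
rewrite iterS -iota_wzS; last exact: trunc1_iter.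
by rewrite IHk // (_ : q + 1 + k%:Z = q + k.+1%:Z) //; lia.
Qed.

Lemma iota_wz_nat (k : nat) f : trunc1 f -> iota_wz k%:Z f = iter k zmw f.
Proof.
by move=> hf; rewrite -[k%:Z]add0r -iota_wz_iter // iota_wz0.
Qed.

Lemma iter_zmw_iota_zw k q f : trunc2 f ->
  iter k zmw (iota_zw q f) = iota_zw (q + k%:Z) f.
Proof.
move=> hf; elim: k => [|k IHk]; first by rewrite addr0.
by rewrite iterS IHk zmw_iota_zw // -iota_zwS // -addrA -PoszD addn1.
Qed.

Lemma iter_zmw_iota_wz k q f : trunc1 f ->
  iter k zmw (iota_wz q f) = iota_wz (q + k%:Z) f.
Proof.
move=> hf; elim: k => [|k IHk]; first by rewrite addr0.
by rewrite iterS IHk zmw_iota_wz // -iota_wzS // -addrA -PoszD addn1.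
Qed.

Lemma iter_zmw_sub k f g :
  iter k zmw (sub2 f g) = sub2 (iter k zmw f) (iter k zmw g).
Proof.
elim: k => //= k ->; apply/funext => m; apply/funext => n.
by rewrite /zmw /sub2 !opprD addrACA.
Qed.

Lemma iter_zmw0 k : iter k zmw (fun _ _ => 0) = (fun _ _ => 0).
Proof.
elim: k => //= k ->; apply/funext => m; apply/funext => n.
by rewrite /zmw subrr.
Qed.

Lemma iota_zw_sub q f g : trunc2 f -> trunc2 g ->
  iota_zw q (sub2 f g) = sub2 (iota_zw q f) (iota_zw q g).
Proof.
move=> hf hg; apply/funext => m; apply/funext => n.
rewrite /sub2 /iota_zw -fsumB; try exact: trunc2_vanishing.
by apply: fsum_ext => i; rewrite mulrzBl.
Qed.

Lemma iota_wz_sub q f g : trunc1 f -> trunc1 g ->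
  iota_wz q (sub2 f g) = sub2 (iota_wz q f) (iota_wz q g).
Proof.
move=> hf hg; apply/funext => m; apply/funext => n.
by rewrite /sub2 /iota_wz -mulrzBl -[_ - _]/(sub2 _ _ n m) -iota_zw_sub.
Qed.

End IotaCalculus.

Lemma iter_zmw_addf (V W : zmodType) (phi : V -> W) k (f : int -> int -> V) :
  addf phi ->
  iter k (@zmw W) (fun m n => phi (f m n)) =
  fun m n => phi (iter k (@zmw V) f m n).
Proof.
move=> hphi; elim: k => //= k ->; apply/funext => m; apply/funext => n.
by rewrite /zmw hphi.
Qed.

(** * Local fields and Dong's lemma *)

Section LocalFields.
Variable V : zmodType.
Implicit Types a b c : int -> V -> V.

Record is_field a : Prop := IsField {
  field_addf : forall n, addf (a n);
  field_trunc : forall v, exists N : int, forall n, N <= n -> a n v = 0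
}.

Definition modes a b v : int -> int -> V := fun m n => a m (b n v).
Definition commutator a b v := sub2 (modes a b v) (swap (modes b a v)).

(** The exponent is uniform in v. Dong's lemma relies on this when it applies locality to vectors
    such as [c p v] with p varying. *)
Definition local a b :=
  exists N, forall v, iter N (@zmw V) (commutator a b v) = fun _ _ => 0.

(* The modes of Res_z ((z - w)^q a(z) b(w) - (- w + z)^q b(w) a(z)). *)
Definition field_prod a (q : int) b : int -> V -> V := fun n v =>
  iota_zw q (modes a b v) 0 n - iota_wz q (swap (modes b a v)) 0 n.

Lemma trunc2_modes a b v : is_field a -> is_field b -> trunc2 (modes a b v).
Proof.
move=> ha hb; have [N hN] := field_trunc hb v; exists N => m n hn.
by rewrite /modes hN // (addf0 (field_addf ha m)).
Qed.

Lemma trunc1_modes a b v :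
  is_field a -> is_field b -> trunc1 (swap (modes b a v)).
Proof. by move=> ha hb; have := trunc2_modes v hb ha. Qed.

Lemma local_leq a b N M : (N <= M)%N ->
  (forall v, iter N (@zmw V) (commutator a b v) = fun _ _ => 0) ->
  forall v, iter M (@zmw V) (commutator a b v) = fun _ _ => 0.
Proof. by move=> NM h v; rewrite -(subnK NM) iterD h iter_zmw0. Qed.

Lemma iter_zmw_swap k (f : int -> int -> V) : iter k (@zmw V) f = (fun _ _ => 0) ->
  iter k (@zmw V) (fun m n => - f n m) = fun _ _ => 0.
Proof.
suff h : iter k (@zmw V) (fun m n => - f n m) =
    (fun m n => - (iter k (@zmw V) f n m *~ (-1) ^+ k)).
  by move=> f0; rewrite h f0; apply/funext => m; apply/funext => n;
     rewrite mul0rz oppr0.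
elim: k => [|k IHk]; first by apply/funext => m; apply/funext => n; rewrite mulr1z.
rewrite !iterS IHk; apply/funext => m; apply/funext => n.
by rewrite /zmw opprK addrC -mulrzBl exprS mulN1r mulrNz opprK.
Qed.

Lemma local_sym a b : local a b -> local b a.
Proof.
move=> [N hN]; exists N => v; rewrite -(iter_zmw_swap (hN v)).
congr iter; apply/funext => m; apply/funext => n.
by rewrite /commutator /sub2 /swap opprB.
Qed.

Lemma vanishing_modes a b v (m n : int) (c : nat -> int) :
  is_field a -> is_field b ->
  vanishing (fun i : nat => a (m - i%:Z) (b (n + i%:Z) v) *~ c i).
Proof. by move=> ha hb; apply: (trunc2_vanishing m n c (trunc2_modes v ha hb)). Qed.

Lemma field_prodE a b q n v : field_prod a q b n v =
  fsum (fun i : nat => a (q - i%:Z) (b (n + i%:Z) v) *~ ((-1) ^+ i * binz q i)) -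
  fsum (fun i : nat => b (n + q - i%:Z) (a i%:Z v) *~ ((-1) ^+ i * binz q i))
    *~ (-1) ^+ `|q|%N.
Proof.
rewrite /field_prod /iota_wz /iota_zw /modes /swap; congr (_ - _ *~ _).
by apply: fsum_ext => i; rewrite add0r.
Qed.

Lemma field_prod_field a b q : is_field a -> is_field b ->
  is_field (field_prod a q b).
Proof.
move=> ha hb; have [hA hB] := (field_addf ha, field_addf hb); split=> [n x y|v].
  rewrite /field_prod; transitivity
    (sub2 (iota_zw q (modes a b x)) (iota_zw q (modes a b y)) 0 n -
     sub2 (iota_wz q (swap (modes b a x))) (iota_wz q (swap (modes b a y))) 0 n).
    rewrite -iota_zw_sub -?iota_wz_sub;
      try exact: trunc2_modes; try exact: trunc1_modes.
    congr (iota_zw q _ 0 n - iota_wz q _ 0 n); apply/funext => k; apply/funext => p.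
      by rewrite /sub2 /modes hB hA.
    by rewrite /sub2 /modes /swap hA hB.
  by rewrite /sub2 !opprD addrACA.
have [N hN] := field_trunc hb v; have [M hM] := field_trunc ha v.
(* Only the finitely many i < M enter the second sum, so the truncation bounds for the vectors a_i v
   have a common maximum P. *)
have [P hP] : exists P : int, forall i : nat, i%:Z < M -> forall n, P <= n ->
    b n (a i%:Z v) = 0.
  have: exists P : int, forall i : nat, (i < `|M|)%N -> forall n, P <= n ->
      b n (a i%:Z v) = 0.
    elim: `|M|%N => [|k [P hP]]; first by exists 0.
    have [Q hQ] := field_trunc hb (a k%:Z v); exists (Num.max P Q) => i.
    rewrite ltnS leq_eqVlt => /orP[/eqP ->|/hP h] n; rewrite ge_max => /andP[hp hq].
      exact: hQ.
    exact: h.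
  by move=> [P hP]; exists P => i iM n hn; apply: hP => //; lia.
exists (Num.max N (P - q + `|M|)) => n; rewrite ge_max => /andP[hn hp].
rewrite field_prodE !fsum0 ?mul0rz ?subr0 // => i.
  have [hi|hi] := leP M i%:Z; first by rewrite hM // (addf0 (hB _)) mul0rz.
  by rewrite hP ?mul0rz //; lia.
by rewrite hN ?(addf0 (hA _)) ?mul0rz //; lia.
Qed.

Section Dong.
Variables (a b c : int -> V -> V) (q : int).
Hypotheses (ha : is_field a) (hb : is_field b) (hc : is_field c).

(** A family in three variables z, w, x that carries both orders of the first two fields: a to the
    left of b under [true], b to the left of a under [false]. The operators d12, d13, d23 multiply
    by z - w, z - x, w - x. *)
Let T4 := bool -> int -> int -> int -> V.
Implicit Types g : T4.
Let d12 g : T4 := fun s m n p => g s (m + 1) n p - g s m (n + 1) p.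
Let d13 g : T4 := fun s m n p => g s (m + 1) n p - g s m n (p + 1).
Let d23 g : T4 := fun s m n p => g s m (n + 1) p - g s m n (p + 1).
Let sub4 (f g : T4) : T4 := fun s m n p => f s m n p - g s m n p.
Let zero4 : T4 := fun _ _ _ _ => 0.

Let sub4ACA (x y z t : V) : (x - y) - (z - t) = (x - z) - (y - t).
Proof. by rewrite !opprD addrACA. Qed.

Let dsub (d : T4 -> T4) := forall f g, d (sub4 f g) = sub4 (d f) (d g).
Let d12_sub : dsub d12.
Proof. by move=> f g; do 4![apply/funext => ?]; apply: sub4ACA. Qed.
Let d13_sub : dsub d13.
Proof. by move=> f g; do 4![apply/funext => ?]; apply: sub4ACA. Qed.
Let d23_sub : dsub d23.
Proof. by move=> f g; do 4![apply/funext => ?]; apply: sub4ACA. Qed.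
Let d12_13 g : d12 (d13 g) = d13 (d12 g).
Proof. by do 4![apply/funext => ?]; apply: sub4ACA. Qed.
Let d12_23 g : d12 (d23 g) = d23 (d12 g).
Proof. by do 4![apply/funext => ?]; apply: sub4ACA. Qed.
Let d13_23 g : d13 (d23 g) = d23 (d13 g).
Proof. by do 4![apply/funext => ?]; apply: sub4ACA. Qed.
Let d23E g : d23 g = sub4 (d13 g) (d12 g).
Proof.
by do 4![apply/funext => ?]; rewrite /d23 /sub4 /d13 /d12 opprB [RHS]addrC addrA subrK.
Qed.

Let iter_sub d k f g : dsub d -> iter k d (sub4 f g) = sub4 (iter k d f) (iter k d g).
Proof. by move=> hd; elim: k => //= k ->; rewrite hd. Qed.
Let iter_zero d k : dsub d -> iter k d zero4 = zero4.
Proof.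
have z4 : sub4 zero4 zero4 = zero4.
  by do 4![apply/funext => ?]; apply: subrr.
move=> hd; elim: k => //= k ->; rewrite -z4 hd.
by do 4![apply/funext => ?]; rewrite /sub4 !subrr.
Qed.
Let iter_comm d d' j k g : (forall g, d (d' g) = d' (d g)) ->
  iter j d (iter k d' g) = iter k d' (iter j d g).
Proof.
move=> dd; have h1 i f : d (iter i d' f) = iter i d' (d f).
  by elim: i f => //= i IH f; rewrite dd IH.
by elim: j => //= j ->; rewrite h1.
Qed.

(* (w - x)^M = ((z - x) - (z - w))^M is a combination of (z - w)^s (z - x)^t *)
Let d23_expand (P : T4 -> Prop) M g :
  (forall f h, P f -> P h -> P (sub4 f h)) ->
  (forall s t, (s + t = M)%N -> P (iter s d12 (iter t d13 g))) ->
  P (iter M d23 g).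
Proof.
move=> Psub; elim: M g => [|M IHM] g hg; first by apply: (hg 0%N 0%N).
rewrite iterSr d23E iter_sub //; apply: Psub; apply: IHM => s t st.
  by rewrite -iterSr; apply: hg; rewrite addnS st.
have -> : iter t d13 (d12 g) = d12 (iter t d13 g) by exact: (iter_comm t 1).
by rewrite -iterSr; apply: hg; rewrite addSn st.
Qed.

Let tr g := (forall p, trunc2 (fun m n => g true m n p)) /\
            (forall p, trunc1 (fun m n => g false m n p)).

Let tr_sub f g : tr f -> tr g -> tr (sub4 f g).
Proof.
move=> [f1 f2] [g1 g2]; split=> p.
  have [N hN] := f1 p; have [M hM] := g1 p.
  exists (Num.max N M) => m n; rewrite ge_max => /andP[h1 h2].
  by rewrite /sub4 hN // hM // subr0.
have [N hN] := f2 p; have [M hM] := g2 p.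
exists (Num.max N M) => m n; rewrite ge_max => /andP[h1 h2].
by move: (hN m n h1) (hM m n h2); rewrite /swap /sub4 => -> ->; rewrite subr0.
Qed.

Let tr_d12 g : tr g -> tr (d12 g).
Proof. by move=> [g1 g2]; split=> p; [exact: (trunc2_zmw (g1 p))|exact: (trunc1_zmw (g2 p))]. Qed.

Let tr_d13 g : tr g -> tr (d13 g).
Proof.
move=> hg; have h : tr (fun s m n p => g s (m + 1) n p) /\
    tr (fun s m n p => g s m n (p + 1)); last by apply: tr_sub; case: h.
case: hg => g1 g2; split; split=> p //.
- by have [N hN] := g1 p; exists N => m n h; apply: hN.
- have [N hN] := g2 p; exists N => m n h; apply: (hN m (n + 1)); lia.
Qed.

Let tr_d23 g : tr g -> tr (d23 g).
Proof. by move=> hg; rewrite d23E; apply: tr_sub; [apply: tr_d13|apply: tr_d12]. Qed.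

Let tr_iter d k g : (forall g, tr g -> tr (d g)) -> tr g -> tr (iter k d g).
Proof. by move=> hd hg; elim: k => //= k; apply: hd. Qed.

(** The residue in z of (z - w)^q times g, expanded in powers of w on the component [true] and in
    powers of z on [false]. At [F v] it is the commutator of the product field with c. *)
Let H g : int -> int -> V := fun n p =>
  iota_zw q (fun m n => g true m n p) 0 n - iota_wz q (fun m n => g false m n p) 0 n.

Let H_sub f g n p : tr f -> tr g -> H (sub4 f g) n p = H f n p - H g n p.
Proof.
move=> [f1 f2] [g1 g2]; rewrite /H sub4ACA.
have := congr1 (fun h => h 0 n) (iota_zw_sub q (f1 p) (g1 p)).
have := congr1 (fun h => h 0 n) (iota_wz_sub q (f2 p) (g2 p)).
by rewrite /sub2 /= => <- <-.
Qed.

Let zmw_H g : tr g -> zmw (H g) = H (d23 g).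
Proof.
move=> hg; apply/funext => n; apply/funext => p; have [g1 g2] := hg.
rewrite /zmw /H sub4ACA; congr (_ - _).
  rewrite /iota_zw -fsumB;
    try by [exact: (trunc2_vanishing _ _ _ (g1 p))|
            exact: (trunc2_vanishing _ _ _ (g1 (p + 1)))].
  apply: fsum_ext => i; rewrite -mulrzBl /d23.
  by congr ((g _ _ _ _ - _) *~ _); lia.
rewrite /iota_wz -mulrzBl; congr (_ *~ _).
rewrite /iota_zw -fsumB;
  try by [exact: (trunc2_vanishing _ _ _ (g2 p))|
          exact: (trunc2_vanishing _ _ _ (g2 (p + 1)))].
apply: fsum_ext => i; rewrite -mulrzBl /d23 /swap.
by congr ((g _ _ _ _ - _) *~ _); lia.
Qed.

Let H_iter M g : tr g -> iter M (@zmw V) (H g) = H (iter M d23 g).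
Proof.
elim: M => //= M IHM hg; rewrite IHM // zmw_H //.
by apply: tr_iter hg; apply: tr_d23.
Qed.

Let iter_slice_zmw k g s p :
  (fun m n => iter k d12 g s m n p) = iter k (@zmw V) (fun m n => g s m n p).
Proof. by elim: k => //= k <-. Qed.

Let F v : T4 := fun s m n p =>
  if s then a m (b n (c p v)) - c p (a m (b n v))
  else b n (a m (c p v)) - c p (b n (a m v)).

Let trF v : tr (F v).
Proof.
split=> p.
  have [N hN] := field_trunc hb (c p v); have [M hM] := field_trunc hb v.
  exists (Num.max N M) => m n; rewrite ge_max => /andP[h1 h2].
  by rewrite /F hN // hM // (addf0 (field_addf ha m)) (addf0 (field_addf hc p)) subrr.
have [N hN] := field_trunc ha (c p v); have [M hM] := field_trunc ha v.
exists (Num.max N M) => n m; rewrite ge_max => /andP[h1 h2].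
rewrite /swap /F hN // hM //.
by rewrite (addf0 (field_addf hb n)) (addf0 (field_addf hc p)) subrr.
Qed.

Let commutator_H v : commutator (field_prod a q b) c v = H (F v).
Proof.
apply/funext => n; apply/funext => p.
rewrite /commutator /sub2 /swap /modes /H /field_prod (field_addf hc p) sub4ACA.
have vm x y w m n' (hx : is_field x) (hy : is_field y) :=
  trunc2_vanishing m n' (fun i => (-1) ^+ i * binz q i) (trunc2_modes w hx hy).
congr (_ - _).
  rewrite /iota_zw (addf_fsum (field_addf hc p)); last exact: vm.
  rewrite -fsumB; first last.
  - by apply: (vanishing_addf (field_addf hc p)); apply: vm.
  - exact: vm.
  by apply: fsum_ext => i; rewrite (addfMz (field_addf hc p)) -mulrzBl.
rewrite /iota_wz (addfMz (field_addf hc p)) -mulrzBl; congr (_ *~ _).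
rewrite /iota_zw (addf_fsum (field_addf hc p)); last exact: (vm b a).
rewrite -fsumB; first last.
- by apply: (vanishing_addf (field_addf hc p)); exact: (vm b a).
- exact: (vm b a).
by apply: fsum_ext => i; rewrite (addfMz (field_addf hc p)) -mulrzBl.
Qed.

(** Of the 3N + |q| factors w - x, N are kept against the commutators of b with c, and the other N +
    S are expanded through z - w and z - x. Either z - x occurs at least N times and kills the
    commutators of a with c as well, or z - w occurs more than S = N + |q| times: this clears the
    pole of (z - w)^q, makes the two expansions agree, and leaves N factors for the locality of a
    and b. *)
Lemma dong : local a b -> local a c -> local b c -> local (field_prod a q b) c.
Proof.
move=> [N1 h1] [N2 h2] [N3 h3]; pose N := (N1 + N2 + N3)%N.
have lab := local_leq (leq_trans (leq_addr N2 N1) (leq_addr N3 _) : N1 <= N)%N h1.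
have lac := local_leq (leq_trans (leq_addl N1 N2) (leq_addr N3 _) : N2 <= N)%N h2.
have lbc := local_leq (leq_addl _ N3 : N3 <= N)%N h3.
pose S := (N + `|q|)%N; exists ((N + S) + N)%N => v.
have d12F k : (N <= k)%N -> iter k d12 (F v) true = iter k d12 (F v) false.
  move=> Nk; apply/funext => m; apply/funext => n; apply/funext => p.
  rewrite -[LHS]/((fun m n => iter k d12 (F v) true m n p) m n) iter_slice_zmw.
  rewrite -[RHS]/((fun m n => iter k d12 (F v) false m n p) m n) iter_slice_zmw.
  apply/eqP; rewrite -subr_eq0 -[_ - _]/(sub2 _ _ m n) -iter_zmw_sub.
  have -> : sub2 (fun m n => F v true m n p) (fun m n => F v false m n p) =
      sub2 (commutator a b (c p v)) (fun m n => c p (commutator a b v m n)).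
    apply/funext => i; apply/funext => j.
    by rewrite /sub2 /F /commutator /sub2 /modes /swap (field_addf hc p) sub4ACA.
  rewrite iter_zmw_sub (iter_zmw_addf _ _ (field_addf hc p)).
  by rewrite !(local_leq Nk lab) /sub2 (addf0 (field_addf hc p)) subrr.
have d1323F : iter N d13 (iter N d23 (F v)) = zero4.
  (* [ab, c] = a [b, c] + [a, c] b, and likewise for ba; X holds the commutators with b and -Y those
     with a. *)
  pose X : T4 := fun s m n p =>
    if s then a m (commutator b c v n p) else commutator b c (a m v) n p.
  pose Y : T4 := fun s m n p =>
    if s then - commutator a c (b n v) m p else - b n (commutator a c v m p).
  have -> : F v = sub4 X Y.
    apply/funext => s; do 3![apply/funext => ?].
    case: s; rewrite /sub4 /F /X /Y /commutator /sub2 /modes /swap opprK.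
      by rewrite (field_addf ha) addrA subrK.
    by rewrite (field_addf hb) [RHS]addrC addrA subrK.
  have X0 : iter N d23 X = zero4.
    apply/funext => s; apply/funext => m.
    have -> : iter N d23 X s m = iter N (@zmw V) (X s m) by elim: (N) => //= k <-.
    case: s; rewrite /X; last by rewrite lbc.
    rewrite (iter_zmw_addf _ _ (field_addf ha m)) lbc.
    by do 2![apply/funext => ?]; apply: (addf0 (field_addf ha m)).
  have Y0 : iter N d13 Y = zero4.
    apply/funext => s; apply/funext => m; apply/funext => n; apply/funext => p.
    have -> : iter N d13 Y s m n p = iter N (@zmw V) (fun m p => Y s m n p) m p.
      by elim: (N) m p => //= k IHk m p; rewrite /d13 !IHk.
    have hN : addf (fun x : V => - x) by move=> x y; rewrite opprB opprK addrC.
    case: s; rewrite /Y /= (iter_zmw_addf _ _ hN).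
      by rewrite lac oppr0.
    by rewrite (iter_zmw_addf _ _ (field_addf hb n)) lac (addf0 (field_addf hb n)) oppr0.
  rewrite iter_sub // iter_sub // X0 iter_zero // [iter N d13 (iter N d23 Y)]iter_comm //.
  by rewrite Y0 iter_zero //; do 4![apply/funext => ?]; apply: subrr.
rewrite commutator_H H_iter // iterD.
suff [_ h0] : tr (iter (N + S) d23 (iter N d23 (F v))) /\
    forall n p, H (iter (N + S) d23 (iter N d23 (F v))) n p = 0.
  by apply/funext => n; apply/funext => p; apply: h0.
apply: (d23_expand (P := fun g => tr g /\ forall n p, H g n p = 0)).
  move=> f g [tf f0] [tg g0]; split=> [|n p]; first exact: tr_sub.
  by rewrite H_sub // f0 g0 subrr.
move=> s t st; set G := iter t d13 _.
have trG : tr G by do 2![apply: tr_iter => //].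
split; first exact: tr_iter.
have [Nt|tN] := leqP N t.
  move=> n p; suff -> : G = zero4.
    rewrite iter_zero // /H /iota_wz /iota_zw !fsum0 ?mul0rz ?subrr // => i;
    by rewrite /swap /zero4 mul0rz.
  by rewrite /G -(subnK Nt) iterD d1323F iter_zero.
move=> n p; rewrite /H !iter_slice_zmw iota_zw_iter; last by case: trG.
rewrite iota_wz_iter; last by case: trG.
have [k kE kN] : exists2 k : nat, q + s%:Z = k%:Z & (N <= k)%N.
  by exists `|(q + s%:Z)%R|%N; move: st tN; rewrite /S; lia.
rewrite kE iota_zw_nat ?iota_wz_nat; try by case: trG.
have : iter k d12 G true = iter k d12 G false.
  have eq_iter (d : T4 -> T4) (j : nat) g :
      (forall h, h true = h false -> d h true = d h false) ->
      g true = g false -> iter j d g true = iter j d g false.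
    by move=> hd hg; elim: j => //= j; apply: hd.
  rewrite /G (iter_comm k t) // (iter_comm k N) //.
  apply: (eq_iter d13 t) => [h e|]; first by rewrite /d13 e.
  apply: eq_iter => [h e|]; first by rewrite /d23 e.
  exact: d12F.
move=> e; apply/eqP; rewrite subr_eq0; apply/eqP.
rewrite -(iter_slice_zmw k G true p) -(iter_slice_zmw k G false p) /=.
by rewrite e.
Qed.

End Dong.

End LocalFields.

(** * Reconstruction of a vertex algebra from generating fields *)

Section StateField.
Variables (K : fieldType) (V : lmodType K) (one : V) (T : V -> V).
Hypotheses (addT : addf T) (scaleT : forall k v, T (k *: v) = k *: T v).
Hypotheses (T1 : T one = 0) (tfV : forall (v : V) n, v *+ n.+1 = 0 -> v = 0).
Implicit Types a b c : int -> V -> V.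

(** The hypotheses of Goddard's uniqueness argument in components: covariance under T and regularity
    of a(z) 1. With T 1 = 0 and no torsion they determine a(z) 1 from a_(-1) 1. *)
Record creative_field a : Prop := CreativeField {
  cf_field : is_field a;
  cf_scale : forall n k v, a n (k *: v) = k *: a n v;
  cf_T : forall n v, T (a n v) - a n (T v) = - (a (n - 1) v *~ n);
  cf_vac : forall n : nat, a n%:Z one = 0
}.

(** d/dz + d/dw in components, the entry at (m, n) being the coefficient of z^(-m-1) w^(-n-1). *)
Definition zw_deriv (f : int -> int -> V) : int -> int -> V :=
  fun m n => - (f (m - 1) n *~ m + f m (n - 1) *~ n).

(* d/dz + d/dw commutes with (z - w)^q *)
Lemma iota_zw_deriv q f : trunc2 f ->
  iota_zw q (zw_deriv f) = zw_deriv (iota_zw q f).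
Proof.
move=> hf; apply/funext => m; apply/funext => n.
pose s i := (-1) ^+ i * binz q i.
have h m' n' (c : nat -> int) := trunc2_vanishing m' n' c hf.
have h1 : vanishing (fun i : nat => f (m - 1 + q - i%:Z) (n + i%:Z) *~ (s i * (q - i%:Z))).
  exact: h.
have h2 : vanishing (fun i : nat => f (m + q - i%:Z) (n - 1 + i%:Z) *~ (s i * i%:Z)).
  exact: h.
have h3 : vanishing (fun i : nat => f (m - 1 + q - i%:Z) (n + i%:Z) *~ (s i * m)).
  exact: h.
have h4 : vanishing (fun i : nat => f (m + q - i%:Z) (n - 1 + i%:Z) *~ (s i * n)).
  exact: h.
transitivity (- (fsum (fun i : nat => f (m - 1 + q - i%:Z) (n + i%:Z) *~ (s i * m)) +
    fsum (fun i : nat => f (m + q - i%:Z) (n - 1 + i%:Z) *~ (s i * n)) +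
   (fsum (fun i : nat => f (m - 1 + q - i%:Z) (n + i%:Z) *~ (s i * (q - i%:Z))) +
    fsum (fun i : nat => f (m + q - i%:Z) (n - 1 + i%:Z) *~ (s i * i%:Z))))).
  rewrite -!fsumD //; try exact: vanishingD.
  rewrite -fsumN; apply: fsum_ext => i; rewrite /zw_deriv mulNrz mulrzDl.
  have -> : m + q - i%:Z - 1 = m - 1 + q - i%:Z by lia.
  have -> : n + i%:Z - 1 = n - 1 + i%:Z by lia.
  congr (- _); rewrite addrACA -!mulrzDr -!mulrzA.
  by congr (_ *~ _ + _ *~ _); rewrite /s; ring.
(* Shifted by one, the sum weighted by i cancels the sum weighted by q - i, by [binz_absorb]. *)
rewrite [X in _ + (_ + X)]fsum_recl // mulr0 mulr0z add0r.
rewrite -[X in _ + X]fsumD //; last exact: (vanishingS h2).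
rewrite [X in _ + X]fsum0 => [|i].
  rewrite addr0 /zw_deriv; congr (- (_ + _)).
    rewrite (addf_fsum (phi := fun v => v *~ m)); last exact: h.
      by apply: fsum_ext => i; rewrite -mulrzA.
    by move=> x y; rewrite mulrzBl.
  rewrite (addf_fsum (phi := fun v => v *~ n)); last exact: h.
    by apply: fsum_ext => i; rewrite -mulrzA.
  by move=> x y; rewrite mulrzBl.
have -> : m + q - i.+1%:Z = m - 1 + q - i%:Z by lia.
have -> : n - 1 + i.+1%:Z = n + i%:Z by lia.
rewrite -mulrzDr /s exprS -[X in _ *~ X](_ : 0 = _) ?mulr0z //.
have := binz_absorb q i; rewrite -mulr_natr natz => e.
transitivity ((-1) ^+ i * ((q - i%:Z) * binz q i - binz q i.+1 * i.+1%:Z)).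
  by rewrite e subrr mulr0.
by ring.
Qed.

Lemma field_prod_creative a b q : creative_field a -> creative_field b ->
  creative_field (field_prod a q b).
Proof.
move=> [fa sa Ta va] [fb sb Tb vb].
have addfZ (k : K) : addf (fun v : V => k *: v) by move=> x y; rewrite scalerBr.
have m2 v x y hx hy := @trunc2_modes V x y v hx hy.
split.
- exact: field_prod_field.
- move=> n k v; rewrite /field_prod scalerBr; congr (_ - _).
    rewrite /iota_zw (addf_fsum (addfZ k)); last exact: (trunc2_vanishing _ _ _ (m2 v _ _ fa fb)).
    by apply: fsum_ext => i; rewrite (addfMz (addfZ k)) /modes sb sa.
  rewrite /iota_wz (addfMz (addfZ k)); congr (_ *~ _).
  rewrite /iota_zw (addf_fsum (addfZ k)); last exact: (trunc2_vanishing _ _ _ (m2 v _ _ fb fa)).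
  by apply: fsum_ext => i; rewrite (addfMz (addfZ k)) /modes /swap sa sb.
- move=> n v.
  have key x y f w : is_field x -> is_field y ->
      (forall n v, T (x n v) - x n (T v) = - (x (n - 1) v *~ n)) ->
      (forall n v, T (y n v) - y n (T v) = - (y (n - 1) v *~ n)) -> f = modes x y w ->
      sub2 (fun m n => T (f m n)) (modes x y (T w)) = zw_deriv f.
    move=> hx hy Tx Ty ->; apply/funext => i; apply/funext => j.
    rewrite /sub2 /modes /zw_deriv -[T (x _ _)](subrK (x i (T (y j w)))) Tx.
    rewrite -addrA -(field_addf hx) Ty opprD.
    by rewrite (addfN (field_addf hx i)) (addfMz (field_addf hx i)).
  have trT f : trunc2 f -> trunc2 (fun m n => T (f m n)).
    by move=> [N hN]; exists N => i j h; rewrite hN // (addf0 addT).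
  have TI g q' i j : trunc2 g ->
      T (iota_zw q' g i j) = iota_zw q' (fun i j => T (g i j)) i j.
    move=> hg; rewrite /iota_zw (addf_fsum addT); last exact: trunc2_vanishing.
    by apply: fsum_ext => k; rewrite (addfMz addT).
  rewrite /field_prod addT /iota_wz (addfMz addT) !TI; try exact: m2; last exact: (m2 v b a fb fa).
  rewrite opprD addrACA -[- _ - - _]opprD -mulrzBl.
  (* The residue of a z-derivative is zero, so at index 0 only the part d/dw of [zw_deriv]
     survives. *)
  have -> : iota_zw q (fun i j => T (modes a b v i j)) 0 n -
      iota_zw q (modes a b (T v)) 0 n = - (iota_zw q (modes a b v) 0 (n - 1) *~ n).
    rewrite -[LHS]/(sub2 _ _ 0 n) -iota_zw_sub; try exact: m2; last exact/trT/m2.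
    by rewrite (key a b _ v) // iota_zw_deriv; [rewrite /zw_deriv mulr0z add0r|exact: m2].
  have -> : iota_zw q (fun i j => T (swap (swap (modes b a v)) i j)) n 0 -
      iota_zw q (swap (swap (modes b a (T v)))) n 0 =
      - (iota_zw q (swap (swap (modes b a v))) (n - 1) 0 *~ n).
    rewrite -[LHS]/(sub2 _ _ n 0) -iota_zw_sub; try exact: (m2 _ b a fb fa).
      rewrite -[swap (swap (modes b a (T v)))]/(modes b a (T v)).
      rewrite -[swap (swap (modes b a v))]/(modes b a v).
      by rewrite (key b a _ v) // iota_zw_deriv; [rewrite /zw_deriv mulr0z addr0|exact: m2].
    exact: (trT _ (m2 v b a fb fa)).
  by rewrite mulNrz mulrzBl opprB opprK addrC -!mulrzA [n * _]mulrC.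
- move=> n; rewrite field_prodE !fsum0 ?mul0rz ?subr0 // => i.
    by rewrite va (addf0 (field_addf fb _)) mul0rz.
  by rewrite -PoszD vb (addf0 (field_addf fa _)) mul0rz.
Qed.

Lemma field_prod_vac a b q : creative_field a -> creative_field b ->
  field_prod a q b (-1) one = a q (b (-1) one).
Proof.
move=> [fa sa Ta va] [fb sb Tb vb]; rewrite field_prodE.
rewrite [X in _ - X *~ _]fsum0 => [|i]; last first.
  by rewrite va (addf0 (field_addf fb _)) mul0rz.
rewrite mul0rz subr0 (@fsum1 _ _ 0%N) => [|[//|i] _].
  rewrite binz0 mulr1 mulr1z; by congr a; lia.
have -> : -1 + i.+1%:Z = i%:Z by lia.
by rewrite vb (addf0 (field_addf fa _)) mul0rz.
Qed.

(** Covariance spreads a_(-1) 1 = 0 to a(z) 1 = 0. Locality then gives (z - w)^N a(z) b(w) 1 = 0,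
    and setting w = 0 leaves z^N a(z) b_(-1) 1 = 0. *)
Lemma goddard a b : creative_field a -> is_field b ->
  (forall n : nat, b n%:Z one = 0) -> local a b -> a (-1) one = 0 ->
  forall n, a n (b (-1) one) = 0.
Proof.
move=> [fa sa Ta va] fb vb [N hN] a1.
have a0 n : a n one = 0.
  case: n => [n|]; first exact: va.
  elim=> [|n IHn]; first exact: a1.
  have := Ta (Negz n) one; rewrite IHn (addf0 addT) T1 (addf0 (field_addf fa _)) subr0.
  have -> : Negz n - 1 = Negz n.+1 by rewrite !NegzE; lia.
  by move/esym/eqP; rewrite (NegzE n) mulrNz opprK => /eqP /tfV.
have /(congr1 (fun f : int -> int -> V => f)) := hN one.
have -> : commutator a b one = modes a b one.
  apply/funext => m; apply/funext => n.
  by rewrite /commutator /sub2 /swap /modes a0 (addf0 (field_addf fb _)) subr0.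
rewrite -iota_zw_nat; last exact: trunc2_modes.
move=> h n; have /(congr1 (fun f => f (n - N%:Z) (-1))) /= := h.
rewrite /iota_zw (@fsum1 _ _ 0%N) => [|[//|i] _].
  rewrite binz0 mulr1 mulr1z /modes => <-; by congr a; lia.
have -> : -1 + i.+1%:Z = i%:Z by lia.
by rewrite /modes vb (addf0 (field_addf fa _)) mul0rz.
Qed.

Section Closure.
Variable G : (int -> V -> V) -> Prop.

(** Locality of the two factors is a premise of [ClosureProd], so that Dong's lemma applies inside
    the induction, before the closure as a whole is known to be local. *)
Inductive field_closure : (int -> V -> V) -> Prop :=
| ClosureGen a : G a -> field_closure a
| ClosureD a b : field_closure a -> field_closure b ->
    field_closure (fun n v => a n v + b n v)
| ClosureZ k a : field_closure a -> field_closure (fun n v => k *: a n v)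
| ClosureProd a q b : field_closure a -> field_closure b -> local a b ->
    field_closure (field_prod a q b).

Hypothesis G_creative : forall a, G a -> creative_field a.
Hypothesis G_local : forall a b, G a -> G b -> local a b.

Lemma closure_creative a : field_closure a -> creative_field a.
Proof.
elim=> {a} [a /G_creative //|a b _ [fa sa Ta va] _ [fb sb Tb vb]|k a _ [fa sa Ta va]
  |a q b _ ha _ hb _]; last exact: field_prod_creative.
- split=> [|n k v|n v|n].
  + split=> [n x y|v].
      by rewrite (field_addf fa) (field_addf fb) opprD addrACA.
    have [N hN] := field_trunc fa v; have [M hM] := field_trunc fb v.
    exists (Num.max N M) => n; rewrite ge_max => /andP[h1 h2].
    by rewrite hN // hM // addr0.
  + by rewrite sa sb scalerDr.
  + by rewrite (addfD addT) opprD addrACA Ta Tb mulrzDl opprD.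
  + by rewrite va vb addr0.
- split=> [|n k' v|n v|n].
  + split=> [n x y|v]; first by rewrite (field_addf fa) scalerBr.
    by have [N hN] := field_trunc fa v; exists N => n h; rewrite hN ?scaler0.
  + by rewrite sa !scalerA mulrC.
  + by rewrite scaleT -scalerBr Ta scalerN scalerMzr.
  + by rewrite va scaler0.
Qed.

Lemma closure_local_r c : creative_field c -> (forall a, G a -> local a c) ->
  forall a, field_closure a -> local a c.
Proof.
move=> hc Gc a; elim=> {a} [a|a b ha la hb lb|k a ha la|a q b ha la hb lb lab].
- exact: Gc.
- have [fa fb] := (cf_field (closure_creative ha), cf_field (closure_creative hb)).
  case: la lb => N1 h1 [N2 h2]; exists (N1 + N2)%N => v.
  have -> : commutator (fun n v => a n v + b n v) c v =
      sub2 (commutator a c v) (fun m n => - commutator b c v m n).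
    apply/funext => m; apply/funext => n.
    rewrite /commutator /sub2 /swap /modes (addfD (field_addf (cf_field hc) n)).
    by rewrite opprK opprD addrACA.
  have hN : addf (fun x : V => - x) by move=> x y; rewrite opprB opprK addrC.
  rewrite iter_zmw_sub (iter_zmw_addf _ _ hN) (local_leq (leq_addr _ _) h1).
  rewrite (local_leq (leq_addl _ _) h2).
  by apply/funext => m; apply/funext => n; rewrite /sub2 oppr0 subr0.
- case: la => N hN; exists N => v.
  have -> : commutator (fun n v => k *: a n v) c v =
      fun m n => k *: commutator a c v m n.
    apply/funext => m; apply/funext => n.
    by rewrite /commutator /sub2 /swap /modes (cf_scale hc) scalerBr.
  have addfZ : addf (fun v : V => k *: v) by move=> x y; rewrite scalerBr.
  rewrite (iter_zmw_addf _ _ addfZ) hN.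
  by apply/funext => m; apply/funext => n; rewrite scaler0.
- by apply: dong => //; apply: cf_field; [apply: closure_creative ha|apply: closure_creative hb|].
Qed.

Lemma closure_local a b : field_closure a -> field_closure b -> local a b.
Proof.
move=> ha hb; apply: closure_local_r ha => [|c Gc]; first exact: closure_creative.
apply: local_sym; apply: closure_local_r hb => [|d Gd]; first exact: G_creative.
exact: G_local.
Qed.

Variable Y : V -> int -> V -> V.
Hypotheses (clY : forall v, field_closure (Y v)) (Y1 : forall v, Y v (-1) one = v).

(** Goddard's argument for a - b, tested against each field Y v, which creates v. *)
Lemma closure_inj a b : field_closure a -> field_closure b ->
  a (-1) one = b (-1) one -> a = b.
Proof.
move=> ha hb e; pose c := fun n v => a n v + (-1) *: b n v.
have hc : field_closure c by apply: ClosureD => //; apply: ClosureZ.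
apply/funext => n; apply/funext => v; apply/eqP; rewrite -subr_eq0 -scaleN1r.
have hv := closure_creative (clY v).
have c1 : c (-1) one = 0 by rewrite /c e scaleN1r subrr.
have := goddard (closure_creative hc) (cf_field hv) (cf_vac hv)
  (closure_local hc (clY v)) c1 n.
by rewrite Y1 => /eqP.
Qed.

(** Both fields belong to the closure and create the vector u_q v. *)
Lemma state_field_prod u q v : Y (Y u q v) = field_prod (Y u) q (Y v).
Proof.
have hab : field_closure (field_prod (Y u) q (Y v)).
  by apply: ClosureProd => //; apply: closure_local.
apply: closure_inj => //.
by rewrite Y1 field_prod_vac ?Y1 //; apply: closure_creative.
Qed.

End Closure.
End StateField.

(* Borcherds' identity at (m, n, q) is B m n q with
   B (m + 1) n q = B m (n + 1) q + B m n (q + 1); it holds at m = 0 by the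
   product formula and for large q by locality, hence everywhere. *)
Section Borcherds.
Variables (V : zmodType) (Y : V -> int -> V -> V).
Hypotheses (fY : forall a, is_field (Y a)) (addY : forall n b, addf (fun a => Y a n b)).
Hypotheses (lY : forall a b, local (Y a) (Y b)).
Hypothesis (prodY : forall a q b, Y (Y a q b) = field_prod (Y a) q (Y b)).

Let lhs a b c m n q :=
  fsum (fun i : nat => Y (Y a (q + i%:Z) b) (m + n - i%:Z) c *~ binz m i).
Let rhs a b c m n q :=
  iota_zw q (modes (Y a) (Y b) c) m n - iota_wz q (swap (modes (Y b) (Y a) c)) m n.

Let rhs_rec a b c m n q :
  rhs a b c (m + 1) n q = rhs a b c m (n + 1) q + rhs a b c m n (q + 1).
Proof.
have h2 := trunc2_modes c (fY a) (fY b); have h1 := trunc1_modes c (fY a) (fY b).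
rewrite /rhs iota_zwS // iota_wzS // -zmw_iota_zw // -zmw_iota_wz // /zmw.
set x := iota_zw q _ _ n; set y := iota_zw q _ m (n + 1).
set z := iota_wz q _ _ n; set t := iota_wz q _ m (n + 1).
by rewrite opprB addrACA [y + _]addrC subrK addKr.
Qed.

Let Y0 n c : Y 0 n c = 0.
Proof. exact: (addf0 (addY n c)). Qed.

Let lhs_rec a b c m n q :
  lhs a b c (m + 1) n q = lhs a b c m (n + 1) q + lhs a b c m n (q + 1).
Proof.
have [N hN] := field_trunc (fY a) b.
(* With the sign (-1)^j absorbed, the left side is [iota_zw m] of a family in the outer and the
   inner mode index, so its recursion in m is again [iota_zwS]. *)
pose sg (j : int) : int := (-1) ^+ `|j|%N.
have sgS j : sg (j + 1) = - sg j by exact: signz.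
have sgD j (i : nat) : sg (j + i%:Z) = sg j * (-1) ^+ i.
  elim: i => [|i IHi]; first by rewrite addr0 mulr1.
  by rewrite -addn1 PoszD addrA sgS IHi addn1 exprS mulN1r mulrN.
have sgM j : sg j * sg j = 1 by rewrite /sg -expr2 sqrr_sign.
pose f n' : int -> int -> V := fun s j => Y (Y a j b) (n' + s) c *~ sg j.
have trf n' : trunc2 (f n').
  by exists N => s j h; rewrite /f hN // Y0 mul0rz.
have E m' n' q' : lhs a b c m' n' q' = iota_zw m' (f n') 0 q' *~ sg q'.
  rewrite /lhs /iota_zw.
  rewrite (addf_fsum (phi := fun v => v *~ sg q')).
  - apply: fsum_ext => i; rewrite /f -!mulrzA sgD.
    congr (Y _ _ _ *~ _); first by lia.
    transitivity ((sg q' * sg q') * ((-1) ^+ i * (-1) ^+ i) * binz m' i).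
      by rewrite sgM mul1r -expr2 sqrr_sign mul1r.
    by ring.
  - by move=> x y; rewrite mulrzBl.
  - exact: trunc2_vanishing.
rewrite !E iota_zwS //.
have -> : zmw (f n) = sub2 (f (n + 1)) (fun s j => f n s (j + 1)).
  apply/funext => s; apply/funext => j; rewrite /zmw /sub2.
  by rewrite /f (_ : n + (s + 1) = n + 1 + s) //; ring.
rewrite iota_zw_sub //; last first.
  by have [M hM] := trf n; exists M => s j h; apply: hM; lia.
rewrite /sub2 mulrzBl sgS mulrNz; congr (_ - _ *~ _).
rewrite /iota_zw; apply: fsum_ext => i.
by rewrite (_ : q + i%:Z + 1 = q + 1 + i%:Z) //; lia.
Qed.

Let borcherds_aux a b c m n q : lhs a b c m n q = rhs a b c m n q.
Proof.
have base n' q' : lhs a b c 0 n' q' = rhs a b c 0 n' q'.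
  rewrite /lhs (@fsum1 _ _ 0%N) => [|[//|i _]]; last by rewrite binz_nat bin0n mulr0z.
  rewrite binz0 mulr1z add0r subr0 addr0 prodY //.
have [N hN] := field_trunc (fY a) b; have [M hM] := lY a b.
(* From N on the left side vanishes by truncation, from M on the right side vanishes by locality. *)
pose Q := Num.max N M%:Z.
have large m' n' q' : Q <= q' -> lhs a b c m' n' q' = rhs a b c m' n' q'.
  rewrite ge_max => /andP[hq1 hq2].
  rewrite /lhs fsum0 => [|i]; last first.
    rewrite hN; last by lia.
    by rewrite Y0 mul0rz.
  have -> : q' = `|q'|%N%:Z by lia.
  rewrite /rhs iota_zw_nat; last exact: trunc2_modes.
  rewrite iota_wz_nat; last exact: trunc1_modes.
  rewrite -[RHS]/(sub2 _ _ m' n') -iter_zmw_sub.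
  by rewrite (local_leq (N := M) (M := `|q'|%N)) //; lia.
have pos (k : nat) : forall n' q', lhs a b c k%:Z n' q' = rhs a b c k%:Z n' q'.
  elim: k => // k IHk n' q'.
  by rewrite -addn1 PoszD lhs_rec rhs_rec !IHk.
have neg (k : nat) : forall n' q', lhs a b c (- k%:Z) n' q' = rhs a b c (- k%:Z) n' q'.
  elim: k => // k IHk n' q'.
  (* For negative m the recursion is solved as B m n q = B (m + 1) (n - 1) q - B m (n - 1) (q + 1),
     descending in q from the range where both sides vanish. *)
  have [hq|hq] := leP Q q'; first exact: large.
  have : q' = Q - `|(Q - q')%R|%N%:Z by lia.
  move: (`|(Q - q')%R|%N) => d; elim: d n' q' {hq} => [|j IHj] n' q' ->; first by apply: large; lia.
  have e : - k%:Z = - k.+1%:Z + 1 by lia.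
  have := lhs_rec a b c (- k.+1%:Z) (n' - 1) (Q - j.+1%:Z).
  have := rhs_rec a b c (- k.+1%:Z) (n' - 1) (Q - j.+1%:Z).
  rewrite -e !IHk => -> /eqP; rewrite subrK.
  rewrite [X in _ == _ + X](IHj (n' - 1) (Q - j.+1%:Z + 1)); last by lia.
  by move/eqP/addIr => ->.
by case: (ltrP m 0) => hm; [rewrite (_ : m = - `|m|%N%:Z); [exact: neg|lia]|
  rewrite (_ : m = `|m|%N%:Z); [exact: pos|lia]].
Qed.

Lemma borcherds a b c m n q :
  fsum (fun i : nat => Y (Y a (q + i%:Z) b) (m + n - i%:Z) c *~ binz m i) =
  fsum (fun i : nat =>
       (Y a (m + q - i%:Z) (Y b (n + i%:Z) c)
        - (Y b (n + q - i%:Z) (Y a (m + i%:Z) c)) *~ (-1) ^+ `|q|%N)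
       *~ ((-1) ^+ i * binz q i)).
Proof.
rewrite -[LHS]/(lhs a b c m n q) borcherds_aux /rhs /iota_wz.
rewrite /iota_zw (addf_fsum (phi := fun v => v *~ (-1) ^+ `|q|%N)); last 2 first.
- by move=> x y; rewrite mulrzBl.
- exact: (trunc2_vanishing _ _ _ (trunc2_modes c (fY b) (fY a))).
rewrite -fsumB; first last.
- apply: (vanishing_addf (phi := fun v => v *~ (-1) ^+ `|q|%N)).
    by move=> x y; rewrite mulrzBl.
  exact: (trunc2_vanishing _ _ _ (trunc2_modes c (fY b) (fY a))).
- exact: (trunc2_vanishing _ _ _ (trunc2_modes c (fY a) (fY b))).
apply: fsum_ext => i; rewrite /modes /swap mulrzBl; congr (_ - _).
by rewrite -!mulrzA mulrC.
Qed.

End Borcherds.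

(** * The Heisenberg action *)

Section LinearMaps.
Variables (K : fieldType) (V W : lmodType K).
Implicit Types f g : V -> W.

Definition linear_map f := forall k u v, f (k *: u + v) = k *: f u + f v.

Lemma linear_map_addf f : linear_map f -> addf f.
Proof.
by move=> hf u v; rewrite [u - v]addrC -[- v]scaleN1r hf scaleN1r addrC.
Qed.

Lemma linear_mapZ f k v : linear_map f -> f (k *: v) = k *: f v.
Proof.
by move=> hf; rewrite -[k *: v]addr0 hf (addf0 (linear_map_addf hf)) addr0.
Qed.

Lemma linear_mapD f g : linear_map f -> linear_map g -> linear_map (fun v => f v + g v).
Proof. by move=> hf hg k u v; rewrite hf hg scalerDr addrACA. Qed.
Lemma linear_map_opp f : linear_map f -> linear_map (fun v => - f v).
Proof. by move=> hf k u v; rewrite hf opprD scalerN. Qed.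
Lemma linear_map_scale f (c : K) : linear_map f -> linear_map (fun v => c *: f v).
Proof. by move=> hf k u v; rewrite hf scalerDr !scalerA mulrC. Qed.
Lemma linear_map_sum I (r : seq I) (F : I -> V -> W) :
  (forall i, linear_map (F i)) -> linear_map (fun v => \sum_(i <- r) F i v).
Proof.
move=> hF k u v; rewrite scaler_sumr -big_split; apply: eq_bigr => i _.
exact: hF.
Qed.
Lemma linear_map0 : linear_map (fun _ : V => 0 : W).
Proof. by move=> k u v; rewrite scaler0 addr0. Qed.
End LinearMaps.

Lemma linear_map_comp (K : fieldType) (U V W : lmodType K) (f : V -> W) (g : U -> V) :
  linear_map f -> linear_map g -> linear_map (fun v => f (g v)).
Proof. by move=> hf hg k u v; rewrite hg hf. Qed.

Lemma linear_map_id (K : fieldType) (V : lmodType K) : linear_map (fun v : V => v).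
Proof. by []. Qed.

(* The algebraic facts about [VL] and [heis] that the theory of V_L uses.
   Stating them for an abstract module keeps unification from unfolding the
   concrete one. *)
Record is_fock (K : numFieldType) (l : nat) (A : 'M[int]_l) (V : lmodType K)
    (bv : fock_index l -> V) (hs : 'I_l -> int -> V -> V)
    (le : (fock_index l -> V) -> V -> V) : Prop := IsFock {
  fock_ext_linear : forall f, linear_map (le f);
  fock_ext_basis : forall f b, le f (bv b) = f b;
  fock_span : forall P : V -> Prop,
    (forall k u v, P u -> P v -> P (k *: u + v)) ->
    (forall b, P (bv b)) -> forall v, P v;
  fock_heis_linear : forall i n, linear_map (hs i n);
  fock_heis_neg : forall i k m g,
    hs i (Negz k) (bv (m, g)) = bv (((i, k) +` m)%mset, g);
  fock_heis_zero : forall i m g,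
    hs i 0 (bv (m, g)) = (lat_form A (simple i) g)%:~R *: bv (m, g);
  fock_heis_pos : forall i k m g, hs i (Posz k.+1) (bv (m, g)) =
    \sum_(j < l) (A i j * (k.+1 * m (j, k))%N%:Z)%:~R *:
      bv ((m `\ (j, k))%mset, g)
}.

Section LatticeForm.
Variables (l : nat) (A : 'M[int]_l).
Hypothesis symA : forall i j, A i j = A j i.
Local Notation L := 'rV[int]_l.
Local Notation form := (lat_form A).

Lemma formDl a b c : form (a + b) c = form a c + form b c.
Proof. by rewrite /lat_form !mulmxDl mxE. Qed.
Lemma formDr a b c : form a (b + c) = form a b + form a c.
Proof. by rewrite /lat_form linearD mulmxDr mxE. Qed.
Lemma formNl a b : form (- a) b = - form a b.
Proof. by rewrite /lat_form !mulNmx mxE. Qed.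
Lemma formNr a b : form a (- b) = - form a b.
Proof. by rewrite /lat_form linearN mulmxN mxE. Qed.
Lemma form0l b : form 0 b = 0.
Proof. by rewrite /lat_form !mul0mx mxE. Qed.
Lemma form0r b : form b 0 = 0.
Proof. by rewrite /lat_form linear0 mulmx0 mxE. Qed.
Lemma formZl (z : int) a b : form (z *: a) b = z * form a b.
Proof. by rewrite /lat_form -!scalemxAl mxE. Qed.
Lemma formZr (z : int) a b : form a (z *: b) = z * form a b.
Proof. by rewrite /lat_form linearZ -scalemxAr mxE. Qed.
Lemma formC a b : form a b = form b a.
Proof.
have AT : A^T = A by apply/matrixP => i j; rewrite mxE symA.
rewrite /lat_form; transitivity ((a *m A *m b^T)^T 0 0); first by rewrite [RHS]mxE.
by rewrite !trmx_mul trmxK AT mulmxA.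
Qed.
Lemma form_simple i j : form (simple i) (simple j) = A i j.
Proof.
rewrite /lat_form /simple -rowE trmx_delta -colE !mxE //.
Qed.
Lemma row_sum_simple (a : L) : a = \sum_i a 0 i *: simple i.
Proof.
rewrite {1}[a]row_sum_delta; apply: eq_bigr => i _; by [].
Qed.
Lemma form_suml a b : form a b = \sum_i a 0 i * form (simple i) b.
Proof.
rewrite {1}[a]row_sum_simple (big_morph (form^~ b) (fun x y => formDl x y b) (form0l b)).
by apply: eq_bigr => i _; rewrite formZl.
Qed.
Lemma form_sumr a b : form a b = \sum_i b 0 i * form a (simple i).
Proof. by rewrite formC form_suml; apply: eq_bigr => i _; rewrite formC. Qed.
End LatticeForm.

Section FockSpace.
Variables (K : numFieldType) (l : nat) (A : 'M[int]_l) (V : lmodType K).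
Hypothesis symA : forall i j, A i j = A j i.
Variables (bv : fock_index l -> V) (hs : 'I_l -> int -> V -> V).
Variable le : (fock_index l -> V) -> V -> V.
Hypothesis fock : is_fock A bv hs le.
Local Notation L := 'rV[int]_l.
Local Notation form := (lat_form A).
Local Notation ex g := (bv (mset0, g)).
Local Notation heis_linear := (fock_heis_linear fock).
Local Notation heis_neg := (fock_heis_neg fock).
Local Notation heis_zero := (fock_heis_zero fock).

Definition heisv (a : L) (n : int) (v : V) : V := \sum_(i < l) (a 0 i)%:~R *: hs i n v.

Lemma linear_map_ext (f g : V -> V) : linear_map f -> linear_map g ->
  (forall b, f (bv b) = g (bv b)) -> f =1 g.
Proof.
by move=> hf hg fg; apply: (fock_span fock) => // k u v eu ev; rewrite hf hg eu ev.
Qed.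

Lemma heis_addf i n : addf (hs i n).
Proof. exact/linear_map_addf/heis_linear. Qed.
Lemma heisv_linear a n : linear_map (heisv a n).
Proof. by apply: linear_map_sum => i; apply/linear_map_scale/heis_linear. Qed.
Lemma heisv_addf a n : addf (heisv a n).
Proof. exact/linear_map_addf/heisv_linear. Qed.

(** The basis vectors arise from the e^g by creation operators. Operator identities are therefore
    checked on the e^g and propagated through commutation with creation operators. *)
Lemma fock_ind (P : V -> Prop) :
  (forall k u v, P u -> P v -> P (k *: u + v)) ->
  (forall g, P (ex g)) -> (forall i k v, P v -> P (hs i (Negz k) v)) ->
  forall v, P v.
Proof.
move=> Plin Pe Ph; apply: (fock_span fock) => // -[m g].
rewrite -[m]seq_mset_id; elim: (m : seq _) => [|[i k] s IHs].
  suff -> : seq_mset [::] = mset0 :> {mset (osc l)}%mset by apply: Pe.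
  by apply/msetP => x; rewrite mset_seqE mset0E.
suff -> : seq_mset ((i, k) :: s) = ((i, k) +` seq_mset s)%mset.
  by rewrite -heis_neg; apply: Ph.
by apply/msetP => x; rewrite mset1DE !mset_seqE /= eq_sym.
Qed.

Lemma fock_operator_ext (X Y : V -> V) : linear_map X -> linear_map Y ->
  (forall g, X (ex g) = Y (ex g)) ->
  (forall i k v, X v = Y v -> X (hs i (Negz k) v) = Y (hs i (Negz k) v)) ->
  X =1 Y.
Proof.
move=> hX hY he hh; apply: fock_ind => // k u v eu ev.
by rewrite hX hY eu ev.
Qed.

(* The derivation dual to the creation operator of the generator [x]. *)
Definition osc_deriv (x : osc l) : V -> V :=
  le (fun b => (b.1 x)%:R *: bv ((b.1 `\ x)%mset, b.2)).

Lemma osc_deriv_bv x (m : {mset (osc l)}%mset) (g : L) :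
  osc_deriv x (bv (m, g)) = (m x)%:R *: bv ((m `\ x)%mset, g).
Proof. exact: (fock_ext_basis fock). Qed.

Lemma osc_deriv_linear x : linear_map (osc_deriv x).
Proof. exact: (fock_ext_linear fock). Qed.

Lemma heis_pos i k v :
  hs i (Posz k.+1) v = \sum_j (A i j * k.+1%:Z)%:~R *: osc_deriv (j, k) v.
Proof.
move: v; apply: linear_map_ext => [||b].
- exact: heis_linear.
- by apply: linear_map_sum => j; apply/linear_map_scale/osc_deriv_linear.
case: b => m g; rewrite (fock_heis_pos fock); apply: eq_bigr => j _.
by rewrite osc_deriv_bv scalerA -[(m _)%:R]/((m (j, k))%:Z%:~R) -intrM -mulrA -PoszM.
Qed.

Lemma osc_deriv_exp x g : osc_deriv x (ex g) = 0.
Proof. by rewrite osc_deriv_bv mset0E scale0r. Qed.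

Lemma osc_deriv_cre x i k v : osc_deriv x (hs i (Negz k) v) =
  hs i (Negz k) (osc_deriv x v) + (x == (i, k))%:R *: v.
Proof.
move: v; apply: linear_map_ext => [||[m g]].
- by apply: linear_map_comp; [apply: osc_deriv_linear|apply: heis_linear].
- apply: linear_mapD; last exact/linear_map_scale/linear_map_id.
  by apply: linear_map_comp; [apply: heis_linear|apply: osc_deriv_linear].
rewrite heis_neg.
rewrite !osc_deriv_bv.
rewrite (linear_mapZ _ _ (heis_linear _ _)).
rewrite heis_neg mset1DE natrD.
rewrite scalerDl.
rewrite [LHS]addrC.
congr (_ + _).
  have [m0|m0] := posnP (m x); first by rewrite m0 !scale0r.
  congr (_ *: bv (_, _)); apply/msetP => y; rewrite msetB1E !mset1DE msetB1E.
  by have [->|] := eqVneq y x; rewrite ?subn0 ?addnBA.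
have [->|_] := eqVneq x (i, k); last by rewrite !scale0r.
congr (_ *: bv (_, _)); exact: msetD1K.
Qed.

Lemma osc_derivC x y v : osc_deriv x (osc_deriv y v) = osc_deriv y (osc_deriv x v).
Proof.
have lin a b : linear_map (fun v => osc_deriv a (osc_deriv b v)).
  by apply: linear_map_comp; apply: osc_deriv_linear.
move: v; apply: (fock_operator_ext (lin x y) (lin y x)) => [g|i k v IHv].
  rewrite (osc_deriv_exp y) (osc_deriv_exp x).
  by rewrite !(addf0 (linear_map_addf (osc_deriv_linear _))).
have hZ := fun z => linear_mapZ _ _ (osc_deriv_linear z).
have hD := fun z => addfD (linear_map_addf (osc_deriv_linear z)).
by rewrite !osc_deriv_cre !hD !hZ !osc_deriv_cre IHv -!addrA [_ *: _ + _ *: _]addrC.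
Qed.

Lemma osc_deriv_zero x i v : osc_deriv x (hs i 0 v) = hs i 0 (osc_deriv x v).
Proof.
move: v; apply: linear_map_ext => [||[m g]].
- by apply: linear_map_comp; [apply: osc_deriv_linear|apply: heis_linear].
- by apply: linear_map_comp; [apply: heis_linear|apply: osc_deriv_linear].
rewrite heis_zero (linear_mapZ _ _ (osc_deriv_linear _)) !osc_deriv_bv.
by rewrite (linear_mapZ _ _ (heis_linear _ _)) heis_zero !scalerA mulrC.
Qed.

Let heis_heis_linear i m j n : linear_map (fun v => hs i m (hs j n v)).
Proof. exact: linear_map_comp (heis_linear i m) (heis_linear j n). Qed.

Lemma heis_zeroC i j n v : hs i 0 (hs j n v) = hs j n (hs i 0 v).
Proof.
have hZ i' n' := fun z => linear_mapZ z _ (heis_linear i' n').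
case: n => [[|k]|k].
- move: v; apply: (linear_map_ext (heis_heis_linear _ _ _ _) (heis_heis_linear _ _ _ _)) => -[m g].
  by rewrite !heis_zero !hZ !heis_zero !scalerA mulrC.
- rewrite !heis_pos (addf_sum (heis_addf _ _)); apply: eq_bigr => x _.
  by rewrite hZ osc_deriv_zero.
move: v; apply: (linear_map_ext (heis_heis_linear _ _ _ _) (heis_heis_linear _ _ _ _)) => -[m g].
by rewrite !heis_neg !heis_zero hZ heis_neg.
Qed.

Lemma heis_negC i j k k' v :
  hs i (Negz k) (hs j (Negz k') v) = hs j (Negz k') (hs i (Negz k) v).
Proof.
move: v; apply: (linear_map_ext (heis_heis_linear _ _ _ _) (heis_heis_linear _ _ _ _)) => -[m g].
by rewrite !heis_neg msetDCA.
Qed.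

Lemma heis_posC i j k k' v :
  hs i (Posz k.+1) (hs j (Posz k'.+1) v) = hs j (Posz k'.+1) (hs i (Posz k.+1) v).
Proof.
have hZ x := fun z => linear_mapZ z _ (osc_deriv_linear x).
have hS x := addf_sum (linear_map_addf (osc_deriv_linear x)).
rewrite !heis_pos; under eq_bigr do rewrite hS scaler_sumr.
under [RHS]eq_bigr do rewrite hS scaler_sumr.
rewrite exchange_big; apply: eq_bigr => x _; apply: eq_bigr => y _ /=.
by rewrite !hZ !scalerA mulrC osc_derivC.
Qed.

Lemma heis_posneg i j k k' v : hs i (Posz k.+1) (hs j (Negz k') v) =
  hs j (Negz k') (hs i (Posz k.+1) v) +
  (if k == k' then k.+1%:Z * A i j else 0)%:~R *: v.
Proof.
rewrite !heis_pos (addf_sum (heis_addf _ _)).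
under eq_bigr do rewrite osc_deriv_cre scalerDr scalerA.
rewrite big_split /=; congr (_ + _).
  by apply: eq_bigr => x _; rewrite (linear_mapZ _ _ (heis_linear _ _)).
rewrite -scaler_suml; congr (_ *: v); rewrite (bigD1 j) //= big1 ?addr0.
  rewrite xpair_eqE eqxx; case: eqP => _; rewrite ?mulr0 // mulr1 mulrC //.
by move=> x xj; rewrite xpair_eqE (negbTE xj) mulr0.
Qed.

Lemma heis_comm i j m n v :
  hs i m (hs j n v) = hs j n (hs i m v) +
  (if m + n == 0 then m * A i j else 0)%:~R *: v.
Proof.
have [->|m0] := eqVneq m 0; first by rewrite heis_zeroC mul0r if_same scale0r addr0.
have [->|n0] := eqVneq n 0.
  by rewrite -heis_zeroC addr0 (negbTE m0) scale0r addr0.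
case: m m0 => [[|k]|k] // _; case: n n0 => [[|k']|k'] // _.
- by rewrite heis_posC /= scale0r addr0.
- rewrite heis_posneg; congr (_ + _%:~R *: _).
  by have -> : (k.+1%:Z + Negz k' == 0) = (k == k') by rewrite NegzE; lia.
(* For m < 0 < n the relation is the previous case read backwards, with the symmetry of A. *)
- rewrite heis_posneg -addrA -scalerDl -intrD [X in X%:~R](_ : _ = 0) ?scale0r ?addr0 //.
  have -> : (Negz k + k'.+1%:Z == 0) = (k' == k) by rewrite NegzE; lia.
  by case: eqP => [->|_]; rewrite ?addr0 // NegzE symA mulNr subrr.
- by rewrite heis_negC /= scale0r addr0.
Qed.

Lemma heisv_comm i a m n v :
  hs i m (heisv a n v) = heisv a n (hs i m v) +
  (if m + n == 0 then m * form (simple i) a else 0)%:~R *: v.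
Proof.
rewrite /heisv (addf_sum (heis_addf _ _)).
under eq_bigr do rewrite (linear_mapZ _ _ (heis_linear _ _)) heis_comm scalerDr scalerA.
rewrite big_split /= -scaler_suml; congr (_ + _ *: v).
case: eqP => _; last by rewrite big1 // => j _; rewrite mulr0.
rewrite (form_sumr symA) big_distrr rmorph_sum /=; apply: eq_bigr => j _.
by rewrite form_simple -intrM mulrCA.
Qed.

Lemma heisv_heisv a b m n v :
  heisv a m (heisv b n v) = heisv b n (heisv a m v) +
  (if m + n == 0 then m * form a b else 0)%:~R *: v.
Proof.
rewrite [LHS]/heisv [in RHS](_ : heisv b n (heisv a m v) =
    \sum_i (a 0 i)%:~R *: heisv b n (hs i m v)); last first.
  rewrite [heisv a m v]/heisv (addf_sum (heisv_addf _ _)).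
  by apply: eq_bigr => i _; rewrite (linear_mapZ _ _ (heisv_linear _ _)).
under eq_bigr do rewrite heisv_comm scalerDr scalerA.
rewrite big_split /= -scaler_suml; congr (_ + _ *: v).
case: eqP => _; last by rewrite big1 // => j _; rewrite mulr0.
rewrite form_suml big_distrr rmorph_sum /=; apply: eq_bigr => j _.
by rewrite -intrM mulrCA.
Qed.

Lemma heis_exp i (n : int) g : 0 < n -> hs i n (ex g) = 0.
Proof.
case: n => [[|k]|k] // _.
by rewrite heis_pos big1 // => j _; rewrite osc_deriv_exp scaler0.
Qed.

Lemma heisv_exp a (n : int) g : 0 < n -> heisv a n (ex g) = 0.
Proof. by move=> n0; rewrite /heisv big1 // => i _; rewrite heis_exp ?scaler0. Qed.

Lemma heis_trunc i v : exists N : int, forall n, N <= n -> hs i n v = 0.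
Proof.
move: v; apply: fock_ind => [k u v [N hN] [M hM]|g|j k v [N hN]].
- exists (Num.max N M) => n; rewrite ge_max => /andP[h1 h2].
  by rewrite (heis_linear i n) hN // hM // scaler0 addr0.
- by exists 1 => n hn; apply: heis_exp; lia.
exists (Num.max N (k.+2)%:Z) => n; rewrite ge_max => /andP[h1 h2].
rewrite heis_comm hN // (addf0 (heis_addf _ _)) ifF ?scale0r ?addr0 //.
rewrite NegzE; lia.
Qed.

Lemma heis_field i : is_field (hs i).
Proof. by split; [move=> n; apply: heis_addf | move=> v; apply: heis_trunc]. Qed.

End FockSpace.

(** * Coefficients of exponentials of commuting operators *)

Section TriangularSums.
Variable V : zmodType.

Lemma triangle_swap s t n (F : nat -> nat -> V) :
  \sum_(s <= m < n.+1) \sum_(t <= k < (n - m).+1) F m k =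
  \sum_(t <= k < n.+1) \sum_(s <= m < (n - k).+1) F m k.
Proof.
transitivity (\sum_(s <= m < n.+1) \sum_(t <= k < n.+1) if (m + k <= n)%N then F m k else 0).
  apply: eq_big_nat => m /andP[_ mn].
  rewrite (big_nat_widen _ _ n.+1) ?big_mkcond /=; last by lia.
  apply: eq_big_nat => k _; rewrite (_ : (k < (n - m).+1)%N = (m + k <= n)%N) //; lia.
rewrite exchange_big_nat; apply: eq_big_nat => k /andP[_ kn].
rewrite [RHS](big_nat_widen _ _ n.+1) ?[RHS]big_mkcond /=; last by lia.
apply: eq_big_nat => m _.
by rewrite (_ : (m < (n - k).+1)%N = (m + k <= n)%N) //; lia.
Qed.

Lemma triangle_diag n (F : nat -> nat -> V) :
  \sum_(0 <= i < n.+1) \sum_(1 <= m < (n - i).+1) F (i + m)%N i =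
  \sum_(1 <= r < n.+1) \sum_(0 <= i < r) F r i.
Proof.
transitivity (\sum_(0 <= i < n.+1) \sum_(1 <= r < n.+1) if (i < r)%N then F r i else 0).
  apply: eq_big_nat => i /andP[_ ni].
  have -> : (n - i).+1 = (n.+1 - i)%N by lia.
  under eq_bigr do rewrite addnC.
  rewrite -(big_addn 1 n.+1 i xpredT (F^~ i)) (big_nat_widenl _ 1) ?big_mkcond //.
rewrite exchange_big_nat; apply: eq_big_nat => r /andP[_ rn].
rewrite [RHS](big_nat_widen _ _ n.+1) ?[RHS]big_mkcond //=; lia.
Qed.

Lemma triangle_restrict n p (F : nat -> V) : (p <= n)%N ->
  \sum_(1 <= m < n.+1) (if (m + p <= n)%N then F m else 0) =
  \sum_(1 <= m < (n - p).+1) F m.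
Proof.
move=> pn; rewrite [RHS](big_nat_widen _ _ n.+1) ?[RHS]big_mkcond /=; last by lia.
apply: eq_big_nat => m _; rewrite (_ : (m < (n - p).+1)%N = (m + p <= n)%N) //; lia.
Qed.

End TriangularSums.

Lemma mulrn_inj (K : numFieldType) (V : lmodType K) (u v : V) n :
  u *+ n.+1 = v *+ n.+1 -> u = v.
Proof.
move/(congr1 (fun w => n.+1%:R^-1 *: w)); rewrite -!scaler_nat !scalerA.
by rewrite mulVf ?pnatr_eq0 // !scale1r.
Qed.

Section Exponentials.
Variables (K : numFieldType) (V : lmodType K) (D : nat -> V -> V).
Hypotheses (Dlin : forall m, linear_map (D m)).
Hypothesis (Dcomm : forall m n v, D m (D n v) = D n (D m v)).
Let Dadd m : addf (D m). Proof. exact/linear_map_addf/Dlin. Qed.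

(* [pow_coef] and [exp_coef] over an arbitrary module. *)
Fixpoint gen_pow_coef (p n : nat) (v : V) : V :=
  if p is p'.+1 then \sum_(1 <= m < n.+1) D m (gen_pow_coef p' (n - m) v)
  else if n == 0%N then v else 0.
Definition gen_exp_coef (n : nat) (v : V) : V :=
  \sum_(0 <= p < n.+1) (p`!%:R)^-1 *: gen_pow_coef p n v.

Lemma gen_exp0 v : gen_exp_coef 0 v = v.
Proof. by rewrite /gen_exp_coef big_nat1 /= invr1 scale1r. Qed.

Lemma gen_pow_gt p n v : (n < p)%N -> gen_pow_coef p n v = 0.
Proof.
elim: p n => // p IHp n np /=; rewrite big_nat big1 // => m /andP[m1 mn].
by rewrite IHp ?(addf0 (Dadd m)) //; lia.
Qed.

(* the derivation z d/dz applied to the power of the exponent *)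
Lemma gen_pow_rec p n v : gen_pow_coef p.+1 n v *+ n =
  (\sum_(1 <= m < n.+1) D m (gen_pow_coef p (n - m) v) *+ m) *+ p.+1.
Proof.
elim: p n => [|p IHp] n.
  rewrite mulr1n /= -sumrMnl; apply: eq_big_nat => m /andP[m1 mn].
  have [mE|_] := eqVneq (n - m)%N 0%N; last by rewrite (addf0 (Dadd m)) !mul0rn.
  by rewrite (_ : n = m) //; lia.
rewrite [gen_pow_coef p.+2 n v]/= -sumrMnl mulrSr addrC.
transitivity (\sum_(1 <= m < n.+1) (D m (gen_pow_coef p.+1 (n - m) v) *+ m +
    D m (gen_pow_coef p.+1 (n - m) v *+ (n - m)))).
  apply: eq_big_nat => m /andP[m1 mn].
  by rewrite (addfMn (Dadd m)) -mulrnDr subnKC.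
rewrite big_split; congr (_ + _).
transitivity (\sum_(1 <= m < n.+1) (\sum_(1 <= k < (n - m).+1)
    D m (D k (gen_pow_coef p (n - m - k) v)) *+ k) *+ p.+1).
  apply: eq_bigr => m _; rewrite IHp (addfMn (Dadd _)) (addf_sum (Dadd _)); congr (_ *+ _).
  by apply: eq_bigr => k _; rewrite (addfMn (Dadd _)).
rewrite sumrMnl triangle_swap; congr (_ *+ _).
apply: eq_bigr => k _; rewrite (addf_sum (Dadd _)) -sumrMnl.
by apply: eq_bigr => m _; rewrite Dcomm subnAC.
Qed.

(** z d/dz exp(D) = (z D') exp(D). The vertex operators are later handled only through this
    recursion and the value 1 in degree zero. *)
Lemma gen_exp_rec n v : gen_exp_coef n v *+ n =
  \sum_(1 <= m < n.+1) D m (gen_exp_coef (n - m) v) *+ m.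
Proof.
rewrite /gen_exp_coef -sumrMnl big_nat_recl //.
rewrite [X in X + _](_ : _ = 0) ?add0r; last first.
  by rewrite /=; case: eqP => [->|_]; rewrite ?mulr0n ?scaler0 ?mul0rn.
transitivity (\sum_(0 <= p < n) \sum_(1 <= m < n.+1)
    (p`!%:R)^-1 *: (D m (gen_pow_coef p (n - m) v) *+ m)).
  apply: eq_bigr => p _; rewrite -scaler_sumr scalerMnr gen_pow_rec.
  rewrite -[X in _ *: X]scaler_nat scalerA factS natrM invfM.
  by rewrite mulrAC mulVf ?pnatr_eq0 // mul1r.
rewrite exchange_big_nat /=; apply: eq_big_nat => m /andP[m1 mn].
rewrite (addf_sum (Dadd m)) -sumrMnl.
rewrite [LHS](@big_cat_nat _ _ _ (n - m).+1) //=; last by lia.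
rewrite [X in _ + X]big_nat [X in _ + X]big1 ?addr0 => [|p /andP[p1 _]].
  by apply: eq_bigr => p _; rewrite (linear_mapZ _ _ (Dlin m)) scalerMnr.
by rewrite gen_pow_gt ?(addf0 (Dadd m)) ?mul0rn ?scaler0.
Qed.
End Exponentials.

(* A family with n E_n = \sum_(1 <= m <= n) d_m E_(n-m) is the family of
   coefficients of an exponential; what commutes with the d_m up to a scalar
   satisfies the corresponding relation with the E_n. *)
Section ExponentialFamilies.
Variables (K : numFieldType) (V : lmodType K) (d E : nat -> V -> V).
Hypotheses (dadd : forall m, addf (d m)).
Hypothesis E0 : forall v, E 0 v = v.
Hypothesis Erec : forall n v, E n v *+ n = \sum_(1 <= m < n.+1) d m (E (n - m)%N v).
Variables (X : V -> V) (c : int).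
Hypothesis Xadd : addf X.

(** If [X, d_p] = p c and X commutes with the other d_m, then X commutes with exp (sum d_m z^m / m)
    up to c z^p times that series. *)
Lemma exp_family_shift p :
  (forall m v, (0 < m)%N ->
     X (d m v) = d m (X v) + (if m == p then v *~ (p%:Z * c) else 0)) ->
  (0 < p)%N ->
  forall n v, X (E n v) = E n (X v) + (if (p <= n)%N then E (n - p)%N v *~ c else 0).
Proof.
move=> Xd p0 n; elim/ltn_ind: n => -[_ v|n IHn v].
  by rewrite !E0 leqNgt p0 /= addr0.
apply: (@mulrn_inj _ _ _ _ n); rewrite -(addfMn Xadd) mulrnDl !Erec (addf_sum Xadd).
transitivity (\sum_(1 <= m < n.+2) (d m (E (n.+1 - m)%N (X v)) +
    (if (m + p <= n.+1)%N then d m (E (n.+1 - p - m)%N v) *~ c else 0) +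
    (if m == p then E (n.+1 - p)%N v *~ (p%:Z * c) else 0))).
  apply: eq_big_nat => m /andP[m1 mn].
  rewrite Xd // IHn; last by lia.
  rewrite (addfD (dadd m)) (_ : (p <= n.+1 - m)%N = (m + p <= n.+1)%N); last by lia.
  congr (_ + _ + _); last by case: eqP => // ->.
  by case: ifP => _; rewrite ?(addf0 (dadd m)) // (addfMz (dadd m)) subnAC.
rewrite !big_split /= -addrA; congr (_ + _).
have [pn|np] := leqP p n.+1; last first.
  rewrite mul0rn big_nat big1 => [|m /andP[m1 mn]]; last by rewrite ifF //; lia.
  by rewrite add0r big_nat big1 // => m /andP[m1 mn]; rewrite ifF //; lia.
rewrite triangle_restrict // -[X in _ + X = _]/(\sum_(1 <= m < n.+2) _).
(* The two corrections have the weights n + 1 - p and p, which add up to the factor n + 1 that is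
   cancelled. *)
rewrite -mulrz_suml -Erec -big_mkcond big_nat1_eq ifT; last by lia.
set u := E _ v; rewrite -[u *+ _]/(u *~ (n.+1 - p)%N%:Z).
rewrite -[RHS]/(u *~ c *~ n.+1%:Z) -!mulrzA -mulrzDr -subzn //.
by congr (_ *~ _); ring.
Qed.

Lemma exp_family_commute :
  (forall m v, (0 < m)%N -> X (d m v) = d m (X v)) ->
  forall n v, X (E n v) = E n (X v).
Proof.
move=> Xd n; elim/ltn_ind: n => -[_ v|n IHn v]; first by rewrite !E0.
apply: (@mulrn_inj _ _ _ _ n); rewrite -(addfMn Xadd) !Erec (addf_sum Xadd).
apply: eq_big_nat => m /andP[m1 mn].
by rewrite Xd // IHn //; lia.
Qed.

Lemma exp_family_ind (P : V -> Prop) v :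
  (forall k u w, P u -> P w -> P (k *: u + w)) ->
  (forall m u, (0 < m)%N -> P u -> P (d m u)) -> P v -> forall n, P (E n v).
Proof.
move=> Plin Pd Pv n; have P0 : P 0.
  by rewrite -(subrr v) addrC -scaleN1r; apply: Plin.
elim/ltn_ind: n => -[_|n IHn]; first by rewrite E0.
suff h : P (E n.+1 v *+ n.+1).
  rewrite -[E _ _]addr0 -[E _ _]scale1r -(@mulVf _ n.+1%:R) ?pnatr_eq0 //.
  by rewrite -scalerA scaler_nat; apply: Plin.
rewrite Erec big_nat; elim/big_ind: _ => // [x y Px Py|m /andP[m1 mn]].
  by rewrite -[x]scale1r; apply: Plin.
by apply: Pd => //; apply: IHn; lia.
Qed.

Lemma exp_family_linear : (forall m, linear_map (d m)) -> forall n, linear_map (E n).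
Proof.
move=> dlin n; elim/ltn_ind: n => -[_ k u v|n IHn k u v]; first by rewrite !E0.
apply: (@mulrn_inj _ _ _ _ n); rewrite mulrnDl scalerMnr !Erec scaler_sumr -big_split.
apply: eq_big_nat => m /andP[m1 mn].
by rewrite IHn ?dlin //; lia.
Qed.

End ExponentialFamilies.

(** * Base change and divided powers *)

Section IntegralVertexAlgebras.
Variables (M : zmodType) (S : vertex_ops M).
Local Notation "1v" := (vac S).
Local Notation np := (nprod S).

(** The axioms on T are packed into T a = a_(-2) 1, from which the Borcherds identity recovers them
    in [zva_Tnp] and [zva_Tderiv]. *)
Record is_zva : Prop := IsZva {
  zva_addl : forall n b, addf (fun a => np a n b);
  zva_addr : forall a n, addf (np a n);
  zva_vacl : forall n b, np 1v n b = if n == -1 then b else 0;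
  zva_vacr : forall a (n : nat), np a n%:Z 1v = 0;
  zva_create : forall a, np a (-1) 1v = a;
  zva_trunc : forall a b, exists N : int, forall n, N <= n -> np a n b = 0;
  zva_T : forall a, transl S a = np a (-2) 1v;
  zva_borcherds : forall a b c (m n q : int),
    fsum (fun i : nat => np (np a (q + i%:Z) b) (m + n - i%:Z) c *~ binz m i) =
    fsum (fun i : nat =>
       (np a (m + q - i%:Z) (np b (n + i%:Z) c)
        - (np b (n + q - i%:Z) (np a (m + i%:Z) c)) *~ (-1) ^+ `|q|%N)
       *~ ((-1) ^+ i * binz q i))
}.

Hypothesis zva : is_zva.

Lemma zva_addTf : addf (transl S).
Proof. by move=> x y; rewrite !(zva_T zva) (zva_addl zva). Qed.

Lemma zva_np0l n b : np 0 n b = 0.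
Proof. exact: (addf0 (zva_addl zva n b)). Qed.
Lemma zva_np0r a n : np a n 0 = 0.
Proof. exact: (addf0 (zva_addr zva a n)). Qed.

Lemma zva_prod a q b n c : np (np a q b) n c = fsum (fun i : nat =>
   (np a (q - i%:Z) (np b (n + i%:Z) c)
    - (np b (n + q - i%:Z) (np a i%:Z c)) *~ (-1) ^+ `|q|%N) *~ ((-1) ^+ i * binz q i)).
Proof.
have := zva_borcherds zva a b c 0 n q; rewrite (@fsum1 _ _ 0%N) => [|[//|i _]]; last first.
  by rewrite binz_nat bin0n mulr0z.
rewrite binz0 mulr1z subr0 addr0 add0r => ->; apply: fsum_ext => i.
by rewrite !add0r.
Qed.

Lemma zva_derivation a b n c : np a 0 (np b n c) = np (np a 0 b) n c + np b n (np a 0 c).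
Proof.
rewrite zva_prod (@fsum1 _ _ 0%N) => [|[//|i _]]; last first.
  by rewrite binz_nat bin0n mulr0 mulr0z.
by rewrite binz0 !mulr1z subr0 !addr0 subrK.
Qed.

Lemma zva_Tvac : transl S 1v = 0.
Proof. by rewrite (zva_T zva) (zva_vacl zva). Qed.

Lemma zva_Tnp a n b : transl S (np a n b) = np a n (transl S b) - np a (n - 1) b *~ n.
Proof.
rewrite !(zva_T zva) zva_prod.
(* T is applied as the mode -2 on the vacuum, where b_(-2+i) 1 vanishes from i = 2 on: i = 0 gives
   a_n (T b), and i = 1 gives the derivative term. *)
have v0 i : np b (-2 + i.+2%:Z) 1v = 0.
  by rewrite (_ : -2 + i.+2%:Z = i%:Z) ?(zva_vacr zva) //; lia.
rewrite (@fsumE _ 2) => [|[|[|i]] // _].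
  rewrite !big_nat_recr //= big_geq // add0r !(zva_vacr zva) !zva_np0r !mul0rz !subr0.
  rewrite !binz0 mulr1 (_ : -2 + 1%N%:Z = -1) //.
  rewrite (zva_create zva) mulr1z; congr (_ + _).
  rewrite -mulrNz; congr (_ *~ _); rewrite expr1 mulN1r.
  by have := binz_absorb n 0; rewrite binz0 mulr1 subr0 mulr1n => ->.
by rewrite v0 (zva_vacr zva) !zva_np0r mul0rz subr0 mul0rz.
Qed.

Lemma zva_Tderiv a n b : np (transl S a) n b = - (np a (n - 1) b *~ n).
Proof.
rewrite (zva_T zva) zva_prod.
have bE (i : nat) : (-1) ^+ i * binz (-2) i = i.+1%:Z.
  by rewrite [binz _ _]/((-1) ^+ i * 'C(1 + i, i)%:Z) mulrA -expr2 sqrr_sign mul1r add1n binSn.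
have v1 k c : k = -1 -> np 1v k c = c by move=> ->; rewrite (zva_vacl zva).
have v0 k c : k != -1 -> np 1v k c = 0.
  by move=> k1; rewrite (zva_vacl zva) (negbTE k1).
(* The only nonzero mode of the vacuum is the one at -1. It selects one term of the second sum for n
   > 0, one of the first sum for n < 0, and none for n = 0. *)
case: n => n.
  case: n => [|n].
    rewrite mulr0z oppr0 fsum0 // => i.
    by rewrite !v0 ?zva_np0r ?mul0rz ?subr0 ?mul0rz //; lia.
  rewrite (@fsum1 _ _ n) => [|i ni].
    rewrite [np 1v (n.+1%:Z + _) b]v0 ?zva_np0r; last by lia.
    rewrite v1; last by lia.
    by rewrite bE mulr1z sub0r mulNrz (_ : n.+1%:Z - 1 = n%:Z) //; lia.
  by rewrite !v0 ?zva_np0r ?mul0rz ?subr0 ?mul0rz //; lia.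
rewrite (@fsum1 _ _ n) => [|i ni].
  rewrite v1; last by rewrite NegzE; lia.
  rewrite v0; last by rewrite NegzE; lia.
  rewrite bE mul0rz subr0 (NegzE n) mulrNz opprK.
  by rewrite (_ : -2 - n%:Z = - n.+1%:Z - 1) //; lia.
by rewrite !v0 ?zva_np0r ?mul0rz ?subr0 ?mul0rz //; rewrite NegzE; lia.
Qed.

Lemma zva_commT a n b : transl S (np a n b) - np a n (transl S b) = np (transl S a) n b.
Proof. by rewrite zva_Tnp zva_Tderiv addrC addKr. Qed.

End IntegralVertexAlgebras.

Section Subalgebra.
Variables (M : zmodType) (P : zmodClosed M) (S : vertex_ops M).
Hypotheses (zva : is_zva S) (Pvac : vac S \in P)
  (Pnp : forall a n b, a \in P -> b \in P -> nprod S a n b \in P).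

Definition sub_ops : vertex_ops (subz P) :=
  VertexOps (to_sub P (vac S)) (fun a => to_sub P (transl S (\val a)))
    (fun a n b => to_sub P (nprod S (\val a) n (\val b))).

Lemma val_to_sub v : v \in P -> \val (to_sub P v) = v.
Proof. by move=> Pv; rewrite /to_sub val_insubd Pv. Qed.

Lemma val_addf : addf (fun v : subz P => \val v).
Proof. by move=> x y; rewrite raddfB. Qed.

Lemma valB (x y : subz P) : \val (x - y) = \val x - \val y.
Proof. exact: val_addf. Qed.

Lemma val_sub_vac : \val (vac sub_ops) = vac S.
Proof. exact: val_to_sub. Qed.

Lemma val_sub_np a n b : \val (nprod sub_ops a n b) = nprod S (\val a) n (\val b).
Proof. by apply: val_to_sub; apply: Pnp; apply: valP. Qed.

Lemma val_sub_T a : \val (transl sub_ops a) = transl S (\val a).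
Proof. by apply: val_to_sub; rewrite (zva_T zva); apply: Pnp => //; apply: valP. Qed.

Lemma sub_zva : is_zva sub_ops.
Proof.
split.
- by move=> n b x y; apply: val_inj; rewrite valB !val_sub_np valB (zva_addl zva).
- by move=> a n x y; apply: val_inj; rewrite valB !val_sub_np valB (zva_addr zva).
- move=> n b; apply: val_inj; rewrite val_sub_np val_sub_vac (zva_vacl zva).
  by case: ifP.
- by move=> a n; apply: val_inj; rewrite val_sub_np val_sub_vac (zva_vacr zva).
- by move=> a; apply: val_inj; rewrite val_sub_np val_sub_vac (zva_create zva).
- move=> a b; have [N hN] := zva_trunc zva (\val a) (\val b).
  by exists N => n h; apply: val_inj; rewrite val_sub_np hN.
- by move=> a; apply: val_inj; rewrite val_sub_np val_sub_T val_sub_vac (zva_T zva).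
move=> a b c m n q; apply: val_inj.
have hA := val_addf; have tr := zva_trunc zva.
rewrite (addf_fsum hA); last first.
  have [N hN] := tr (\val a) (\val b); exists `|N - q|%N => i hi.
  have -> : nprod sub_ops a (q + i%:Z) b = 0.
    by apply: val_inj; rewrite val_sub_np hN //; lia.
  by apply: val_inj; rewrite (addfMz hA) val_sub_np /= (zva_np0l zva) mul0rz.
rewrite (addf_fsum hA); last first.
  have [N hN] := tr (\val b) (\val c); have [N' hN'] := tr (\val a) (\val c).
  exists (`|N - n| + `|N' - m|)%N => i hi; apply: val_inj.
  rewrite (addfMz hA) hA (addfMz hA) !val_sub_np hN; last by lia.
  by rewrite hN' ?(zva_np0r zva) ?mul0rz ?subr0 ?mul0rz //; lia.
transitivity (fsum (fun i : nat => nprod S (nprod S (\val a) (q + i%:Z) (\val b))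
    (m + n - i%:Z) (\val c) *~ binz m i)).
  by apply: fsum_ext => i; rewrite (addfMz hA) !val_sub_np.
rewrite (zva_borcherds zva); apply: fsum_ext => i.
by rewrite (addfMz hA) hA (addfMz hA) !val_sub_np.
Qed.

End Subalgebra.

(** * Additive maps on tensor products and base change of vertex algebras *)

Section TensorMaps.
Variables (R : comPzRingType) (M : zmodType).
Local Notation RM := (tensor R M).

Lemma pureDl r r' (a : M) : pure (r + r') a = pure r a + pure r' a :> RM.
Proof. by rewrite [RHS]tadd_pi; apply/eq_tensP; apply: TensDl. Qed.
Lemma pureDr (r : R) (a a' : M) : pure r (a + a') = pure r a + pure r a' :> RM.
Proof. by rewrite [RHS]tadd_pi; apply/eq_tensP; apply: TensDr. Qed.
Lemma pureBr (r : R) : addf (fun a : M => pure r a : RM).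
Proof.
by move=> a b; apply: (@addIr _ (pure r b)); rewrite -pureDr !subrK.
Qed.
Lemma pure0l (a : M) : pure 0 a = 0 :> RM.
Proof. by apply: (@addIr _ (pure 0 a)); rewrite -pureDl !add0r. Qed.
Lemma pureZ (c r : R) (a : M) : c *: pure r a = pure (c * r) a :> RM.
Proof. by rewrite [LHS]tscale_pi. Qed.

Lemma tensor_ind (P : RM -> Prop) :
  P 0 -> (forall r a x, P x -> P (pure r a + x)) -> forall x, P x.
Proof.
move=> P0 PD; elim/tens_ind; elim=> [|[r a] s IHs]; first exact: P0.
by rewrite -[_ :: s]cat1s -tadd_pi; apply: PD.
Qed.

Lemma tens_lift_addf (W : zmodType) (f : R -> M -> W) :
  (forall r r' a, f (r + r') a = f r a + f r' a) ->
  (forall r a a', f r (a + a') = f r a + f r a') -> addf (tens_lift f).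
Proof.
move=> fl fr x y; apply: (@addIr _ (tens_lift f y)).
by rewrite -tens_liftD // !subrK.
Qed.

Lemma tensor_ext (W : zmodType) (f g : RM -> W) : addf f -> addf g ->
  (forall r a, f (pure r a) = g (pure r a)) -> f =1 g.
Proof.
move=> hf hg fg; apply: tensor_ind => [|r a x IHx].
  by rewrite (addf0 hf) (addf0 hg).
by rewrite (addfD hf) (addfD hg) fg IHx.
Qed.

Lemma addfZ (V : lmodType R) (c : R) : addf (fun v : V => c *: v).
Proof. by move=> x y; rewrite scalerBr. Qed.

Lemma tens_lift_scale (W : lmodType R) (f : R -> M -> W) :
  (forall r r' a, f (r + r') a = f r a + f r' a) ->
  (forall r a a', f r (a + a') = f r a + f r a') ->
  (forall c r a, f (c * r) a = c *: f r a) ->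
  forall c x, tens_lift f (c *: x) = c *: tens_lift f x.
Proof.
move=> fl fr fZ c; apply: tensor_ext => [||r a].
- exact: addf_comp (tens_lift_addf fl fr) (@addfZ _ c).
- exact: addf_comp (@addfZ W c) (tens_lift_addf fl fr).
by rewrite pureZ !tens_lift_pure.
Qed.

End TensorMaps.

Section TensorMap.
Variables (R : comPzRingType) (M N : zmodType) (f : M -> N).
Hypothesis addff : addf f.

Lemma tens_map_addf : addf (tens_map (R := R) f).
Proof.
by apply: tens_lift_addf => *; rewrite ?(addfD addff) ?pureDl ?pureDr.
Qed.
Lemma tens_map_pure (r : R) a : tens_map f (pure r a) = pure r (f a).
Proof. by apply: tens_lift_pure => *; rewrite ?(addfD addff) ?pureDl ?pureDr. Qed.
Lemma tens_map_scale (c : R) x : tens_map f (c *: x) = c *: tens_map f x.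
Proof.
by apply: tens_lift_scale => *; rewrite ?(addfD addff) ?pureDl ?pureDr ?pureZ.
Qed.
End TensorMap.

Section BaseChange.
Variables (R : comPzRingType) (M : zmodType) (S : vertex_ops M).
Hypothesis zva : is_zva S.
Local Notation RM := (tensor R M).
Local Notation np := (nprod S).
Local Notation bnp := (nprod (base_change R S)).

Let np_addr a n := zva_addr zva a n.
Let np_addl n b := zva_addl zva n b.

Lemma bc_inner_addf (r : R) a n :
  addf (tens_lift (fun s b => pure (r * s) (np a n b) : RM)).
Proof.
by apply: tens_lift_addf => *; rewrite ?(addfD (np_addr _ _)) ?pureDr ?mulrDr ?pureDl.
Qed.

Lemma bc_inner_pure (r : R) a n s b :
  tens_lift (fun s b => pure (r * s) (np a n b) : RM) (pure s b) = pure (r * s) (np a n b).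
Proof.
by apply: tens_lift_pure => *; rewrite ?(addfD (np_addr _ _)) ?pureDr ?mulrDr ?pureDl.
Qed.

Let outer n y (r : R) a := tens_lift (fun s b => pure (r * s) (np a n b) : RM) y.

Let outerDl n y r r' a : outer n y (r + r') a = outer n y r a + outer n y r' a.
Proof.
move: y; apply: tensor_ext => [||s b]; first exact: bc_inner_addf.
  by move=> x z; rewrite /outer !bc_inner_addf opprD addrACA.
by rewrite /outer !bc_inner_pure mulrDl pureDl.
Qed.

Let outerDr n y r a a' : outer n y r (a + a') = outer n y r a + outer n y r a'.
Proof.
move: y; apply: tensor_ext => [||s b]; first exact: bc_inner_addf.
  by move=> x z; rewrite /outer !bc_inner_addf opprD addrACA.
rewrite /outer !bc_inner_pure -pureDr; congr pure.
exact: (addfD (np_addl n b)).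
Qed.

Lemma bc_addl n y : addf (fun x => bnp x n y).
Proof. exact: tens_lift_addf (outerDl n y) (outerDr n y). Qed.

Lemma bc_purel r a n y : bnp (pure r a) n y =
  tens_lift (fun s b => pure (r * s) (np a n b)) y.
Proof. exact: (tens_lift_pure (outerDl n y) (outerDr n y)). Qed.

Lemma bc_addr x n : addf (bnp x n).
Proof.
move=> y z; move: x; apply: tensor_ext => [||r a].
- exact: bc_addl.
- by move=> u v; rewrite !bc_addl !opprD addrACA.
by rewrite !bc_purel bc_inner_addf.
Qed.

Lemma bc_pure r a n s b : bnp (pure r a) n (pure s b) = pure (r * s) (np a n b).
Proof. by rewrite bc_purel bc_inner_pure. Qed.

Lemma bc_scalel c x n y : bnp (c *: x) n y = c *: bnp x n y.
Proof.
move: x; apply: tensor_ext => [||r a].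
- exact: addf_comp (bc_addl n y) (@addfZ R RM c).
- exact: addf_comp (@addfZ R RM c) (bc_addl n y).
move: y; apply: tensor_ext => [||s b].
- exact: bc_addr.
- exact: addf_comp (@addfZ R RM c) (bc_addr _ n).
by rewrite pureZ !bc_pure pureZ mulrA.
Qed.

Lemma bc_scaler c x n y : bnp x n (c *: y) = c *: bnp x n y.
Proof.
move: x; apply: tensor_ext => [||r a].
- exact: bc_addl.
- exact: addf_comp (@addfZ R RM c) (bc_addl n y).
move: y; apply: tensor_ext => [||s b].
- exact: addf_comp (bc_addr _ n) (@addfZ R RM c).
- exact: addf_comp (@addfZ R RM c) (bc_addr _ n).
by rewrite pureZ !bc_pure pureZ mulrCA.
Qed.

Lemma bc_trunc x y : exists N : int, forall n, N <= n -> bnp x n y = 0.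
Proof.
move: x; apply: tensor_ind => [|r a x [N hN]].
  by exists 0 => n _; apply: (addf0 (bc_addl n y)).
suff [N' hN'] : exists N : int, forall n, N <= n -> bnp (pure r a) n y = 0.
  exists (Num.max N N') => n; rewrite ge_max => /andP[h1 h2].
  by rewrite (addfD (bc_addl n y)) hN // hN' // addr0.
move: y {N hN}; apply: tensor_ind => [|s b y [N hN]].
  by exists 0 => n _; apply: (addf0 (bc_addr _ n)).
have [N' hN'] := zva_trunc zva a b.
exists (Num.max N N') => n; rewrite ge_max => /andP[h1 h2].
by rewrite (addfD (bc_addr _ n)) hN // bc_pure hN' // (addf0 (@pureBr R M _)) addr0.
Qed.

Let L x y z (m n q : int) (i : nat) : RM :=
  bnp (bnp x (q + i%:Z) y) (m + n - i%:Z) z *~ binz m i.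
Let Rt x y z (m n q : int) (i : nat) : RM :=
  (bnp x (m + q - i%:Z) (bnp y (n + i%:Z) z)
   - (bnp y (n + q - i%:Z) (bnp x (m + i%:Z) z)) *~ (-1) ^+ `|q|%N)
  *~ ((-1) ^+ i * binz q i).

(** Comparing all long partial sums is additive in the two families, so the identity can be proved
    by induction on the three tensors, with bounds on the supports used only for pure tensors. *)
Let eventually_eq (F G : nat -> RM) :=
  exists N, forall k, (N <= k)%N -> \sum_(0 <= i < k) F i = \sum_(0 <= i < k) G i.

Let eventuallyD F F' G G' : eventually_eq F G -> eventually_eq F' G' ->
  eventually_eq (fun i => F i + F' i) (fun i => G i + G' i).
Proof.
move=> [N hN] [N' hN']; exists (maxn N N') => k; rewrite geq_max => /andP[h1 h2].
by rewrite !big_split /= hN // hN'.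
Qed.

Let aM z : addf (fun v : RM => v *~ z). Proof. by move=> x y; rewrite mulrzBl. Qed.

Let borcherds_eventually x y z m n q : eventually_eq (L x y z m n q) (Rt x y z m n q).
Proof.
have bD n' y' u v : bnp (u + v) n' y' = bnp u n' y' + bnp v n' y'.
  exact: (addfD (bc_addl n' y')).
have bDr n' x' u v : bnp x' n' (u + v) = bnp x' n' u + bnp x' n' v.
  exact: (addfD (bc_addr x' n')).
have b0 n' y' : bnp 0 n' y' = 0 by exact: (addf0 (bc_addl n' y')).
have b0r n' x' : bnp x' n' 0 = 0 by exact: (addf0 (bc_addr x' n')).
have Dz (u v : RM) c : (u + v) *~ c = u *~ c + v *~ c by exact: (addfD (aM c)).
have zero F G : (forall i, F i = 0) -> (forall i, G i = 0) -> eventually_eq F G.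
  by move=> F0 G0; exists 0%N => k _; rewrite !big1.
have split F F1 F2 G G1 G2 : (forall i, F i = F1 i + F2 i) ->
    (forall i, G i = G1 i + G2 i) -> eventually_eq F1 G1 -> eventually_eq F2 G2 ->
    eventually_eq F G.
  by move=> /funext -> /funext ->; apply: eventuallyD.
move: x; apply: tensor_ind => [|r a x IHx].
  by apply: zero => i; rewrite /L /Rt !b0 ?b0 ?b0r ?mul0rz ?subr0 ?mul0rz.
apply: (split _ (L (pure r a) y z m n q) _ _ (Rt (pure r a) y z m n q) _ _ _ _ IHx) => [i|i|]; last 1 first.
- move: y {x IHx}; apply: tensor_ind => [|s b y IHy].
    by apply: zero => i; rewrite /L /Rt !(b0, b0r) ?b0 ?mul0rz ?subr0 ?mul0rz.
  apply: (split _ (L (pure r a) (pure s b) z m n q) _ _ (Rt (pure r a) (pure s b) z m n q) _ _ _ _ IHy) => [i|i|]; last 1 first.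
  + move: z {y IHy}; apply: tensor_ind => [|t c z IHz].
      by apply: zero => i; rewrite /L /Rt !(b0, b0r) ?b0 ?mul0rz ?subr0 ?mul0rz.
    apply: (split _ (L (pure r a) (pure s b) (pure t c) m n q) _ _ (Rt (pure r a) (pure s b) (pure t c) m n q) _ _ _ _ IHz) => [i|i|]; last 1 first.
    * have pM w e v : pure w (v *~ e) = pure w v *~ e :> RM.
        exact: (addfMz (@pureBr R M w)).
      pose l i := np (np a (q + i%:Z) b) (m + n - i%:Z) c *~ binz m i.
      pose r' i := (np a (m + q - i%:Z) (np b (n + i%:Z) c)
        - (np b (n + q - i%:Z) (np a (m + i%:Z) c)) *~ (-1) ^+ `|q|%N)
         *~ ((-1) ^+ i * binz q i).
      have LE i : L (pure r a) (pure s b) (pure t c) m n q i = pure (r * s * t) (l i).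
        by rewrite /L !bc_pure pM.
      have RE i : Rt (pure r a) (pure s b) (pure t c) m n q i = pure (r * s * t) (r' i).
        rewrite /Rt !bc_pure pM pureBr pM mulrA [s * (r * t)]mulrCA mulrA.
        by [].
      have [N1 h1] := zva_trunc zva a b; have [N2 h2] := zva_trunc zva b c.
      have [N3 h3] := zva_trunc zva a c.
      pose N := (`|N1 - q| + `|N2 - n| + `|N3 - m|)%N.
      have l0 i : (N <= i)%N -> l i = 0.
        by move=> hi; rewrite /l h1 ?(zva_np0l zva) ?mul0rz //; rewrite /N in hi; lia.
      have r0 i : (N <= i)%N -> r' i = 0.
        move=> hi; rewrite /r' h2 ?h3 ?(zva_np0r zva) ?mul0rz ?subr0 ?mul0rz //;
        rewrite /N in hi; lia.
      exists N => k Nk; under eq_bigr do rewrite LE; under [RHS]eq_bigr do rewrite RE.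
      rewrite -!(addf_sum (@pureBr R M _)) -(@fsumE _ k) => [|i hi]; last first.
        by apply: l0; apply: leq_trans hi.
      rewrite -(@fsumE _ k) => [|i hi]; last by apply: r0; apply: leq_trans hi.
      by rewrite (zva_borcherds zva).
    * by rewrite /L bDr Dz.
    * by rewrite /Rt !(bD, bDr) !Dz opprD addrACA Dz.
  + by rewrite /L !(bD, bDr) !Dz.
  + by rewrite /Rt !(bD, bDr) !Dz opprD addrACA Dz.
- by rewrite /L !(bD, bDr) !Dz.
- by rewrite /Rt !(bD, bDr) !Dz opprD addrACA Dz.
Qed.

Lemma bc_borcherds x y z m n q : fsum (L x y z m n q) = fsum (Rt x y z m n q).
Proof.
have [N0 h0] := borcherds_eventually x y z m n q.
have [N1 h1] := bc_trunc x y; have [N2 h2] := bc_trunc y z.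
have [N3 h3] := bc_trunc x z.
pose N := (N0 + `|N1 - q| + `|N2 - n| + `|N3 - m|)%N.
have b0 n' y' : bnp 0 n' y' = 0 by exact: (addf0 (bc_addl n' y')).
have b0r n' x' : bnp x' n' 0 = 0 by exact: (addf0 (bc_addr x' n')).
rewrite !(@fsumE _ N) => [|i hi|i hi]; first by apply: h0; rewrite /N; lia.
  rewrite /Rt h2 ?h3 ?b0r ?mul0rz ?subr0 ?mul0rz //; rewrite /N in hi; lia.
by rewrite /L h1 ?b0 ?mul0rz //; rewrite /N in hi; lia.
Qed.

Let addT := zva_addTf zva.

Lemma bc_transl x : transl (base_change R S) x = bnp x (-2) (pure 1 (vac S)).
Proof.
move: x; apply: tensor_ext => [||r a]; [exact: tens_map_addf|exact: bc_addl|].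
by rewrite [LHS]tens_map_pure // bc_pure mulr1 (zva_T zva).
Qed.

Lemma bc_vertex_algebra : is_vertex_algebra (base_change R S).
Proof.
have bT : addf (transl (base_change R S)) by exact: tens_map_addf.
split.
- by move=> n b c u v; rewrite (addfD (bc_addl n b)) bc_scalel.
- by move=> a n c u v; rewrite (addfD (bc_addr a n)) bc_scaler.
- by move=> c u v; rewrite (addfD bT); congr (_ + _); apply: tens_map_scale.
- move=> n; apply: tensor_ext => [||s b]; first exact: bc_addr.
    by move=> x y; case: ifP => _; rewrite ?subrr.
  rewrite bc_pure mul1r (zva_vacl zva); case: ifP => // _.
  exact: (addf0 (@pureBr R M s)).
- move=> a n; move: a; apply: (@tensor_ext _ _ _ _ (fun=> 0)) => [||r a].
  + exact: bc_addl.
  + by move=> x y; rewrite subrr.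
  by rewrite bc_pure (zva_vacr zva) (addf0 (@pureBr R M _)).
- apply: tensor_ext => [||r a]; [exact: bc_addl|by []|].
  by rewrite bc_pure mulr1 (zva_create zva).
- exact: bc_trunc.
- by rewrite [LHS](tens_map_pure addT) (zva_Tvac zva) (addf0 (@pureBr R M _)).
- move=> a n b; move: a; apply: tensor_ext => [||r a].
  + move=> x y; by rewrite (bc_addl n b) (bc_addl n (transl _ b)) bT !opprD addrACA.
  + by move=> x y; rewrite bT (bc_addl n b).
  move: b; apply: tensor_ext => [||s b].
  + by move=> x y; rewrite (bc_addr _ n) !bT (bc_addr _ n) !opprD addrACA.
  + exact: bc_addr.
  rewrite bc_pure ![transl (base_change _ _) _]tens_map_pure // !bc_pure -pureBr.
  by rewrite (zva_commT zva).
- move=> a n b; move: a; apply: tensor_ext => [||r a].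
  + by move=> x y; rewrite bT (bc_addl n b).
  + by move=> x y; rewrite (bc_addl _ b) mulrzBl opprB opprK addrC.
  move: b; apply: tensor_ext => [||s b].
  + exact: bc_addr.
  + by move=> x y; rewrite (bc_addr _ _) mulrzBl opprB opprK addrC.
  rewrite [transl (base_change _ _) _]tens_map_pure // !bc_pure (zva_Tderiv zva).
  by rewrite (addfN (@pureBr R M _)) (addfMz (@pureBr R M _)).
- exact: bc_borcherds.
Qed.

End BaseChange.

(** * Divided powers of a zero mode *)

Section DividedPowers.
Variables (K : numFieldType) (V : lmodType K) (S : vertex_ops V) (d : V).
Hypothesis zva : is_zva S.
Hypotheses (scalel : forall (c : K) a n b, nprod S (c *: a) n b = c *: nprod S a n b)
  (scaler : forall (c : K) a n b, nprod S a n (c *: b) = c *: nprod S a n b).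
Local Notation np := (nprod S).
Local Notation D := (np d 0).

Definition div_pow (k : nat) (v : V) : V := (k`!%:R)^-1 *: iter k D v.

Lemma iter_addf k : addf (iter k D).
Proof.
elim: k => [|k IHk] x y //=; rewrite IHk; exact: (zva_addr zva).
Qed.

Lemma div_pow_addf k : addf (div_pow k).
Proof. by move=> x y; rewrite /div_pow iter_addf scalerBr. Qed.

Lemma div_pow0 v : div_pow 0 v = v.
Proof. by rewrite /div_pow /= invr1 scale1r. Qed.

Lemma iter_scale k (c : K) v : iter k D (c *: v) = c *: iter k D v.
Proof. by elim: k => //= k ->; rewrite scaler. Qed.

Lemma div_powS k v : div_pow k.+1 v *+ k.+1 = D (div_pow k v).
Proof.
rewrite /div_pow scaler -scaler_nat scalerA factS natrM invfM mulrA.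
by rewrite divff ?mul1r // pnatr_eq0.
Qed.

Lemma div_pow_comp i j v : div_pow i (div_pow j v) = div_pow (i + j) v *+ 'C(i + j, i).
Proof.
rewrite /div_pow iter_scale scalerA -iterD -scaler_nat scalerA; congr (_ *: _).
have h : 'C(i + j, i)%:R * (i`!%:R * j`!%:R) = (i + j)`!%:R :> K.
  by rewrite -!natrM -(bin_fact (leq_addr j i)) addKn.
have n0 k : (k`!%:R : K) != 0 by rewrite pnatr_eq0 -lt0n fact_gt0.
have hC : ('C(i + j, i)%:R : K) != 0 by rewrite pnatr_eq0 -lt0n bin_gt0 leq_addr.
by rewrite -h !invfM [RHS]mulrA divff // mul1r.
Qed.

(** After multiplication by k + 1 the induction step is the derivation property of d_0, each term
    receiving the weights i and k + 1 - i; the factor is cancelled over K. *)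
Lemma div_pow_leibniz k u n v : div_pow k (np u n v) =
  \sum_(0 <= i < k.+1) np (div_pow i u) n (div_pow (k - i) v).
Proof.
elim: k => [|k IHk]; first by rewrite big_nat1 !div_pow0.
apply: (@mulrn_inj _ _ _ _ k); rewrite div_powS IHk (addf_sum (zva_addr zva d 0)).
under eq_bigr do rewrite (zva_derivation zva) -!div_powS.
rewrite big_split /= -sumrMnl.
transitivity (\sum_(0 <= i < k.+2) np (div_pow i u) n (div_pow (k.+1 - i) v) *+ i +
   \sum_(0 <= i < k.+2) np (div_pow i u) n (div_pow (k.+1 - i) v) *+ (k.+1 - i)).
  congr (_ + _).
    rewrite [RHS]big_nat_recl // mulr0n add0r; apply: eq_bigr => i _.
    by rewrite (addfMn (zva_addl zva n _)) subSS.
  rewrite [RHS]big_nat_recr //= subnn mulr0n addr0.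
  apply: eq_big_nat => i /andP[_ ik].
  by rewrite (addfMn (zva_addr zva _ n)) subSn.
by rewrite -big_split; apply: eq_big_nat => i /andP[_ ik] /=; rewrite -mulrnDr subnKC.
Qed.

Lemma div_pow_vac k : (0 < k)%N -> div_pow k (vac S) = 0.
Proof.
case: k => // k _; rewrite /div_pow iterSr (zva_vacr zva) (addf0 (iter_addf k)).
by rewrite scaler0.
Qed.

End DividedPowers.

(** * Lattice vertex operators and the integral form *)

Lemma linear_map_fsum (K : fieldType) (V W : lmodType K) (F : nat -> V -> W) :
  (forall i, linear_map (F i)) -> (forall v, vanishing (F^~ v)) ->
  linear_map (fun v => fsum (F^~ v)).
Proof.
move=> hF h0 k u v; transitivity (fsum (fun i => k *: F i u) + fsum (F^~ v)).
  rewrite -fsumD //; first by apply: fsum_ext => i; rewrite hF.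
  by have [N hN] := h0 u; exists N => i hi; rewrite hN ?scaler0.
congr (_ + _); rewrite (addf_fsum (phi := fun w : W => k *: w)) //.
by move=> x y; rewrite scalerBr.
Qed.

Lemma scaler_intr_mulz (K : fieldType) (V : lmodType K) (z : int) (v : V) :
  z%:~R *: v = v *~ z.
Proof. by rewrite scaler_int. Qed.

Lemma signr_scale (K : fieldType) (V : lmodType K) (n : nat) (v : V) :
  ((-1) ^+ n : K) *: v = v *~ (-1) ^+ n.
Proof. by rewrite -scaler_int rmorphXn /= rmorphN1. Qed.

Section VertexOperators.
Variables (K : numFieldType) (l : nat) (Q : 'M[int]_l) (V : lmodType K).
Hypothesis symQ : forall i j, Q i j = Q j i.
Variables (bv : fock_index l -> V) (hs : 'I_l -> int -> V -> V).
Variable le : (fock_index l -> V) -> V -> V.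
Hypothesis fock : is_fock Q bv hs le.
Local Notation L := 'rV[int]_l.
Local Notation form := (lat_form Q).
Local Notation ex g := (bv (mset0, g)).
Local Notation hv := (heisv hs).
Variable eps : L -> L -> bool.
Hypothesis epsP : is_cocycle Q eps.
Variables S A : L -> nat -> V -> V.
Variable E : L -> int -> V -> V.
Hypotheses (S0 : forall a v, S a 0 v = v)
  (Srec : forall a n v, S a n v *+ n = \sum_(1 <= m < n.+1) hv a (- m%:Z) (S a (n - m)%N v)).
Hypotheses (A0 : forall a v, A a 0 v = v)
  (Arec : forall a n v, A a n v *+ n = \sum_(1 <= m < n.+1) - hv a m%:Z (A a (n - m)%N v)).

(** Extension by zero to negative degrees, so that shifts of the degree need no case distinction. *)
Definition Sz (a : L) (k : int) (v : V) : V := if k is Posz i then S a i v else 0.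

Hypothesis Elin : forall a n, linear_map (E a n).
Hypothesis Ebasis : forall a n m g, E a n (bv (m, g)) = (-1) ^+ eps a g *:
  fsum (fun j : nat => Sz a (j%:Z - n - 1 - form a g) (A a j (bv (m, a + g)))).

Let hlin := fock_heis_linear fock.
Let hadd i n : addf (hs i n). Proof. exact: heis_addf fock i n. Qed.
Let hvlin a n : linear_map (hv a n). Proof. exact: heisv_linear fock a n. Qed.
Let hvadd a n : addf (hv a n). Proof. exact: heisv_addf fock a n. Qed.
Let mlin (f : V -> V) : linear_map f -> linear_map (fun v => - f v).
Proof. exact: linear_map_opp. Qed.

Lemma S_linear a n : linear_map (S a n).
Proof. by apply: (exp_family_linear (d := fun m => hv a (- m%:Z)) (S0 a) (Srec a)) => m; apply: hvlin. Qed.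
Lemma A_linear a n : linear_map (A a n).
Proof.
by apply: (exp_family_linear (d := fun m w => - hv a m%:Z w) (A0 a) (Arec a)) => m; apply/mlin/hvlin.
Qed.
Lemma S_addf a n : addf (S a n). Proof. exact/linear_map_addf/S_linear. Qed.
Lemma A_addf a n : addf (A a n). Proof. exact/linear_map_addf/A_linear. Qed.
Lemma Sz_linear a k : linear_map (Sz a k).
Proof. by case: k => k; [apply: S_linear|apply: linear_map0]. Qed.
Lemma Sz_addf a k : addf (Sz a k). Proof. exact/linear_map_addf/Sz_linear. Qed.

Lemma heis_hv i a (p n : int) v : hs i p (hv a n v) =
  hv a n (hs i p v) + v *~ (if p + n == 0 then p * form (simple i) a else 0).
Proof. by rewrite (heisv_comm symQ fock) scaler_intr_mulz. Qed.

Lemma hv_hv b a (p n : int) v : hv b p (hv a n v) =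
  hv a n (hv b p v) + v *~ (if p + n == 0 then p * form b a else 0).
Proof. by rewrite (heisv_heisv symQ fock) scaler_intr_mulz. Qed.

(* [X] is a mode of a Heisenberg field, paired with [a] through [c] *)
Lemma S_shift X a (c : int) (p : nat) : addf X ->
  (forall n v, X (hv a n v) = hv a n (X v) +
     v *~ (if p%:Z + n == 0 then p%:Z * c else 0)) ->
  (0 < p)%N -> forall n v, X (S a n v) = S a n (X v) +
     (if (p <= n)%N then S a (n - p)%N v *~ c else 0).
Proof.
move=> hX hc p0; apply: (exp_family_shift (d := fun m => hv a (- m%:Z)) _ (S0 a) (Srec a)) => //.
move=> m v m0; rewrite hc (_ : (p%:Z - m%:Z == 0) = (m == p)); last by lia.
by case: eqP => // _; rewrite mulr0z.
Qed.

Lemma heis_S_pos i a (p n : nat) v : (0 < p)%N -> hs i p%:Z (S a n v) =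
  S a n (hs i p%:Z v) + (if (p <= n)%N then S a (n - p)%N v *~ form (simple i) a else 0).
Proof. by move=> p0; apply: S_shift => // k w; apply: heis_hv. Qed.

Lemma hv_S_pos b a (p n : nat) v : (0 < p)%N -> hv b p%:Z (S a n v) =
  S a n (hv b p%:Z v) + (if (p <= n)%N then S a (n - p)%N v *~ form b a else 0).
Proof. by move=> p0; apply: S_shift => // k w; apply: hv_hv. Qed.

Lemma S_comm X a : addf X ->
  (forall (m : nat) v, (0 < m)%N -> X (hv a (- m%:Z) v) = hv a (- m%:Z) (X v)) ->
  forall n v, X (S a n v) = S a n (X v).
Proof. by move=> hX h; apply: (exp_family_commute (d := fun m => hv a (- m%:Z)) (S0 a) (Srec a)). Qed.

Lemma heis_S_le0 i a (p : int) n v : p <= 0 -> hs i p (S a n v) = S a n (hs i p v).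
Proof.
move=> p0; apply: S_comm => // m w m0; rewrite heis_hv ifF ?mulr0z ?addr0 //; lia.
Qed.

Lemma hv_S_le0 b a (p : int) n v : p <= 0 -> hv b p (S a n v) = S a n (hv b p v).
Proof.
move=> p0; apply: S_comm => // m w m0; rewrite hv_hv ifF ?mulr0z ?addr0 //; lia.
Qed.

Lemma S_S a b i j v : S a i (S b j v) = S b j (S a i v).
Proof.
apply: S_comm => [|m w m0]; first exact: S_addf.
by rewrite hv_S_le0 //; lia.
Qed.

Lemma Sz_shift X a (c : int) (p : nat) : addf X -> (0 < p)%N ->
  (forall n v, X (S a n v) =
     S a n (X v) + (if (p <= n)%N then S a (n - p)%N v *~ c else 0)) ->
  forall k v, X (Sz a k v) = Sz a k (X v) + Sz a (k - p%:Z) v *~ c.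
Proof.
move=> hX p0 XS [] k v; last first.
  by rewrite /= (addf0 hX) add0r (_ : _ - p%:Z = Negz (k + p)) ?mul0rz // !NegzE; lia.
rewrite [LHS]XS; congr (_ + _); have [pk|kp] := leqP p k; first by rewrite subzn.
by rewrite (_ : k%:Z - p%:Z = Negz (p - k).-1) ?mul0rz // NegzE; lia.
Qed.

Lemma heis_Sz i a (p k : int) v : hs i p (Sz a k v) =
  Sz a k (hs i p v) + (if 0 < p then Sz a (k - p) v *~ form (simple i) a else 0).
Proof.
have [p0|p0] := ltP 0 p; last first.
  by case: k => k /=; rewrite ?addr0 ?heis_S_le0 // (addf0 (hadd _ _)).
case: p p0 => // p p0; apply: Sz_shift => // n w; exact: heis_S_pos.
Qed.

Lemma hv_Sz b a (p : nat) (k : int) v : (0 < p)%N -> hv b p%:Z (Sz a k v) =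
  Sz a k (hv b p%:Z v) + Sz a (k - p%:Z) v *~ form b a.
Proof. by move=> p0; apply: Sz_shift => // n w; exact: hv_S_pos. Qed.

Lemma A_heis_neg i a (p n : nat) v : (0 < p)%N -> hs i (- p%:Z) (A a n v) =
  A a n (hs i (- p%:Z) v) + (if (p <= n)%N then A a (n - p)%N v *~ form (simple i) a else 0).
Proof.
move=> p0; apply: (exp_family_shift (d := fun m w => - hv a m%:Z w) _ (A0 a) (Arec a)) => //.
  by move=> m; apply/linear_map_addf/mlin/hvlin.
move=> m w m0; rewrite (addfN (hadd _ _)) heis_hv opprD; congr (_ + _).
rewrite (_ : (- p%:Z + m%:Z == 0) = (m == p)); last by lia.
by case: eqP => _; rewrite -mulrNz ?oppr0 // mulNr opprK.
Qed.

Lemma A_comm X a : addf X ->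
  (forall (m : nat) v, (0 < m)%N -> X (hv a m%:Z v) = hv a m%:Z (X v)) ->
  forall n v, X (A a n v) = A a n (X v).
Proof.
move=> hX h; apply: (exp_family_commute (d := fun m w => - hv a m%:Z w) (A0 a) (Arec a)) => // m v m0.
by rewrite (addfN hX) h.
Qed.

Lemma A_heis_ge0 i a (p : int) n v : 0 <= p -> hs i p (A a n v) = A a n (hs i p v).
Proof.
move=> p0; apply: A_comm => // m w m0; rewrite heis_hv.
have [e|ne] := eqVneq (p + m%:Z) 0; first by lia.
by rewrite mulr0z addr0.
Qed.

Lemma A_exp a n g : A a n (ex g) = if n == 0%N then ex g else 0.
Proof.
elim/ltn_ind: n => -[_|n IHn]; first by rewrite A0.
apply: (@mulrn_inj _ _ _ _ n); rewrite Arec /= mul0rn.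
rewrite big_nat big1 // => m /andP[m1 mn]; rewrite IHn; last by lia.
case: eqP => _; last by rewrite (addf0 (hvadd _ _)) oppr0.
by rewrite (heisv_exp fock) ?oppr0 //; lia.
Qed.

Lemma A_vanishing a v : vanishing (fun n => A a n v).
Proof.
move: v; apply: (fock_ind fock) => [k u v [N hN] [M hM]|g|i k v [N hN]].
- exists (maxn N M) => n; rewrite geq_max => /andP[h1 h2].
  by rewrite A_linear hN // hM // scaler0 addr0.
- by exists 1%N => -[|n] // _; rewrite A_exp.
exists (N + k.+1)%N => n hn.
have h := A_heis_neg i a n v (isT : (0 < k.+1)%N).
rewrite NegzE (_ : A a n (hs i (- k.+1%:Z) v) = hs i (- k.+1%:Z) (A a n v) -
  (if (k < n)%N then A a (n - k.+1)%N v *~ form (simple i) a else 0)); last by rewrite h addrK.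
rewrite hN ?(addf0 (hadd _ _)) ?hN ?mul0rz; try by lia.
by rewrite if_same subr0.
Qed.

(* the coefficients of (1 - x)^(a, b) *)
Definition Acoef (a b : L) (i : nat) : int := (-1) ^+ i * binz (form a b) i.

(** The logarithmic derivative of (1 - x)^M: x d/dx (1 - x)^M = - M x (1 - x)^M / (1 - x). *)
Lemma Acoef_rec a b j :
  Acoef a b j *+ j = - (form a b * \sum_(0 <= i < j) Acoef a b i).
Proof.
set M := form a b.
(* Division by 1 - x: the partial sums of the coefficients of (1 - x)^M are the coefficients of (1 -
   x)^(M-1). *)
suff sumE k : \sum_(0 <= i < k.+1) Acoef a b i = (-1) ^+ k * binz (M - 1) k.
  case: j => [|j]; first by rewrite big_geq // mulr0 oppr0.
  rewrite sumE /Acoef -mulrnAr.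
  have -> : binz (form a b) j.+1 *+ j.+1 = M * binz (M - 1) j.
    have h1 := binz_absorb (M - 1) j; have h2 := binzS (M - 1) j.
    rewrite subrK in h2; rewrite -/M h2 mulrnDl h1 -mulr_natr natz.
    by rewrite -addn1 PoszD; ring.
  by rewrite exprS; ring.
elim: k => [|k IHk]; first by rewrite big_nat1 /Acoef !binz0.
rewrite big_nat_recr //= IHk /Acoef exprS -/M.
have := binzS (M - 1) k; rewrite subrK => ->; by ring.
Qed.

(** In generating series: moving the annihilation exponential of a in z past the creation
    exponential of b in w produces the factor (1 - w/z)^(a, b). Its coefficients are integers, which
    is the source of integrality later. *)
Lemma A_S a b j k v : A a j (S b k v) =
  \sum_(0 <= i < j.+1) Sz b (k%:Z - i%:Z) (A a (j - i)%N v) *~ Acoef a b i.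
Proof.
elim/ltn_ind: j k v => -[_ k v|j IHj k v].
  by rewrite big_nat1 !A0 subr0 /Acoef binz0 mulr1.
apply: (@mulrn_inj _ _ _ _ j); rewrite Arec.
set n := j.+1.
pose F m i := - (Sz b (k%:Z - i%:Z) (hv a m%:Z (A a (n - i - m)%N v)) *~ Acoef a b i).
pose G r i := Sz b (k%:Z - r%:Z) (A a (n - r)%N v) *~ (- (form a b * Acoef a b i)).
transitivity (\sum_(1 <= m < n.+1) \sum_(0 <= i < (n - m).+1) (F m i + G (i + m)%N i)).
  apply: eq_big_nat => m /andP[m1 mj]; rewrite IHj; last by rewrite /n in mj *; lia.
  rewrite (addf_sum (hvadd _ _)) -sumrN; apply: eq_bigr => i _.
  rewrite (addfMz (hvadd _ _)) hv_Sz // mulrzDl opprD /F /G subnAC; congr (_ + _).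
  rewrite -mulrzA -mulrNz; congr (Sz b _ (A a _ v) *~ _); lia.
have -> : \sum_(1 <= m < n.+1) \sum_(0 <= i < (n - m).+1) (F m i + G (i + m)%N i) =
    \sum_(1 <= m < n.+1) \sum_(0 <= i < (n - m).+1) F m i +
    \sum_(1 <= m < n.+1) \sum_(0 <= i < (n - m).+1) G (i + m)%N i.
  by rewrite -big_split; apply: eq_bigr => m _; rewrite -big_split.
rewrite triangle_swap [X in _ + X]triangle_swap triangle_diag.
have -> : \sum_(0 <= i < n.+1) \sum_(1 <= m < (n - i).+1) F m i =
    \sum_(0 <= i < n.+1) Sz b (k%:Z - i%:Z) (A a (n - i)%N v) *~ Acoef a b i *+ (n - i).
  apply: eq_bigr => i _.
  transitivity (Sz b (k%:Z - i%:Z) (A a (n - i)%N v *+ (n - i)) *~ Acoef a b i).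
    rewrite Arec (addf_sum (Sz_addf _ _)) mulrz_suml; apply: eq_bigr => m _.
    by rewrite /F (addfN (Sz_addf _ _)) mulNrz.
  rewrite (addfMn (Sz_addf _ _)); exact: (mulrzAC _ (n - i)%N%:Z).
have -> : \sum_(1 <= r < n.+1) \sum_(0 <= i < r) G r i =
    \sum_(0 <= i < n.+1) Sz b (k%:Z - i%:Z) (A a (n - i)%N v) *~ Acoef a b i *+ i.
  rewrite [RHS]big_ltn // mulr0n add0r; apply: eq_bigr => r _.
  rewrite /G -mulrz_sumr sumrN -big_distrr /= -Acoef_rec.
  by rewrite -mulr_natr natz mulrzA.
rewrite -big_split -sumrMnl; apply: eq_big_nat => i /andP[_ ni] /=.
by rewrite -mulrnDr subnK.
Qed.

Definition shift (a : L) : V -> V := le (fun b => bv (b.1, a + b.2)).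

Lemma shift_linear a : linear_map (shift a).
Proof. exact: (fock_ext_linear fock). Qed.
Lemma shift_addf a : addf (shift a).
Proof. exact/linear_map_addf/shift_linear. Qed.
Lemma shift_bv a m g : shift a (bv (m, g)) = bv (m, a + g).
Proof. exact: (fock_ext_basis fock). Qed.

Lemma heis_shift i n a v : hs i n (shift a v) =
  shift a (hs i n v) + (if n == 0 then shift a v *~ form (simple i) a else 0).
Proof.
case: n => [[|k]|k]; rewrite ?addr0 /=.
- move: v; apply: (linear_map_ext fock) => [||[m g]].
  + exact: linear_map_comp (hlin _ _) (shift_linear a).
  + have -> : (fun v => shift a (hs i 0%N v) + shift a v *~ form (simple i) a) =
        (fun v => shift a (hs i 0%N v) + (form (simple i) a)%:~R *: shift a v).
      by apply/funext => w; rewrite scaler_intr_mulz.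
    apply: linear_mapD; first exact: linear_map_comp (shift_linear a) (hlin _ _).
    exact/linear_map_scale/shift_linear.
  rewrite shift_bv (fock_heis_zero fock) [hs i 0%N _](fock_heis_zero fock).
  rewrite (linear_mapZ _ _ (shift_linear a)) shift_bv -scaler_intr_mulz -scalerDl.
  by rewrite -intrD addrC -formDr addrC.
- move: v; apply: (linear_map_ext fock) => [||[m g]].
  + exact: linear_map_comp (hlin _ _) (shift_linear a).
  + exact: linear_map_comp (shift_linear a) (hlin _ _).
  rewrite shift_bv !(fock_heis_pos fock) (addf_sum (shift_addf a)).
  by apply: eq_bigr => j _; rewrite (linear_mapZ _ _ (shift_linear a)) shift_bv.
move: v; apply: (linear_map_ext fock) => [||[m g]].
- exact: linear_map_comp (hlin _ _) (shift_linear a).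
- exact: linear_map_comp (shift_linear a) (hlin _ _).
by rewrite shift_bv !(fock_heis_neg fock) shift_bv.
Qed.

(** The vertex operator of e^a with z^(a(0)) frozen to z^(a, g) and without the cocycle sign. Unlike
    [E a n] it is given by one formula on the whole space, which makes commutation rules
    accessible. *)
Definition Eg (a : L) (n : int) (g : L) (v : V) : V :=
  fsum (fun j : nat => Sz a (j%:Z - n - 1 - form a g) (A a j (shift a v))).

Lemma Eg_vanishing a n g v :
  vanishing (fun j : nat => Sz a (j%:Z - n - 1 - form a g) (A a j (shift a v))).
Proof.
have [N hN] := A_vanishing a (shift a v).
by exists N => j hj; rewrite hN // (addf0 (Sz_addf _ _)).
Qed.

Lemma Eg_linear a n g : linear_map (Eg a n g).
Proof.
apply: (linear_map_fsum (F := fun j v =>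
    Sz a (j%:Z - n - 1 - form a g) (A a j (shift a v)))) => [j|v].
  exact: linear_map_comp (Sz_linear _ _)
    (linear_map_comp (A_linear a j) (shift_linear a)).
exact: Eg_vanishing.
Qed.

(** On these vectors the exponent (a, g) and the sign of [E a n] are constant, and Heisenberg modes
    and Schur operators do not leave them. *)
Inductive sector (g : L) : V -> Prop :=
| SectorBasis m : sector g (bv (m, g))
| SectorLin k u v : sector g u -> sector g v -> sector g (k *: u + v).

Lemma sector0 g : sector g 0.
Proof.
rewrite -(subrr (ex g)) addrC -scaleN1r.
by apply: SectorLin; apply: SectorBasis.
Qed.

Lemma sectorZ g k v : sector g v -> sector g (k *: v).
Proof. by move=> hv; rewrite -[_ *: _]addr0; apply: SectorLin => //; apply: sector0. Qed.

Lemma sector_heis g i n v : sector g v -> sector g (hs i n v).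
Proof.
elim=> [m|k u w _ hu _ hw]; last by rewrite hlin; apply: SectorLin.
case: n => [[|k]|k].
- by rewrite [hs i _ _](fock_heis_zero fock); apply/sectorZ/SectorBasis.
- rewrite (fock_heis_pos fock); elim/big_ind: _ => [|x y hx hy|j _].
  + exact: sector0.
  + by rewrite -[x]scale1r; apply: SectorLin.
  + exact/sectorZ/SectorBasis.
- by rewrite (fock_heis_neg fock); apply: SectorBasis.
Qed.

Lemma sector_hv g a n v : sector g v -> sector g (hv a n v).
Proof.
move=> gv; rewrite /heisv; elim/big_ind: _ => [|x y hx hy|i _].
- exact: sector0.
- by rewrite -[x]scale1r; apply: SectorLin.
- exact/sectorZ/sector_heis.
Qed.

Lemma sector_S g a n v : sector g v -> sector g (S a n v).
Proof.
move=> gv; apply: (exp_family_ind (d := fun m => hv a (- m%:Z)) (S0 a) (Srec a)) => //.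
  by move=> k u w; apply: SectorLin.
by move=> m u _; apply: sector_hv.
Qed.

Lemma E_sector a n g v : sector g v -> E a n v = Eg a n g v *~ (-1) ^+ eps a g.
Proof.
elim=> [m|k u w _ hu _ hw].
  by rewrite Ebasis signr_scale /Eg shift_bv.
by rewrite Elin Eg_linear hu hw mulrzDl scalerMzr.
Qed.

(** Only one factor of the vertex operator contributes to the commutator: the creation exponential
    for p > 0, the shift by a for p = 0, the annihilation exponential for p < 0. *)
Lemma heis_Eg i p a n g v : hs i p (Eg a n g v) =
  Eg a n g (hs i p v) + Eg a (n + p) g v *~ form (simple i) a.
Proof.
have vg n' w := Eg_vanishing a n' g w.
have vz n' w : vanishing (fun j : nat =>
    Sz a (j%:Z - n' - 1 - form a g) (A a j (shift a w)) *~ form (simple i) a).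
  exact: (vanishingZ (fun=> form (simple i) a) (vg n' w)).
have EZ n' w : Eg a n' g w *~ form (simple i) a = fsum (fun j : nat =>
    Sz a (j%:Z - n' - 1 - form a g) (A a j (shift a w)) *~ form (simple i) a).
  rewrite /Eg (addf_fsum (phi := fun v => v *~ form (simple i) a)) //.
  by move=> x y; rewrite mulrzBl.
rewrite {1}/Eg (addf_fsum (hadd _ _)) //.
have [p0|p0] := ltP p 0; last first.
  rewrite EZ -fsumD //; apply: fsum_ext => j.
  rewrite heis_Sz A_heis_ge0 // heis_shift (addfD (A_addf _ _)) (addfD (Sz_addf _ _)).
  rewrite -addrA; congr (_ + _); have [->|pn0] := eqVneq p 0.
    by rewrite /= !addr0 (addfMz (A_addf _ _)) (addfMz (Sz_addf _ _)).
  rewrite ifT; last by lia.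
  rewrite (addf0 (A_addf _ _)) (addf0 (Sz_addf _ _)) add0r.
  by congr (Sz _ _ _ *~ _); lia.
have [r r0 pE] : exists2 r : nat, (0 < r)%N & p = - r%:Z by exists `|p|%N; lia.
transitivity (fsum (fun j : nat => Sz a (j%:Z - n - 1 - form a g)
    (A a j (shift a (hs i p v))) + (if (r <= j)%N then Sz a (j%:Z - n - 1 - form a g)
     (A a (j - r)%N (shift a v)) *~ form (simple i) a else 0))).
  apply: fsum_ext => j; rewrite heis_Sz (_ : 0 < p = false); last by lia.
  rewrite addr0 pE A_heis_neg // -pE heis_shift (_ : p == 0 = false); last by lia.
  rewrite addr0 (addfD (Sz_addf _ _)); congr (_ + _).
  by case: ifP; rewrite ?(addf0 (Sz_addf _ _)) // (addfMz (Sz_addf _ _)).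
have vr : vanishing (fun j : nat => if (r <= j)%N then Sz a (j%:Z - n - 1 - form a g)
     (A a (j - r)%N (shift a v)) *~ form (simple i) a else 0).
  have [N hN] := A_vanishing a (shift a v); exists (N + r)%N => j hj.
  by rewrite ifT ?hN ?(addf0 (Sz_addf _ _)) ?mul0rz //; lia.
rewrite fsumD //; congr (_ + _); rewrite EZ (fsum_shift (k := r)) //; last first.
  by move=> j jr; rewrite ifF //; lia.
apply: fsum_ext => j; rewrite leq_addl addnK.
by congr (Sz _ _ _ *~ _); lia.
Qed.

Lemma heis_E i p a n v :
  hs i p (E a n v) = E a n (hs i p v) + E a (n + p) v *~ form (simple i) a.
Proof.
move: v; apply: (linear_map_ext fock) => [||[m g]].
- exact: linear_map_comp (hlin _ _) (Elin _ _).
- have -> : (fun v => E a n (hs i p v) + E a (n + p) v *~ form (simple i) a) =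
      (fun v => E a n (hs i p v) + (form (simple i) a)%:~R *: E a (n + p) v).
    by apply/funext => w; rewrite scaler_intr_mulz.
  apply: linear_mapD; first exact: linear_map_comp (Elin _ _) (hlin _ _).
  exact/linear_map_scale/Elin.
have gm : sector g (bv (m, g)) by exact: SectorBasis.
rewrite (E_sector a n gm) (E_sector a (n + p) gm) (E_sector a n (sector_heis i p gm)).
by rewrite (addfMz (hadd _ _)) heis_Eg mulrzDl mulrzAC.
Qed.

Lemma E_addf a n : addf (E a n). Proof. exact/linear_map_addf/Elin. Qed.

Lemma E_exp a n g : E a n (ex g) =
  Sz a (- n - 1 - form a g) (ex (a + g)) *~ (-1) ^+ eps a g.
Proof.
rewrite (E_sector a n (SectorBasis g _)) /Eg (@fsum1 _ _ 0%N) => [|j j0].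
  by rewrite shift_bv A0 add0r.
by rewrite shift_bv A_exp (negbTE j0) (addf0 (Sz_addf _ _)).
Qed.

Lemma E_field a : is_field (E a).
Proof.
split=> [n|]; first exact: E_addf.
apply: (fock_ind fock) => [k u v [N hN] [M hM]|g|i k v [N hN]].
- exists (Num.max N M) => n; rewrite ge_max => /andP[h1 h2].
  by rewrite Elin hN // hM // scaler0 addr0.
- exists (- form a g) => n hn; rewrite E_exp.
  have : - n - 1 - form a g < 0 by lia.
  by case: (- n - 1 - form a g) => // j _; rewrite mul0rz.
exists (N + k.+1%:Z) => n hn.
have h := heis_E i (Negz k) a n v.
rewrite (_ : E a n (hs i (Negz k) v) = hs i (Negz k) (E a n v) -
  E a (n + Negz k) v *~ form (simple i) a); last by rewrite h addrK.
rewrite !hN ?(addf0 (hadd _ _)) ?mul0rz ?subrr //; rewrite ?NegzE; lia.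
Qed.

(** * Locality of the generating fields *)

Lemma local_heis_heis i j : local (hs i) (hs j).
Proof.
(* The commutator is m (alpha_i, alpha_j) on the line m + n = 0, and the second difference of the
   linear function m is zero. *)
exists 2%N => v; pose f (m n : int) := if m + n == 0 then m * Q i j else 0.
have -> : commutator (hs i) (hs j) v = fun m n => v *~ f m n.
  apply/funext => m; apply/funext => n.
  by rewrite /commutator /sub2 /modes /swap (heis_comm symQ fock) addrC addKr scaler_int.
rewrite /= /zmw; apply/funext => m; apply/funext => n; rewrite -!mulrzBr.
rewrite -[RHS](mulr0z v); congr (_ *~ _); rewrite /f.
rewrite (_ : m + 1 + 1 + n = m + n + 1 + 1); last by ring.
rewrite (_ : m + 1 + (n + 1) = m + n + 1 + 1); last by ring.
rewrite (_ : m + (n + 1 + 1) = m + n + 1 + 1); last by ring.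
by case: ifP => _; rewrite ?subrr //; ring.
Qed.

Lemma local_heis_E i a : local (hs i) (E a).
Proof.
(* The commutator depends on m + n only, so a single difference kills it. *)
exists 1%N => v /=; apply/funext => m; apply/funext => n.
rewrite /zmw /commutator /sub2 /modes /swap !heis_E.
rewrite [X in X - _]addrC addKr [X in _ - X]addrC addKr.
by rewrite (_ : n + (m + 1) = n + 1 + m) ?subrr //; ring.
Qed.

Lemma shift_Sz a b k v : shift a (Sz b k v) = Sz b k (shift a v).
Proof.
case: k => k /=; last exact: (addf0 (shift_addf a)).
apply: S_comm => [|m w m0]; first exact: shift_addf.
rewrite /heisv (addf_sum (shift_addf a)); apply: eq_bigr => i _.
rewrite (linear_mapZ _ _ (shift_linear a)) heis_shift.
by rewrite (_ : - m%:Z == 0 = false) ?addr0 //; lia.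
Qed.

Lemma A_Sz_exp a b j k g : A a j (Sz b k (ex g)) = Sz b (k - j%:Z) (ex g) *~ Acoef a b j.
Proof.
case: k => k; last first.
  rewrite /= (addf0 (A_addf _ _)) (_ : _ - j%:Z = Negz (k + j)) ?mul0rz //.
  by rewrite !NegzE; lia.
rewrite A_S big_nat_recr //= subnn A0 big_nat big1 ?add0r // => i /andP[_ ij].
rewrite A_exp (_ : (j - i)%N == 0%N = false) ?(addf0 (Sz_addf _ _)) ?mul0rz //; lia.
Qed.

Lemma sector_Sz g a k v : sector g v -> sector g (Sz a k v).
Proof. by case: k => k gv; [apply: sector_S|apply: sector0]. Qed.

(** The normally ordered product of the two vertex operators on e^g. It is symmetric under exchange
    of the fields, and both orders of composition come from it by expanding (z - w)^(a, b), up to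
    sign. *)
Let pair_modes a b g (m n : int) : V :=
  Sz a (- m - 1 - form a g) (Sz b (- n - 1 - form b g) (ex (a + (b + g)))).

Let modes_E_E a b g : modes (E a) (E b) (ex g) = fun m n =>
  iota_zw (form a b) (pair_modes a b g) m n *~ ((-1) ^+ eps a (b + g) * (-1) ^+ eps b g).
Proof.
apply/funext => m; apply/funext => n; rewrite /modes E_exp (addfMz (E_addf _ _)).
rewrite (E_sector a m (sector_Sz b _ (SectorBasis (b + g) mset0))) -mulrzA; congr (_ *~ _).
apply: fsum_ext => i; rewrite shift_Sz shift_bv A_Sz_exp (addfMz (Sz_addf _ _)).
rewrite /pair_modes formDr; congr (Sz a _ (Sz b _ _) *~ _); lia.
Qed.

Let Sz_neg a k v : k < 0 -> Sz a k v = 0.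
Proof. by case: k. Qed.

Let pair_modes_trunc2 a b g : trunc2 (pair_modes a b g).
Proof.
exists (- form b g) => m n h; rewrite /pair_modes [Sz b _ _]Sz_neg; last lia.
exact: (addf0 (Sz_addf _ _)).
Qed.

Let pair_modes_trunc1 a b g : trunc1 (pair_modes a b g).
Proof.
by exists (- form a g) => n m h; rewrite /swap /pair_modes Sz_neg //; lia.
Qed.

Let pair_modes_swap a b g : pair_modes b a g = swap (pair_modes a b g).
Proof.
apply/funext => m; apply/funext => n; rewrite /swap /pair_modes addrCA.
case: (- m - 1 - _) => i; case: (- n - 1 - _) => j //=; rewrite ?(addf0 (S_addf _ _)) //.
exact: S_S.
Qed.

(** The commutator map of the cocycle supplies exactly the sign between (w - z)^(a, b) and (z -
    w)^(a, b). *)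
Let sign_swap a b g : (-1 : int) ^+ eps b (a + g) * (-1) ^+ eps a g =
  (-1) ^+ `|form a b|%N * ((-1) ^+ eps a (b + g) * (-1) ^+ eps b g).
Proof.
have h1 := cocycleP epsP a b g; have h2 := cocycleP epsP b a g.
have h3 := cocycle_comm epsP a b; rewrite [b + a]addrC in h2.
rewrite -[(-1) ^+ `|_|%N]signr_odd -h3.
move: h1 h2; case: (eps a b); case: (eps b a); case: (eps (a + b) g);
  case: (eps b g); case: (eps a (b + g)); case: (eps a g); case: (eps b (a + g)) => //=.
Qed.

Lemma iter_zmw_shift N (f : int -> int -> V) p q :
  iter N (@zmw V) (fun m n => f (m + p) (n + q)) =
  fun m n => iter N (@zmw V) f (m + p) (n + q).
Proof.
elim: N => //= N ->; apply/funext => m; apply/funext => n.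
by rewrite /zmw ![_ + 1 + _]addrAC.
Qed.

(** On e^g the two products are the two expansions of (z - w)^(a, b) applied to one family, so |(a,
    b)| further factors make the power nonnegative and the difference zero. A creation operator only
    adds shifted copies of the previous commutator, hence the exponent is the same for all v. *)
Lemma local_E_E a b : local (E a) (E b).
Proof.
set M := form a b; exists `|M|%N; apply: (fock_ind fock) => [k u v hu hv'|g|i k v hv'].
- have -> : commutator (E a) (E b) (k *: u + v) =
      sub2 (fun m n => k *: commutator (E a) (E b) u m n)
           (fun m n => - commutator (E a) (E b) v m n).
    apply/funext => m; apply/funext => n.
    rewrite /commutator /sub2 /modes /swap !Elin opprK scalerBr opprD.
    by rewrite addrACA.
  have aZ : addf (fun v : V => k *: v) by move=> x y; rewrite scalerBr.
  have aN : addf (fun v : V => - v) by move=> x y; rewrite opprB opprK addrC.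
  rewrite iter_zmw_sub (iter_zmw_addf _ _ aZ) (iter_zmw_addf _ _ aN) hu hv'.
  by apply/funext => m; apply/funext => n; rewrite /sub2 scaler0 oppr0 subrr.
- pose sg := (-1 : int) ^+ eps a (b + g) * (-1) ^+ eps b g.
  have -> : commutator (E a) (E b) (ex g) = fun m n =>
      sub2 (iota_zw M (pair_modes a b g)) (iota_wz M (pair_modes a b g)) m n *~ sg.
    apply/funext => m; apply/funext => n; rewrite /commutator /sub2 !modes_E_E mulrzBl.
    congr (_ - _); rewrite /swap /iota_wz pair_modes_swap (formC symQ b a) -mulrzA.
    by rewrite sign_swap.
  have aM : addf (fun v : V => v *~ sg) by move=> x y; rewrite mulrzBl.
  rewrite (iter_zmw_addf _ _ aM) iter_zmw_sub.
  rewrite iter_zmw_iota_zw // iter_zmw_iota_wz //.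
  have [k ->] : exists k : nat, M + `|M|%N%:Z = k%:Z by exists `|(M + `|M|%N%:Z)%R|%N; lia.
  rewrite iota_zw_nat // iota_wz_nat //.
  by apply/funext => m; apply/funext => n; rewrite /sub2 subrr mul0rz.
pose p := Negz k; pose c := form (simple i) a; pose d := form (simple i) b.
pose f := commutator (E a) (E b) v.
have -> : commutator (E a) (E b) (hs i p v) = sub2 (sub2 (fun m n => hs i p (f m n))
    (fun m n => f (m + p) (n + 0) *~ c)) (fun m n => f (m + 0) (n + p) *~ d).
  apply/funext => m; apply/funext => n; rewrite /f /commutator /sub2 /modes /swap.
  have E1 x y m' n' : E x m' (E y n' (hs i p v)) = hs i p (E x m' (E y n' v)) -
      E x (m' + p) (E y n' v) *~ form (simple i) x - E x m' (E y (n' + p) v) *~ form (simple i) y.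
    by rewrite !heis_E (addfD (E_addf _ _)) (addfMz (E_addf _ _)) !addrK.
  rewrite !E1 (hadd _ _) !addr0 -/c -/d.
  rewrite [(_ - E b n _) *~ c]mulrzBl [(_ - E b (n + p) _) *~ d]mulrzBl.
  by rewrite !opprD !opprK [LHS](AC (3*3) ((1*4)*(2*6)*(3*5))).
have aM z : addf (fun v : V => v *~ z) by move=> x y; rewrite mulrzBl.
have f0 : iter `|M|%N (@zmw V) f = fun _ _ => 0 by exact: hv'.
rewrite !iter_zmw_sub (iter_zmw_addf _ _ (hadd _ _)) !(iter_zmw_addf _ _ (aM _)).
rewrite (iter_zmw_shift _ f p 0) (iter_zmw_shift _ f 0 p) f0.
apply/funext => m; apply/funext => n.
by rewrite /sub2 (addf0 (hadd _ _)) !mul0rz !subrr.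
Qed.

(** * The translation operator and covariance *)

Lemma enum_mset1D (x : osc l) (m : {mset (osc l)}%mset) :
  perm_eq (enum_mset (x +` m)%mset) (x :: enum_mset m).
Proof.
have -> : (x +` m)%mset = seq_mset (x :: enum_mset m).
  apply/msetP => y; rewrite mset1DE mset_seqE /= -mset_seqE seq_mset_id.
  by rewrite eq_sym.
exact: perm_eq_seq_mset.
Qed.

(* The derivation T with T alpha_i(-k-1) = (k+1) alpha_i(-k-2) and
   T e^g = g(-1) e^g. *)
Definition deriv : V -> V := le (fun b =>
  \sum_(x <- enum_mset b.1) bv (((x.1, x.2.+1) +` (b.1 `\ x))%mset, b.2) *+ x.2.+1 +
  \sum_(i < l) (b.2 0 i)%:~R *: bv (((i, 0%N) +` b.1)%mset, b.2)).

Lemma deriv_linear : linear_map deriv.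
Proof. exact: (fock_ext_linear fock). Qed.
Lemma deriv_addf : addf deriv.
Proof. exact/linear_map_addf/deriv_linear. Qed.

Lemma deriv_exp g : deriv (ex g) = hv g (-1) (ex g).
Proof.
rewrite /deriv (fock_ext_basis fock) /= enum_mset0 big_nil add0r.
by apply: eq_bigr => i _; rewrite -(fock_heis_neg fock).
Qed.

Lemma deriv_heis_neg i k v : deriv (hs i (Negz k) v) =
  hs i (Negz k) (deriv v) + hs i (Negz k.+1) v *+ k.+1.
Proof.
move: v; apply: (linear_map_ext fock) => [||[m g]].
- exact: linear_map_comp deriv_linear (hlin _ _).
- have -> : (fun v => hs i (Negz k) (deriv v) + hs i (Negz k.+1) v *+ k.+1) =
      (fun v => hs i (Negz k) (deriv v) + k.+1%:R *: hs i (Negz k.+1) v).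
    by apply/funext => w; rewrite scaler_nat.
  apply: linear_mapD; first exact: linear_map_comp (hlin _ _) deriv_linear.
  exact/linear_map_scale/hlin.
rewrite (fock_heis_neg fock) /deriv !(fock_ext_basis fock) /=.
rewrite (perm_big _ (enum_mset1D _ _)) big_cons /= (addfD (hadd _ _)) !(addf_sum (hadd _ _)).
rewrite msetD1K -(fock_heis_neg fock) -addrA addrC; congr (_ + _ + _).
  rewrite big_seq [RHS]big_seq; apply: eq_bigr => y ym.
  rewrite (addfMn (hadd _ _)) (fock_heis_neg fock) msetDCA; congr (bv ((_ `+` _)%mset, _) *+ _).
  apply/msetP => z; rewrite msetB1E !mset1DE msetB1E.
  have [->|] := eqVneq z y; rewrite ?subn0 // addnBA // -in_mset //.
apply: eq_bigr => j _; rewrite (linear_mapZ _ _ (hlin _ _)) (fock_heis_neg fock).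
by rewrite msetDCA.
Qed.

Lemma deriv_heis i n v : deriv (hs i n v) - hs i n (deriv v) = - (hs i (n - 1) v *~ n).
Proof.
case: n => n; last first.
  rewrite deriv_heis_neg addrC addKr (_ : Negz n - 1 = Negz n.+1); last by rewrite !NegzE; lia.
  by rewrite (NegzE n) mulrNz opprK.
move: v; apply: (fock_ind fock) => [k u v hu hv'|g|j k v IHv].
- rewrite !(hlin, deriv_linear) mulrzDl scalerMzr opprD addrACA.
  by rewrite hv' -scalerBr hu scalerN opprD.
- rewrite deriv_exp (heis_hv i g n (-1)); have [->|n0] := eqVneq n 0%N.
    rewrite !(fock_heis_zero fock) (linear_mapZ _ _ deriv_linear) deriv_exp.
    by rewrite (linear_mapZ _ _ (hvlin _ _)) addr0 subrr mulr0z oppr0.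
  rewrite (heis_exp fock) ?(addf0 deriv_addf) ?(addf0 (hvadd _ _)) ?add0r; last by lia.
  congr (- _); have [->|n1] := eqVneq n 1%N.
    by rewrite subrr (fock_heis_zero fock) mul1r mulr1z scaler_int.
  rewrite (_ : (n%:Z + -1 == 0) = false); last by lia.
  by rewrite mulr0z (heis_exp fock) ?mul0rz //; lia.
pose dl (m : int) r := if m + Negz r == 0 then m * Q i j else 0.
have C m r w : hs i m (hs j (Negz r) w) = hs j (Negz r) (hs i m w) + w *~ dl m r.
  by rewrite (heis_comm symQ fock) scaler_int.
rewrite deriv_heis_neg !C (addfD deriv_addf) (addfMz deriv_addf) deriv_heis_neg.
rewrite (addfD (hadd _ _)) (addfMn (hadd _ _)) !C mulrnDl !opprD.
rewrite [LHS](AC (3*(2*2)) ((1*4*7)*(2*6)*(3*5))) /= !subrr !addr0 -(hadd _ _) IHv.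
rewrite (addfN (hadd _ _)) (addfMz (hadd _ _)) -opprD mulrzDl; congr (- (_ + _)).
rewrite -[_ *+ _]/(_ *~ k.+1%:Z) -!mulrzA; congr (_ *~ _); rewrite /dl.
have -> : (n%:Z - 1 + Negz k == 0) = (n%:Z + Negz k.+1 == 0) by rewrite !NegzE; lia.
by case: eqP => [|_]; rewrite ?mul0r // NegzE => h; rewrite (_ : k.+1%:Z = n%:Z - 1); [ring|lia].
Qed.

Lemma deriv_hv_neg a (m : nat) v :
  deriv (hv a (- m.+1%:Z) v) = hv a (- m.+1%:Z) (deriv v) + hv a (- m.+2%:Z) v *+ m.+1.
Proof.
rewrite /heisv (addf_sum deriv_addf) -sumrMnl -big_split; apply: eq_bigr => i _ /=.
rewrite (linear_mapZ _ _ deriv_linear) -!NegzE deriv_heis_neg scalerDr.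
by rewrite scalerMnr.
Qed.

(** [T, -] sends the exponent sum a(-m)/m z^m to its z-derivative minus a(-1); the exponential then
    gets multiplied by this difference, whose coefficients are collected in [W]. *)
Lemma deriv_S a n v : deriv (S a n v) =
  S a n (deriv v) + (S a n.+1 v *+ n.+1 - hv a (-1) (S a n v)).
Proof.
pose W n := \sum_(1 <= m < n.+1) hv a (- m.+1%:Z) (S a (n - m)%N v).
have WE k : S a k.+1 v *+ k.+1 - hv a (-1) (S a k v) = W k.
  rewrite Srec big_ltn // subSS subn0 addrC addKr /W big_add1 /=.
  by apply: eq_big_nat => m /andP[m1 mk]; rewrite subSS.
rewrite WE; elim/ltn_ind: n => -[_|n IHn].
  by rewrite /W big_geq // addr0 !S0.
apply: (@mulrn_inj _ _ _ _ n); rewrite mulrnDl -(addfMn deriv_addf) !Srec.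
rewrite (addf_sum deriv_addf).
have -> : W n.+1 *+ n.+1 = \sum_(1 <= m < n.+2) hv a (- m.+1%:Z) (S a (n.+1 - m)%N v) *+ m +
    \sum_(1 <= m < n.+2) hv a (- m%:Z) (W (n.+1 - m)%N).
  have -> : \sum_(1 <= m < n.+2) hv a (- m%:Z) (W (n.+1 - m)%N) =
      \sum_(1 <= m < n.+2) hv a (- m.+1%:Z) (S a (n.+1 - m)%N v *+ (n.+1 - m)).
    transitivity (\sum_(1 <= m < n.+2) \sum_(1 <= r < (n.+1 - m).+1)
        hv a (- m%:Z) (hv a (- r.+1%:Z) (S a (n.+1 - m - r)%N v))).
      by apply: eq_bigr => m _; rewrite /W (addf_sum (hvadd _ _)).
    rewrite triangle_swap; apply: eq_bigr => m _.
    rewrite Srec (addf_sum (hvadd _ _)); apply: eq_big_nat => r /andP[r1 _].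
    have rm : (- r%:Z + - m.+1%:Z == 0) = false by lia.
    by rewrite (hv_hv _ _ (- r%:Z)) rm mulr0z addr0 subnAC.
  rewrite -big_split -sumrMnl; apply: eq_big_nat => m /andP[m1 mn] /=.
  by rewrite (addfMn (hvadd _ _)) -mulrnDr subnKC.
rewrite [in RHS]addrCA -big_split -big_split; apply: eq_big_nat => -[|m] // /andP[_ mn] /=.
rewrite deriv_hv_neg IHn; last by lia.
by rewrite (addfD (hvadd _ _)) addrC.
Qed.

Lemma deriv_Sz a k v : deriv (Sz a k v) =
  Sz a k (deriv v) + (Sz a (k + 1) v *~ (k + 1) - hv a (-1) (Sz a k v)).
Proof.
case: k => k; first by rewrite -PoszD addn1 /= deriv_S.
rewrite /= (addf0 deriv_addf) (addf0 (hvadd _ _)) subr0 add0r.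
case: k => [|k]; first by rewrite mulr0z.
by rewrite (_ : Negz k.+1 + 1 = Negz k) ?mul0rz // !NegzE; lia.
Qed.

Lemma heisvD a b n v : hv (a + b) n v = hv a n v + hv b n v.
Proof.
rewrite /heisv -big_split; apply: eq_bigr => i _ /=.
by rewrite mxE intrD scalerDl.
Qed.

Lemma hv_Sz_neg1 b a k v : Sz a k (hv b (-1) v) = hv b (-1) (Sz a k v).
Proof. by case: k => k /=; rewrite ?hv_S_le0 // (addf0 (hvadd _ _)). Qed.

Lemma E_hv g p a n v :
  E a n (hv g p v) = hv g p (E a n v) - E a (n + p) v *~ form g a.
Proof.
rewrite /heisv (addf_sum (E_addf _ _)) form_suml mulrz_sumr -sumrB.
apply: eq_bigr => i _; rewrite (linear_mapZ _ _ (Elin _ _)) heis_E scalerDr.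
by rewrite [_ *: (_ *~ _)]scaler_int mulrzAC -mulrzA addrK.
Qed.

(** On e^g the terms (a + g)(-1), a(-1) and g(-1) cancel, and the remaining factors k + 1 and (g, a)
    add up to -n. Commuting T and the vertex operator past a creation operator preserves the
    identity. *)
Lemma deriv_E a n v : deriv (E a n v) - E a n (deriv v) = - (E a (n - 1) v *~ n).
Proof.
move: v n; apply: (fock_ind fock) => [k u v hu hv' n|g n|j k v IHv n].
- rewrite !(Elin, deriv_linear) mulrzDl scalerMzr opprD addrACA.
  by rewrite hv' -scalerBr hu scalerN opprD.
- rewrite deriv_exp E_exp (addfMz deriv_addf) deriv_Sz deriv_exp.
  rewrite E_hv.
  set k := - n - 1 - form a g; set s := (-1) ^+ eps a g; set w := ex (a + g).
  have k1 : - (n - 1) - 1 - form a g = k + 1 by rewrite /k; ring.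
  rewrite !E_exp k1 -/k -/s -/w heisvD (addfD (Sz_addf _ _)) !hv_Sz_neg1.
  rewrite (addfMz (hvadd _ _)) [X in X *~ s - _](AC (2*2) ((1*4)*(2*3))) /= subrr add0r.
  rewrite mulrzDl opprB [LHS](AC (2*2) ((1*4)*(2*3))) /= subrr add0r.
  by rewrite -!mulrzA -mulrzDr -mulrNz (formC symQ g a); congr (_ *~ _); rewrite /k; ring.
pose p := Negz k; pose c := form (simple j) a.
have E1 n' w : E a n' (hs j p w) = hs j p (E a n' w) - E a (n' + p) w *~ c.
  by rewrite heis_E addrK.
have E2 n' w : E a n' (hs j (Negz k.+1) w) =
    hs j (Negz k.+1) (E a n' w) - E a (n' + Negz k.+1) w *~ c.
  by rewrite heis_E addrK.
rewrite deriv_heis_neg (addfD (E_addf _ _)) (addfMn (E_addf _ _)) !E1 E2.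
rewrite deriv_addf (addfMz deriv_addf) deriv_heis_neg mulrnBl !opprD !opprK.
rewrite [LHS](AC (3*(2*2)) ((1*4)*(3*5)*(2*6)*7)) /= subrr addr0.
rewrite -(hadd _ _) IHv [- _ + _]addrC -mulrzBl -[E a _ _ - deriv _]opprB IHv opprK.
rewrite mulrzBl opprB (addfN (hadd _ _)) (addfMz (hadd _ _)) -addrA addrC; congr (_ - _).
have -> : n + Negz k.+1 = n - 1 + p by rewrite /p !NegzE; lia.
have -> : n + p - 1 = n - 1 + p by ring.
rewrite -[_ *+ _]/(_ *~ k.+1%:Z) -!mulrzA -mulrzDr; congr (_ *~ _).
by rewrite /p NegzE; ring.
Qed.

Lemma heis_creative i : creative_field (ex 0) deriv (hs i).
Proof.
split; first exact: (heis_field symQ fock i).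
- by move=> n k v; apply: (linear_mapZ _ _ (hlin i n)).
- exact: deriv_heis.
case=> [|n]; last by apply: (heis_exp fock).
by rewrite (fock_heis_zero fock) form0r scale0r.
Qed.

Lemma E_creative a : creative_field (ex 0) deriv (E a).
Proof.
split; first exact: E_field.
- by move=> n k v; apply: (linear_mapZ _ _ (Elin a n)).
- exact: deriv_E.
by move=> n; rewrite E_exp Sz_neg ?mul0rz // form0r; lia.
Qed.

Lemma deriv_vac : deriv (ex 0) = 0.
Proof. by rewrite deriv_exp /heisv big1 // => i _; rewrite mxE scale0r. Qed.

(** * The state-field correspondence on the Fock space *)

Definition generating_field (B : int -> V -> V) : Prop :=
  (exists i, B = hs i) \/ (exists a, B = E a).

Lemma generating_creative B : generating_field B -> creative_field (ex 0) deriv B.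
Proof. by case=> -[x ->]; [apply: heis_creative|apply: E_creative]. Qed.

Lemma generating_local B C : generating_field B -> generating_field C -> local B C.
Proof.
case=> -[x ->] [] [y ->].
- exact: local_heis_heis.
- exact: local_heis_E.
- exact/local_sym/local_heis_E.
- exact: local_E_E.
Qed.

Local Notation closure := (field_closure generating_field).

Let deriv_scale k v : deriv (k *: v) = k *: deriv v.
Proof. exact: (linear_mapZ k v deriv_linear). Qed.

Let tfV (v : V) n : v *+ n.+1 = 0 -> v = 0.
Proof. by move=> h; apply: (@mulrn_inj _ _ _ _ n); rewrite h mul0rn. Qed.

Let closureC B (hB : closure B) :=
  closure_creative deriv_addf deriv_scale generating_creative hB.
Let closureL B C (hB : closure B) (hC : closure C) :=
  closure_local deriv_addf deriv_scale generating_creative generating_local hB hC.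

(* Convertible to [normal_ordered] when the module is [VL]. *)
Definition normal_prod (ik : osc l) (B : int -> V -> V) : int -> V -> V :=
  fun m v => let: (i, k) := ik in
  fsum (fun j : nat =>
    (hs i (- (k + j).+1%:Z) (B (m + j%:Z) v)
     + (-1) ^+ k *: B (m - k.+1%:Z - j%:Z) (hs i j%:Z v)) *+ 'C(k + j, k)).

(** The normally ordered product with the k-th divided derivative is the field product of index
    -k-1; this places the fields of all basis states in the closure. *)
Lemma normal_prodE i k B : is_field B ->
  normal_prod (i, k) B = field_prod (hs i) (Negz k) B.
Proof.
move=> fB; apply/funext => m; apply/funext => v; rewrite field_prodE /normal_prod.
have fi := heis_field symQ fock i.
have bE (j : nat) : (-1) ^+ j * binz (Negz k) j = 'C(k + j, k)%:Z.
  rewrite /= mulrA -expr2 sqrr_sign mul1r; congr Posz.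
  by rewrite -bin_sub ?leq_addl // addnK.
have aM z : addf (fun v : V => v *~ z) by move=> x y; rewrite mulrzBl.
have v2 (c : nat -> int) : vanishing (fun j : nat => B (m + Negz k - j%:Z) (hs i j%:Z v) *~ c j).
  have [N hN] := field_trunc fi v; exists `|N|%N => j hj.
  by rewrite hN ?(addf0 (field_addf fB _)) ?mul0rz //; lia.
rewrite (addf_fsum (aM _)); last exact: v2.
rewrite -fsumB.
- apply: fsum_ext => j; rewrite bE -!mulrzA.
  rewrite -[_ *+ 'C(_, _)]/(_ *~ 'C(k + j, k)%:Z) mulrzDl; congr (_ + _).
    by rewrite (_ : Negz k - j%:Z = - (k + j).+1%:Z) // NegzE; lia.
  rewrite signr_scale -mulrNz -mulrzA (_ : m - k.+1%:Z = m + Negz k) ?NegzE //.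
  by congr (_ *~ _); rewrite abszN /= exprS; ring.
- exact: (vanishing_modes v (Negz k) m _ fi fB).
- by apply: (vanishing_addf (aM _)); apply: v2.
Qed.

Lemma normal_prod_closure x B : closure B -> closure (normal_prod x B).
Proof.
case: x => i k hB; have hi : closure (hs i) by apply: ClosureGen; left; exists i.
rewrite normal_prodE; last exact: cf_field (closureC hB).
by apply: ClosureProd => //; apply: closureL.
Qed.

Definition state_basis (b : fock_index l) : int -> V -> V :=
  foldr normal_prod (E b.2) (enum_mset b.1).
Definition state (a : V) (n : int) (v : V) : V := le (fun b => state_basis b n v) a.

Lemma state_linear n v : linear_map (fun a => state a n v).
Proof. exact: (fock_ext_linear fock). Qed.

Lemma state_bv b : state (bv b) = state_basis b.
Proof.
by apply/funext => n; apply/funext => v; rewrite /state (fock_ext_basis fock).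
Qed.

Lemma state_exp g : state (ex g) = E g.
Proof. by rewrite state_bv /state_basis enum_mset0. Qed.

Lemma state_basis_closure b : closure (state_basis b).
Proof.
rewrite /state_basis; elim: (enum_mset _) => [|x s IHs].
  by apply: ClosureGen; right; exists b.2.
exact: normal_prod_closure.
Qed.

Lemma state_closure a : closure (state a).
Proof.
move: a; apply: (fock_span fock) => [k u v hu hv'|b]; last first.
  by rewrite state_bv; apply: state_basis_closure.
have -> : state (k *: u + v) = fun n w => k *: state u n w + state v n w.
  by apply/funext => n; apply/funext => w; rewrite state_linear.
by apply: ClosureD => //; apply: ClosureZ.
Qed.

Lemma state_vac a : state a (-1) (ex 0) = a.
Proof.
move: a; apply: (fock_span fock) => [k u v hu hv'|[m g]].
  by rewrite state_linear hu hv'.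
rewrite state_bv /state_basis /=.
suff h s : foldr normal_prod (E g) s (-1) (ex 0) = bv (seq_mset s, g).
  by rewrite h seq_mset_id.
elim: s => [|[i k] s IHs].
  rewrite /= E_exp form0r subr0 /= S0 addr0 (cocycle_0r epsP) mulr1z.
  by congr (bv (_, _)); apply/msetP => x; rewrite mset_seqE mset0E.
have hB : closure (foldr normal_prod (E g) s).
  elim: s {IHs} => [|x s IHs]; first by apply: ClosureGen; right; exists g.
  exact: normal_prod_closure.
rewrite -[foldr _ _ _]/(normal_prod (i, k) (foldr normal_prod (E g) s)).
rewrite normal_prodE; last exact: cf_field (closureC hB).
rewrite (field_prod_vac _ (heis_creative i) (closureC hB)).
rewrite IHs (fock_heis_neg fock); congr (bv (_, _)).
by apply/msetP => x; rewrite mset1DE !mset_seqE /= eq_sym.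
Qed.

Lemma state_field a : is_field (state a).
Proof. exact: cf_field (closureC (state_closure a)). Qed.

Lemma state_scaler (c : K) x n y : state x n (c *: y) = c *: state x n y.
Proof. exact: (cf_scale (closureC (state_closure x))). Qed.

Lemma state_local a b : local (state a) (state b).
Proof. exact: closureL (state_closure a) (state_closure b). Qed.

Lemma state_prod a q b : state (state a q b) = field_prod (state a) q (state b).
Proof.
exact: (state_field_prod deriv_addf deriv_scale deriv_vac tfV generating_creative
  generating_local state_closure state_vac).
Qed.

Lemma S_zero n v : S 0 n v = if n == 0%N then v else 0.
Proof.
case: n => [|n]; first by rewrite S0.
apply: (@mulrn_inj _ _ _ _ n); rewrite Srec /= mul0rn big1 // => m _.
by rewrite /heisv big1 // => i _; rewrite mxE scale0r.
Qed.

Lemma E_zero n v : E 0 n v = if n == -1 then v else 0.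
Proof.
move: v; apply: (fock_ind fock) => [k u v hu hv'|g|i k v hv'].
- by rewrite Elin hu hv'; case: ifP => // _; rewrite scaler0 addr0.
- rewrite E_exp (cocycle_0l epsP) mulr1z add0r form0l subr0.
  case: eqP => [->|n1]; first by rewrite /= S0.
  case e : (- n - 1) => [j|j] //=; rewrite S_zero ifF //.
  by apply/eqP => j0; apply: n1; move: e; rewrite j0; lia.
have := heis_E i (Negz k) 0 n v; rewrite form0r mulr0z addr0 => <-; rewrite hv'.
by case: ifP => // _; rewrite (addf0 (hadd _ _)).
Qed.

Definition state_ops : vertex_ops V :=
  VertexOps (ex 0) (fun a => state a (-2) (ex 0)) state.

Lemma state_zva : is_zva state_ops.
Proof.
have addY n b : addf (fun a => state a n b) by exact/linear_map_addf/state_linear.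
split=> /=.
- exact: addY.
- by move=> a n; apply: field_addf (state_field a) n.
- by move=> n b; rewrite state_exp E_zero.
- by move=> a n; apply: (cf_vac (closureC (state_closure a))).
- exact: state_vac.
- by move=> a b; apply: field_trunc (state_field a) b.
- by [].
- exact: (borcherds state_field addY state_local state_prod).
Qed.

Lemma state_mulzl u z n v : state (u *~ z) n v = state u n v *~ z.
Proof. exact: (addfMz (zva_addl state_zva n v)). Qed.
Lemma state_mulzr u z n v : state u n (v *~ z) = state u n v *~ z.
Proof. exact: (addfMz (zva_addr state_zva u n)). Qed.

(** * The integral form: stability and generation *)

Definition IVgen (v : V) : Prop := exists (s : seq (L * nat)) (a : L),
  all (fun p => 0 < p.2)%N s /\ v = foldr (fun p => S p.1 p.2) (ex a) s.
Local Notation IV := (zspan IVgen).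
Local Notation fS s g := (foldr (fun p => S p.1 p.2) (ex g) s).

Lemma zspanD (P : V -> Prop) u v : zspan P u -> zspan P v -> zspan P (u + v).
Proof.
move=> hu hv'; rewrite -[v]opprK -[- v]sub0r; apply: ZspanB => //.
by apply: ZspanB => //; apply: Zspan0.
Qed.

Lemma zspanMz (P : V -> Prop) v z : zspan P v -> zspan P (v *~ z).
Proof.
have N w : zspan P w -> zspan P (- w).
  by move=> hw; rewrite -sub0r; apply: ZspanB => //; apply: Zspan0.
have Mn w n : zspan P w -> zspan P (w *+ n).
  move=> hw; elim: n => [|n IHn]; first exact: Zspan0.
  by rewrite mulrS; apply: zspanD.
by move=> hv'; case: z => n; [apply: Mn|apply/N/Mn].
Qed.

Lemma zspan_addf (P Q' : V -> Prop) (f : V -> V) : addf f ->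
  (forall v, P v -> zspan Q' (f v)) -> forall v, zspan P v -> zspan Q' (f v).
Proof.
move=> hf hP v; elim=> {v} [v /hP //||u v _ hu _ hv'].
  by rewrite (addf0 hf); apply: Zspan0.
by rewrite hf; apply: ZspanB.
Qed.

Lemma IVgen_fS s g : IVgen (fS s g).
Proof.
exists [seq p <- s | (0 < p.2)%N], g; split; first exact: filter_all.
elim: s => //= -[b k] s ->; case: k => [|k] //=.
Qed.

Lemma IV_fS s g : IV (fS s g). Proof. exact/ZspanGen/IVgen_fS. Qed.

Lemma IV_Sz a k v : IV v -> IV (Sz a k v).
Proof.
case: k => k; last by move=> _; apply: Zspan0.
apply: zspan_addf => [|{}v [s [g [_ ->]]]]; first exact: S_addf.
exact: (IV_fS ((a, k) :: s) g).
Qed.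

(* The induction showing that the e^(+-alpha_i) generate runs over length plus degree. *)
Definition deg_gen (r : nat) (e : int) (g : L) (v : V) : Prop :=
  exists s : seq (L * nat), [/\ size s = r, (sumn (map snd s))%:Z = e & v = fS s g].
Local Notation Zs r e g := (zspan (deg_gen r e g)).

Lemma Zs_Sz a k r e g v : Zs r e g v -> Zs r.+1 (k + e) g (Sz a k v).
Proof.
case: k => k; last by move=> _; apply: Zspan0.
apply: zspan_addf => [|{}v [s [<- <- ->]]]; first exact: S_addf.
by apply: ZspanGen; exists ((a, k) :: s); split=> //=; rewrite PoszD.
Qed.

(** [A_S] moves the annihilation coefficient through the factors with integer binomial coefficients;
    on e^g only the coefficient of degree zero is nonzero. *)
Lemma Zs_A a j r e g v : Zs r e g v -> Zs r (e - j%:Z) g (A a j v).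
Proof.
apply: zspan_addf => [|{}v [s [<- <- ->]]]; first exact: A_addf.
elim: s j => [|[b k] s IHs] j /=.
  rewrite A_exp; case: eqP => [->|_]; last exact: Zspan0.
  by apply: ZspanGen; exists [::].
rewrite A_S big_nat; elim/big_ind: _ => [|u w|i /andP[_ ij]].
- exact: Zspan0.
- exact: zspanD.
apply: zspanMz; have := Zs_Sz b (k%:Z - i%:Z) (IHs (j - i)%N).
by rewrite (_ : k%:Z - i%:Z + _ = (k + sumn (map snd s))%N%:Z - j%:Z) //; lia.
Qed.

Lemma Zs_IV r e g v : Zs r e g v -> IV v.
Proof.
elim=> {v} [v [s [_ _ ->]]||u v _ hu _ hv']; [exact: IV_fS|exact: Zspan0|].
exact: ZspanB.
Qed.

Lemma IV_A a j v : IV v -> IV (A a j v).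
Proof.
apply: zspan_addf => [|{}v [s [g [_ ->]]]]; first exact: A_addf.
apply: (@Zs_IV (size s) ((sumn (map snd s))%:Z - j%:Z) g); apply: Zs_A.
by apply: ZspanGen; exists s.
Qed.

Lemma shift_fS a s g : shift a (fS s g) = fS s (a + g).
Proof.
elim: s => [|[b k] s IHs] /=; first exact: shift_bv.
by rewrite -IHs; apply: (shift_Sz a b (Posz k)).
Qed.

Lemma sector_fS s g : sector g (fS s g).
Proof.
by elim: s => [|[b k] s IHs] /=; [apply: SectorBasis|apply: sector_S].
Qed.

Lemma IV_E a n v : IV v -> IV (E a n v).
Proof.
apply: zspan_addf => [|{}v [s [g [_ ->]]]]; first exact: E_addf.
rewrite (E_sector a n (sector_fS s g)); apply: zspanMz; apply: zspan_fsum => j.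
by rewrite shift_fS; apply/IV_Sz/IV_A/IV_fS.
Qed.

Lemma lattice_ind (P : L -> Prop) : P 0 ->
  (forall i g, P g -> P (simple i + g)) -> (forall i g, P g -> P (- simple i + g)) ->
  forall g, P g.
Proof.
move=> P0 Pp Pn g; rewrite (row_sum_simple g).
suff h r : P (\sum_(i <- r) g 0 i *: simple i) by apply: h.
elim: r => [|i r IHr]; first by rewrite big_nil.
rewrite big_cons; move: (\sum_(_ <- r) _) IHr => x Px.
case: (g 0 i) => n; elim: n => [|n IHn].
- by rewrite scale0r add0r.
- by rewrite intS scalerDl scale1r -addrA; apply: Pp.
- by rewrite scaleN1r; apply: Pn.
rewrite (_ : Negz n.+1 = -1 + Negz n); last by rewrite !NegzE; lia.
by rewrite scalerDl scaleN1r -addrA; apply: Pn.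
Qed.

Section Generation.
Variable W : V -> Prop.
Hypotheses (WB : forall u v, W u -> W v -> W (u - v))
  (WE : forall a n v, W (ex a) -> W v -> W (E a n v))
  (W0 : W (ex 0)) (Wp : forall i, W (ex (simple i)))
  (Wn : forall i, W (ex (- simple i))).

Let Wz : W 0. Proof. by rewrite -(subrr (ex 0)); apply: WB. Qed.
Let WD u v : W u -> W v -> W (u + v).
Proof. by move=> hu hv'; rewrite -[v]opprK -[- v]sub0r; do 2?apply: WB. Qed.
Let Wspan (P : V -> Prop) : (forall v, P v -> W v) -> forall v, zspan P v -> W v.
Proof. by move=> PW v; elim=> {v} [v /PW|//|u v _ hu _ hv'] //; apply: WB. Qed.
Let WMz v z : W v -> W (v *~ z).
Proof. by move=> hv'; apply: (Wspan (P := W)) => //; apply/zspanMz/ZspanGen. Qed.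
Let Wsign (v : V) (b : bool) : W (v *~ (-1) ^+ b) -> W v.
Proof.
move/(WMz ((-1) ^+ b)); rewrite -mulrzA -expr2 sqrr_sign mulr1z; exact.
Qed.

Lemma generated_exp g : W (ex g).
Proof.
move: g; apply: lattice_ind => // i g Wg.
  (* The mode of the lowest power of z on e^g: its Schur operator has degree zero, so it returns
     e^(alpha_i + g) up to sign. *)
  have := WE (- 1 - form (simple i) g) (Wp i) Wg.
  rewrite E_exp (_ : - (- 1 - _) - 1 - _ = 0%N%:Z); last by ring.
  by rewrite /= S0 => /Wsign.
have := WE (- 1 - form (- simple i) g) (Wn i) Wg.
rewrite E_exp (_ : - (- 1 - _) - 1 - _ = 0%N%:Z); last by ring.
by rewrite /= S0 => /Wsign.
Qed.

Let Zs_neg r e g v : e < 0 -> Zs r e g v -> v = 0.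
Proof.
move=> e0; elim=> {v} [v [s [_ se _]]|//|u v _ -> _ ->]; last by rewrite subr0.
by move: e0; rewrite -se.
Qed.

(** The bound concerns v, while the degree i of the extra factor is free. A product thus follows
    from its shorter tail, and [S a i v] is the leading term of a mode of Y(e^a, z) whose other
    terms have smaller degree. *)
Lemma generated_Zs N : forall r d g v, (d + r <= N)%N -> Zs r d%:Z g v ->
  W v /\ forall a i, W (S a i v).
Proof.
elim/ltn_ind: N => N IHN r d g v drN.
have W1 h s : (sumn (map snd s) + size s <= N)%N -> W (fS s h).
  case: s => [|[b k] s] /= sN; first exact: generated_exp.
  have sN' : (sumn (map snd s) + size s < N)%N by lia.
  have [|_] := IHN _ sN' (size s) (sumn (map snd s)) h (fS s h) (leqnn _); last exact.
  by apply: ZspanGen; exists s.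
move=> hv'; split.
  apply: Wspan hv' => {}v [s [sr sd ->]]; apply: W1; lia.
move=> a i; suff: zspan (fun v => W v) (S a i v) by apply: Wspan.
move: v hv'; apply: zspan_addf => [|v [s [sr sd vE]]]; first exact: S_addf.
(* The lattice part g - a and the mode n make the term j = 0 equal to [S a i v] up to sign; the
   terms j > 0 contain [A a j v], of degree d - j, and belong to the induction hypothesis. *)
apply: ZspanGen; pose n := - 1 - form a (g - a) - i%:Z.
have : W (E a n (fS s (g - a))) by apply: WE; [apply: generated_exp|apply: W1; lia].
rewrite (E_sector a n (sector_fS s _)) => /Wsign; rewrite /Eg shift_fS [a + (g - a)]addrC subrK -vE.
have Av := A_vanishing a v.
rewrite fsum_recl; last first.
  by have [M hM] := Av; exists M => j hj; rewrite hM // (addf0 (Sz_addf _ _)).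
rewrite A0 (_ : 0%N%:Z - n - 1 - _ = i%:Z); last by rewrite /n; ring.
move=> h; rewrite -[S a i v](addrK (fsum (fun j : nat =>
  Sz a (j.+1%:Z - n - 1 - form a (g - a)) (A a j.+1 v)))).
apply: WB => //; elim/big_ind: _ => [//|u w|j _]; first exact: WD.
have Aj : Zs r (d%:Z - j.+1%:Z) g (A a j.+1 v).
  by apply: Zs_A; apply: ZspanGen; exists s.
have [jd|dj] := leqP j.+1 d; last first.
  by rewrite (Zs_neg _ Aj) ?(addf0 (Sz_addf _ _)) //; lia.
rewrite (_ : j.+1%:Z - n - 1 - _ = (j.+1 + i)%N%:Z); last by rewrite /n; lia.
rewrite subzn // in Aj.
have jN : (d - j.+1 + r < N)%N by lia.
by have [_] := IHN _ jN _ _ _ _ (leqnn _) Aj; apply.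
Qed.

Lemma generated_IV v : IV v -> W v.
Proof.
apply: Wspan => {}v [s [g [_ ->]]].
have [|//] := @generated_Zs _ (size s) (sumn (map snd s)) g (fS s g) (leqnn _).
by apply: ZspanGen; exists s.
Qed.
End Generation.

(** By the product formula, the states whose modes preserve the integral form are closed under modes
    of such e^g; generation reduces the claim to the fields of the e^g. *)
Lemma IV_state a n b : IV a -> IV b -> IV (state a n b).
Proof.
move=> ha; move: n b; pose W a := forall n b, IV b -> IV (state a n b).
suff : W a by [].
have addY n b : addf (fun a => state a n b) by exact/linear_map_addf/state_linear.
have Wex g : W (ex g) by move=> n b; rewrite state_exp; apply: IV_E.
move: a ha; apply: generated_IV => // [u v hu hv' n b hb|a n v _ hv' m b hb].
  by rewrite addY; apply: ZspanB; [apply: hu|apply: hv'].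
rewrite -state_exp state_prod field_prodE.
apply: ZspanB; first by apply: zspan_fsum => i; rewrite state_exp; apply/zspanMz/IV_E/hv'.
by apply/zspanMz; apply: zspan_fsum => i; apply/zspanMz/hv'; rewrite state_exp; apply: IV_E.
Qed.

Lemma IV_vac : IV (ex 0). Proof. exact: (IV_fS [::] 0). Qed.

(** The projection to a basis line stands in for a coordinate, which the abstract module does not
    provide. *)
Definition coef_proj (b : fock_index l) : V -> V :=
  le (fun b' => if b' == b then bv b else 0).
Hypothesis coef_proj_inj : forall v, (forall b, coef_proj b v = 0) -> v = 0.
Hypothesis bv_neq0 : forall b, bv b <> 0.

Lemma coef_proj_linear b : linear_map (coef_proj b).
Proof. exact: (fock_ext_linear fock). Qed.
Lemma coef_proj_addf b : addf (coef_proj b).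
Proof. exact/linear_map_addf/coef_proj_linear. Qed.
Lemma coef_proj_bv b b' : coef_proj b (bv b') = if b' == b then bv b else 0.
Proof. exact: (fock_ext_basis fock). Qed.

Lemma coef_proj_heis_zero i m g v :
  coef_proj (m, g) (hs i 0 v) = (form (simple i) g)%:~R *: coef_proj (m, g) v.
Proof.
move: v; apply: (linear_map_ext fock) => [||[m' g']].
- exact: linear_map_comp (coef_proj_linear _) (hlin _ _).
- exact/linear_map_scale/coef_proj_linear.
rewrite (fock_heis_zero fock) (linear_mapZ _ _ (coef_proj_linear _)) coef_proj_bv.
by case: eqP => [[_ ->]|_]; rewrite ?scaler0.
Qed.

Lemma coef_proj_heis_neg i k g v : coef_proj (mset0, g) (hs i (Negz k) v) = 0.
Proof.
move: v; apply: (linear_map_ext fock) => [||[m' g']].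
- exact: linear_map_comp (coef_proj_linear _) (hlin _ _).
- exact: linear_map0.
rewrite (fock_heis_neg fock) coef_proj_bv ifF //; apply/eqP => -[/msetP /(_ (i, k))].
by rewrite mset1DE mset0E eqxx.
Qed.

Lemma coef_proj_S a n g v :
  coef_proj (mset0, g) (S a n v) = if n == 0%N then coef_proj (mset0, g) v else 0.
Proof.
case: n => [|n]; first by rewrite S0.
apply: (@mulrn_inj _ _ _ _ n); rewrite -(addfMn (coef_proj_addf _)) Srec mul0rn.
rewrite (addf_sum (coef_proj_addf _)) big_nat big1 // => -[//|m] _.
rewrite /heisv (addf_sum (coef_proj_addf _)) big1 // => i _.
by rewrite (linear_mapZ _ _ (coef_proj_linear _)) -NegzE coef_proj_heis_neg scaler0.
Qed.

(** A Schur factor of positive degree consists of creation operators and contributes nothing to the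
    e^g-coordinate. *)
Lemma IV_integral g v : IV v -> exists z : int, coef_proj (mset0, g) v = ex g *~ z.
Proof.
elim=> {v} [v [s [g' [_ ->]]]||u v _ [z hz] _ [t ht]]; last 2 first.
- by exists 0; rewrite (addf0 (coef_proj_addf _)).
- by exists (z - t); rewrite coef_proj_addf hz ht mulrzBr.
elim: s => [|[a n] s [z hz]] /=.
  by rewrite coef_proj_bv; case: ifP; [exists 1|exists 0].
by rewrite coef_proj_S; case: ifP => _; [exists z|exists 0].
Qed.

(** * Weight one and the Chevalley basis *)

Definition homogeneous (n : int) (v : V) : Prop :=
  forall b, conf_weight Q b != n -> coef_proj b v = 0.

Lemma homogeneousB n u v : homogeneous n u -> homogeneous n v -> homogeneous n (u - v).
Proof. by move=> hu hv' b hb; rewrite coef_proj_addf hu // hv' // subrr. Qed.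

Lemma homogeneous_bv n b : conf_weight Q b = n -> homogeneous n (bv b).
Proof.
move=> bn b' b'n; rewrite coef_proj_bv ifF //; apply: contraNF b'n => /eqP <-.
by rewrite bn.
Qed.

Lemma conf_weight_exp g : conf_weight Q (mset0, g) = (form g g %/ 2)%Z.
Proof. by rewrite /conf_weight /= enum_mset0 big_nil add0r. Qed.

Lemma conf_weight1D i k m g :
  conf_weight Q (((i, k) +` m)%mset, g) = conf_weight Q (m, g) + k.+1%:Z.
Proof.
rewrite /conf_weight (perm_big _ (enum_mset1D _ _)) big_cons /= PoszD; ring.
Qed.

Lemma heis_neg_iter i n g : exists m, iter n (hs i (Negz 0)) (ex g) = bv (m, g) /\
  conf_weight Q (m, g) = conf_weight Q (mset0, g) + n%:Z.
Proof.
elim: n => [|n [m [hm wm]]]; first by exists mset0; rewrite addr0.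
exists ((i, 0%N) +` m)%mset; rewrite iterS hm (fock_heis_neg fock); split=> //.
by rewrite conf_weight1D wm -addrA -PoszD addn1.
Qed.

Lemma S_one a v : S a 1 v = hv a (-1) v.
Proof. by rewrite -[S a 1 v]mulr1n Srec big_nat1 S0. Qed.

(** Uniqueness of the field in the closure that creates a given vector replaces an unfolding of
    [state_basis]. *)
Lemma state_heis i : state (hs i (-1) (ex 0)) = hs i.
Proof.
apply: (closure_inj deriv_addf deriv_scale deriv_vac tfV generating_creative
  generating_local state_closure state_vac).
- exact: state_closure.
- by apply: ClosureGen; left; exists i.
exact: state_vac.
Qed.

Section ChevalleyBasis.
Variable e : L -> V.
Local Notation root := (is_root Q).
Hypothesis diagQ : forall i, Q i i = 2.
Hypothesis ehom : forall a, root a -> homogeneous 1 (e a).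
Hypothesis eweight : forall a, root a -> forall i,
  state (hs i (-1) (ex 0)) 0 (e a) = (form (simple i) a)%:~R *: e a.
Hypothesis ecoroot : forall a, root a -> state (e a) 0 (e (- a)) = hv a (-1) (ex 0).
Local Notation cgen := (fun w => (exists i, w = hs i (-1) (ex 0)) \/
                    (exists2 a, root a & w = e a)).
Hypothesis espan : forall v, (IV v /\ homogeneous 1 v) <-> zspan cgen v.

Lemma root_norm a : root a -> form a a = 2.
Proof.
elim=> {a} [i|a i _ IHa]; first by rewrite (form_simple Q) diagQ.
set c := lat_form Q a (simple i).
rewrite !(formDl, formDr, formNl, formNr, formZl, formZr) (form_simple Q) diagQ IHa.
by rewrite (formC symQ (simple i) a) -/c; ring.
Qed.

Lemma root_opp a : root a -> root (- a).
Proof.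
elim=> {a} [i|a i ra IHa].
  rewrite (_ : - simple i = simple i - form (simple i) (simple i) *: simple i).
    exact/RootRefl/RootSimple.
  by rewrite (form_simple Q) diagQ (_ : 2 = 1 + 1) // scalerDl scale1r opprD addrA subrr add0r.
rewrite opprB addrC -[form a _]opprK -formNl scaleNr.
exact: RootRefl.
Qed.

Lemma hv_simple i n v : hv (simple i) n v = hs i n v.
Proof.
rewrite /heisv (bigD1 i) //= big1 ?addr0 => [|j ji]; rewrite mxE eqxx /=.
  by rewrite eqxx scale1r.
by rewrite (negbTE ji) scale0r.
Qed.

Lemma bv_mulz_eq0 b z : bv b *~ z = 0 -> z = 0.
Proof.
rewrite -scaler_int => /eqP; rewrite scaler_eq0 intr_eq0 => /orP[/eqP //|/eqP].
by move/bv_neq0.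
Qed.

Let eweight0 a i : root a -> hs i 0 (e a) = (form (simple i) a)%:~R *: e a.
Proof. by move=> ra; rewrite -eweight // state_heis. Qed.

(** alpha_i(0) acts on [e a] by (alpha_i, a) and on a component with lattice part g by (alpha_i, g),
    so a nonzero component forces these to agree. *)
Let coef_e_form m g a : root a -> coef_proj (m, g) (e a) <> 0 ->
  forall x, form x g = form x a.
Proof.
move=> ra ne x; rewrite !(form_suml Q x); apply: eq_bigr => i _; congr (_ * _).
have := coef_proj_heis_zero i m g (e a); rewrite eweight0 //.
rewrite (linear_mapZ _ _ (coef_proj_linear _)) => /eqP; rewrite -subr_eq0 -scalerBl.
rewrite scaler_eq0 subr_eq0 eqr_int => /orP[/eqP -> //|/eqP].
by [].
Qed.

(* For x <> 0 of norm at most 0, the vector alpha_i(-1)^n e^x of weight 1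
   would lie in (IV_L)_1 but not in the span of the Chevalley basis. *)
Lemma form_posdef x : form x x <= 0 -> x = 0.
Proof.
move=> xx; apply/eqP; apply: contrapT => /negP x0.
have [i _] : exists i, x 0 i != 0.
  apply/existsP; rewrite -negb_forall; apply: contra x0 => /forallP x0.
  by apply/eqP/rowP => i; rewrite mxE; apply/eqP/x0.
(* The number of factors alpha_i(-1) that raises the weight (x, x)/2 <= 0 of e^x to 1. *)
pose n := `|(1 - (form x x %/ 2)%Z)%R|%N.
have [m [hm wm]] := heis_neg_iter i n x.
have h : (form x x %/ 2)%Z <= 0 by lia.
have w1 : conf_weight Q (m, x) = 1 by rewrite wm conf_weight_exp /n; lia.
have IVm : IV (bv (m, x)).
  rewrite -hm; elim: (n) => [|k IHk]; first exact: (IV_fS [::] x).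
  by rewrite iterS -(hv_simple i (-1)) -S_one; apply: (IV_Sz (simple i) 1).
have /espan hz : IV (bv (m, x)) /\ homogeneous 1 (bv (m, x)).
  by split=> //; apply: homogeneous_bv.
have : coef_proj (m, x) (bv (m, x)) = 0.
  elim: hz => {hm IVm} [v [[j ->]|[a ra ->]]||u v _ hu _ hv'].
  - rewrite -[-1]/(Negz 0) (fock_heis_neg fock) coef_proj_bv ifF //.
    by apply/eqP => -[_ /esym /eqP]; apply/negP.
  (* A nonzero component of [e a] over x would give (x, x) = (x, a) = (a, a) = 2. *)
  - apply: contrapT => ne; have fE := coef_e_form ra ne.
    have := fE a; rewrite (root_norm ra) (formC symQ a x) -fE => xx2.
    by move: xx; rewrite xx2.
  - exact: (addf0 (coef_proj_addf _)).
  - by rewrite coef_proj_addf hu hv' subrr.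
rewrite coef_proj_bv eqxx; exact: bv_neq0.
Qed.

Lemma conf_weight_exp_eq m g : conf_weight Q (m, g) = conf_weight Q (mset0, g) -> m = mset0.
Proof.
rewrite /conf_weight /= enum_mset0 big_nil add0r => /eqP; rewrite -subr_eq0 addrK.
case em : (enum_mset m) => [|x t]; last by rewrite big_cons.
by move=> _; apply/msetP => y; rewrite -count_mem_mset em mset0E.
Qed.

(** A nonzero component with lattice part g satisfies (g - a, g - a) = 0, hence g = a by
    [form_posdef]; e^a already has weight one, which leaves no room for oscillators. *)
Lemma chevalley_vectorZ a : root a -> exists z : int, e a = ex a *~ z.
Proof.
move=> ra; have [z hz] : exists z : int, coef_proj (mset0, a) (e a) = ex a *~ z.
  by apply: IV_integral; have [|] := (espan (e a)).2; [apply: ZspanGen; right; exists a|].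
exists z; apply/eqP; rewrite -subr_eq0; apply/eqP; apply: coef_proj_inj => -[m g].
rewrite coef_proj_addf (addfMz (coef_proj_addf _)) coef_proj_bv.
have [[<- <-]|ne] := eqVneq (mset0, a) (m, g); first by rewrite hz subrr.
rewrite mul0rz subr0; apply: contrapT => h.
have fE := coef_e_form ra h.
have ga : g = a.
  apply/eqP; rewrite -subr_eq0; apply/eqP; apply: form_posdef.
  by rewrite formDr formNr fE subrr.
subst g; apply: h; apply: ehom => //; apply: contra ne => /eqP w1.
apply/eqP; congr (_, _); apply/esym; apply: (@conf_weight_exp_eq _ a).
by rewrite w1 conf_weight_exp root_norm.
Qed.

(** For e_a = z e^a and e_(-a) = t e^(-a) the coroot relation says that z t is 1 up to the cocycle
    sign, so z is a unit of the integers. *)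
Lemma chevalley_vector a : root a -> exists s : bool, e a = ex a *~ (-1) ^+ s.
Proof.
move=> ra; have [z hz] := chevalley_vectorZ ra.
have [t ht] := chevalley_vectorZ (root_opp ra).
have := ecoroot ra; rewrite hz ht state_mulzl state_mulzr state_exp E_exp subrr.
rewrite formNr root_norm // (_ : - 0 - 1 - - 2 = 1%N%:Z) // [Sz _ _ _]S_one -!mulrzA.
(* a(1) a(-1) 1 = (a, a) 1 turns the relation into an equation between integer multiples of the
   vacuum. *)
move/(congr1 (hv a 1)); rewrite (addfMz (hvadd _ _)) hv_hv (heisv_exp fock) // (addf0 (hvadd _ _)) add0r.
rewrite subrr eqxx mul1r root_norm // -mulrzA.
move/eqP; rewrite -subr_eq0 -mulrzBr => /eqP /bv_mulz_eq0.
set sg := (-1) ^+ _ => h.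
have : z * (sg * t) = 1 by lia.
move/(congr1 absz); rewrite abszM => /eqP; rewrite muln_eq1 => /andP[/eqP z1 _].
case: z z1 {hz h} => k /= k1; first by exists false; rewrite k1.
by exists true; rewrite NegzE k1.
Qed.

Definition weight_one (v : V) : Prop := IV v /\ homogeneous 1 v.

Lemma weight_one_zspan v : zspan weight_one v -> weight_one v.
Proof.
elim=> {v} [//||u v _ [hu wu] _ [hv' wv]].
  by split=> [|b _]; [apply: Zspan0|rewrite (addf0 (coef_proj_addf _))].
by split; [apply: ZspanB|apply: homogeneousB].
Qed.

Lemma weight_one_mulz v z : weight_one v -> weight_one (v *~ z).
Proof. by move=> hv'; apply/weight_one_zspan/zspanMz/ZspanGen. Qed.

Lemma weight_one_0 : weight_one 0. Proof. exact/weight_one_zspan/Zspan0. Qed.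

Lemma weight_one_exp b : form b b = 2 -> weight_one (ex b).
Proof.
move=> b2; split; first exact: (IV_fS [::] b).
by apply: homogeneous_bv; rewrite conf_weight_exp b2.
Qed.

Lemma IV_generated_weight_one (W : V -> Prop) :
  (forall u v, W u -> W v -> W (u - v)) ->
  (forall u n v, W u -> W v -> W (state u n v)) ->
  W (ex 0) -> (forall v, weight_one v -> W v) -> forall v, IV v -> W v.
Proof.
move=> WB Wn Wvac W1 v; apply: generated_IV => // [a n u ha hu|i|i].
- by rewrite -state_exp; apply: Wn.
- by apply/W1/weight_one_exp; rewrite (form_simple Q) diagQ.
- by apply/W1/weight_one_exp; rewrite formNl formNr opprK (form_simple Q) diagQ.
Qed.

Lemma weight_one_heis i : weight_one (hs i (-1) (ex 0)).
Proof. by apply/espan/ZspanGen; left; exists i. Qed.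

Lemma weight_one_hv g : weight_one (hv g (-1) (ex 0)).
Proof.
apply: weight_one_zspan; rewrite /heisv; elim/big_ind: _ => [|u v|i _].
- exact: Zspan0.
- exact: zspanD.
by rewrite scaler_int; apply/zspanMz/ZspanGen/weight_one_heis.
Qed.

Section RootVector.
Variable a : L.
Hypothesis ra : root a.
Let scalel (c : K) x n y : state (c *: x) n y = c *: state x n y.
Proof. exact: (linear_mapZ c x (state_linear n y)). Qed.
Local Notation D := (state (e a) 0).
Local Notation dp := (div_pow state_ops (e a)).
Let dp_addf k : addf (dp k). Proof. exact: (div_pow_addf _ state_zva). Qed.
Let dp0 v : dp 0 v = v. Proof. exact: div_pow0. Qed.
Let dpS k v : dp k.+1 v *+ k.+1 = D (dp k v).
Proof. exact: (div_powS (S := state_ops) _ state_scaler). Qed.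

Lemma div_pow_stop k v : D (dp k v) = 0 -> forall j, (k < j)%N -> dp j v = 0.
Proof.
move=> Dk; elim=> // j IHj; rewrite ltnS leq_eqVlt => /orP[/eqP <-|/IHj dj].
  by apply: (@mulrn_inj _ _ _ _ k); rewrite dpS Dk mul0rn.
apply: (@mulrn_inj _ _ _ _ j); rewrite dpS dj mul0rn.
exact: (zva_np0r state_zva).
Qed.

Let D_E v : exists s : bool, D v = E a 0 v *~ (-1) ^+ s.
Proof.
have [s es] := chevalley_vector ra; exists s.
by rewrite es state_mulzl state_exp.
Qed.

Lemma root_mode_exp b : 0 <= form a b -> D (ex b) = 0.
Proof.
move=> ab; have [s ->] := D_E (ex b).
by rewrite E_exp Sz_neg ?mul0rz //; lia.
Qed.

(* Positive definiteness gives (a, b) >= -2, with b = - a in the extreme case;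
   so the a-string through e^b stops after at most two steps. *)
Lemma div_pow_exp b : form b b = 2 ->
  (forall k, weight_one (dp k (ex b))) /\ (forall k, (2 < k)%N -> dp k (ex b) = 0).
Proof.
move=> b2; have a2 := root_norm ra.
have ab2 : form (a + b) (a + b) = 4 + form a b *+ 2.
  by rewrite formDl !formDr a2 b2 (formC symQ b a) mulr2n; ring.
have step k : (forall j, (j <= k)%N -> weight_one (dp j (ex b))) -> (k <= 2)%N ->
    D (dp k (ex b)) = 0 ->
    (forall k, weight_one (dp k (ex b))) /\ (forall k, (2 < k)%N -> dp k (ex b) = 0).
  move=> hk k2 /div_pow_stop st; split=> j; last by move=> j2; apply: st; lia.
  by have [jk|kj] := leqP j k; [apply: hk|rewrite st //; apply: weight_one_0].
have h0 : weight_one (dp 0 (ex b)) by rewrite dp0; apply: weight_one_exp.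
have [ab0|ab0] := leP 0 (form a b).
  apply: (step 0%N) => //; last by rewrite dp0 root_mode_exp.
  by move=> j; rewrite leqn0 => /eqP ->.
have [s ds] := D_E (ex b).
have d1 : dp 1 (ex b) = Sz a (- 1 - form a b) (ex (a + b)) *~ ((-1) ^+ eps a b * (-1) ^+ s).
  by rewrite -[LHS]mulr1n dpS dp0 ds E_exp mulrzA oppr0 add0r.
have [ab1|ab1] := eqVneq (form a b) (-1).
  have {}d1 : dp 1 (ex b) = ex (a + b) *~ ((-1) ^+ eps a b * (-1) ^+ s).
    by rewrite d1 ab1 (_ : -1 - -1 = 0%N%:Z) //= S0.
  apply: (step 1%N) => // [[|[|]] // _|]; rewrite d1.
    by apply/weight_one_mulz/weight_one_exp; rewrite ab2 ab1.
  by rewrite state_mulzr root_mode_exp ?mul0rz // formDr a2 ab1.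
have ba : a + b = 0.
  by apply: form_posdef; rewrite ab2 mulr2n; lia.
have abE : form a b = - 2.
  by rewrite -[b](addKr a) ba addr0 formNr a2.
have {}d1 : dp 1 (ex b) = hv a (-1) (ex 0) *~ ((-1) ^+ eps a b * (-1) ^+ s).
  by rewrite d1 abE ba (_ : -1 - -2 = 1%N%:Z) // [Sz _ _ _]S_one.
have [t dt] := D_E (hv a (-1) (ex 0)).
(* e_a(0) maps a(-1) 1 to -(a, a) e_a, and the factor (a, a) = 2 absorbs the denominator 2!. *)
have d2 : dp 2 (ex b) = ex a *~ (- ((-1) ^+ t * ((-1) ^+ eps a b * (-1) ^+ s))).
  apply: (@mulrn_inj _ _ _ _ 1); rewrite dpS d1 state_mulzr dt E_hv.
  rewrite E_exp Sz_neg; last by rewrite form0r.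
  rewrite mul0rz (addf0 (hvadd _ _)) E_exp form0r (cocycle_0r epsP) mulr1z /= S0 addr0 a2 add0r.
  rewrite -[RHS]/(_ *~ _ *~ 2%N%:Z) !mulNrz -!mulrzA -mulrNz; congr (_ *~ _); ring.
apply: (step 2%N) => // [[|[|[|]]] // _|].
- by rewrite d1; apply/weight_one_mulz/weight_one_hv.
- by rewrite d2; apply/weight_one_mulz/weight_one_exp.
by rewrite d2 state_mulzr root_mode_exp ?mul0rz // a2.
Qed.

Let IVd v := IV v /\ (forall k, IV (dp k v)) /\ exists N, forall k, (N <= k)%N -> dp k v = 0.

Let IVd_exp b : form b b = 2 -> IVd (ex b).
Proof.
move=> b2; have [h1 h2] := div_pow_exp b2; split; first by case: (weight_one_exp b2).
by split=> [k|]; [case: (h1 k)|exists 3%N => k; apply: h2].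
Qed.

Lemma IV_div_pow v : IV v ->
  (forall k, IV (dp k v)) /\ exists N, forall k, (N <= k)%N -> dp k v = 0.
Proof.
move=> IVv; suff [] : IVd v by [].
have prod u n w : IVd u -> IVd w -> IVd (state u n w).
  move=> [u0 [u1 [N hN]]] [w0 [w1 [M hM]]].
  have lb k := div_pow_leibniz (S := state_ops) (e a) state_zva state_scaler k u n w.
  split; [exact: IV_state|split=> [k|]].
    rewrite [dp _ _]lb; elim/big_ind: _ => [|x y|i _]; [exact: Zspan0|exact: zspanD|].
    exact: IV_state.
  exists (N + M)%N => k hk; rewrite [dp _ _]lb big_nat big1 // => i /andP[_ ik].
  have [iN|Ni] := leqP N i; first by rewrite hN // (zva_np0l state_zva).
  by rewrite hM ?(zva_np0r state_zva) //; lia.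
have i2 i : form (simple i) (simple i) = 2 by rewrite (form_simple Q) diagQ.
apply: generated_IV IVv.
- move=> u w [u0 [u1 [N hN]]] [w0 [w1 [M hM]]]; split; [exact: ZspanB|split=> [k|]].
    by rewrite dp_addf; apply: ZspanB.
  by exists (N + M)%N => k hk; rewrite dp_addf hN ?hM ?subrr //; lia.
- by move=> b n w hb hw; rewrite -state_exp; apply: prod.
- split; [exact: IV_vac|split=> [[|k]|]]; first by rewrite dp0; apply: IV_vac.
    by rewrite [dp _ _](div_pow_vac (S := state_ops) _ state_zva) //; apply: Zspan0.
  by exists 1%N => k k0; rewrite [dp _ _](div_pow_vac (S := state_ops) _ state_zva).
- by move=> i; apply: IVd_exp.
- by move=> i; apply: IVd_exp; rewrite formNl formNr opprK.
Qed.

Lemma weight_one_div_pow k v : weight_one v -> weight_one (dp k v).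
Proof.
move=> /espan hz; elim: hz => {v} [v [[i ->]|[b rb ->]]||u v _ hu _ hv'].
- case: k => [|k]; first by rewrite dp0; apply: weight_one_heis.
  have [s ds] := D_E (hs i (-1) (ex 0)).
  (* e_a(0) maps alpha_i(-1) 1 to -(alpha_i, a) e_a, which is killed next because (a, a) >= 0. *)
  have d1 : dp 1 (hs i (-1) (ex 0)) = ex a *~ (- (form (simple i) a * (-1) ^+ s)).
    rewrite -[LHS]mulr1n dpS dp0 ds -hv_simple E_hv E_exp Sz_neg; last by rewrite form0r.
    rewrite mul0rz (addf0 (hvadd _ _)) E_exp form0r (cocycle_0r epsP) mulr1z /= S0 addr0 add0r.
    by rewrite mulNrz -mulrzA -mulrNz.
  case: k => [|k]; first by rewrite d1; apply/weight_one_mulz/weight_one_exp/root_norm.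
  rewrite (div_pow_stop (k := 1)) //; first exact: weight_one_0.
  by rewrite d1 state_mulzr root_mode_exp ?mul0rz // root_norm.
- have [s ->] := chevalley_vector rb; rewrite (addfMz (dp_addf k)).
  by apply: weight_one_mulz; case: (div_pow_exp (root_norm rb)).
- by rewrite (addf0 (dp_addf k)); apply: weight_one_0.
rewrite dp_addf; apply: weight_one_zspan.
by apply: ZspanB; apply: ZspanGen.
Qed.

End RootVector.

End ChevalleyBasis.

End VertexOperators.

(** * Exponentials of divided powers *)

Lemma fsum_triangle (V : zmodType) N (F : nat -> nat -> V) :
  (forall i j, (N <= i + j)%N -> F i j = 0) ->
  fsum (fun i => fsum (F i)) = fsum (fun k => \sum_(0 <= i < k.+1) F i (k - i)%N).
Proof.
move=> F0; have row i : fsum (F i) = \sum_(0 <= j < N - i) F i j.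
  by apply: fsumE => j hj; apply: F0; lia.
rewrite (@fsumE _ N) => [|i Ni]; last by rewrite row big_geq //; lia.
rewrite (@fsumE _ N) => [|k Nk]; last first.
  by rewrite big_nat big1 // => i /andP[_ ik]; apply: F0; lia.
transitivity (\sum_(0 <= k < N) \sum_(0 <= i < N) if (i <= k)%N then F i (k - i)%N else 0);
    last first.
  apply: eq_big_nat => k /andP[_ kN].
  rewrite [RHS](big_nat_widen _ _ N) ?[RHS]big_mkcond //=; lia.
rewrite exchange_big_nat; apply: eq_big_nat => i /andP[_ iN].
transitivity (\sum_(i <= k < N) F i (k - i)%N); last first.
  by rewrite (big_nat_widenl _ 0) ?big_mkcond.
rewrite row -[in RHS](add0n i) big_addn.
by apply: eq_bigr => j _; rewrite addnK.
Qed.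

Section ExponentialAutomorphisms.
Variables (R : comPzRingType) (M : zmodType) (d : nat -> M -> M).
Hypotheses (d_addf : forall k, addf (d k)) (d_nil : forall v, vanishing (d^~ v)).
Local Notation RM := (tensor R M).

Definition exp_tensor (t : R) : RM -> RM :=
  tens_lift (fun r v => fsum (fun k => pure (t ^+ k * r) (d k v))).

Let term_vanishing (t r : R) v : vanishing (fun k => pure (t ^+ k * r) (d k v) : RM).
Proof.
by have [N hN] := d_nil v; exists N => i hi; rewrite hN // (addf0 (@pureBr R M _)).
Qed.

Let termDl (t : R) r r' v : fsum (fun k => pure (t ^+ k * (r + r')) (d k v) : RM) =
  fsum (fun k => pure (t ^+ k * r) (d k v)) + fsum (fun k => pure (t ^+ k * r') (d k v)).
Proof. by rewrite -fsumD //; apply: fsum_ext => k; rewrite mulrDr pureDl. Qed.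

Let termDr (t : R) r v v' : fsum (fun k => pure (t ^+ k * r) (d k (v + v')) : RM) =
  fsum (fun k => pure (t ^+ k * r) (d k v)) + fsum (fun k => pure (t ^+ k * r) (d k v')).
Proof. by rewrite -fsumD //; apply: fsum_ext => k; rewrite (addfD (d_addf k)) pureDr. Qed.

Lemma exp_tensor_pure t r v :
  exp_tensor t (pure r v) = fsum (fun k => pure (t ^+ k * r) (d k v)).
Proof. exact: (tens_lift_pure (termDl t) (termDr t)). Qed.

Lemma exp_tensor_addf t : addf (exp_tensor t).
Proof. exact: (tens_lift_addf (termDl t) (termDr t)). Qed.

Lemma exp_tensor_scale t c x : exp_tensor t (c *: x) = c *: exp_tensor t x.
Proof.
apply: (tens_lift_scale (termDl t) (termDr t)) => {}c r v.
rewrite (addf_fsum (@addfZ R RM c)) //; apply: fsum_ext => k.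
by rewrite pureZ mulrCA.
Qed.

Section OneParameterGroup.
Hypotheses (d0 : forall v, d 0 v = v)
  (d_comp : forall i j v, d i (d j v) = d (i + j)%N v *+ 'C(i + j, i)).

Lemma exp_tensor0 x : exp_tensor 0 x = x.
Proof.
move: x; apply: tensor_ext => [||r v]; [exact: exp_tensor_addf|by []|].
rewrite exp_tensor_pure (@fsum1 _ _ 0%N) => [|i i0]; first by rewrite mul1r d0.
by rewrite expr0n (negbTE i0) mul0r pure0l.
Qed.

(** The rule d_i d_j = C(i + j, i) d_(i+j) makes this the binomial theorem. It provides the inverse
    exp(-t d), hence bijectivity. *)
Lemma exp_tensorD s t x : exp_tensor s (exp_tensor t x) = exp_tensor (s + t) x.
Proof.
move: x; apply: tensor_ext => [||r v].
- by apply: addf_comp; apply: exp_tensor_addf.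
- exact: exp_tensor_addf.
rewrite !exp_tensor_pure (addf_fsum (exp_tensor_addf s)) //.
under fsum_ext do rewrite exp_tensor_pure.
have [N hN] := d_nil v.
rewrite (fsum_triangle (N := N)) => [|j i hij]; last first.
  by rewrite d_comp hN ?mul0rn ?(addf0 (@pureBr R M _)) //; lia.
apply: fsum_ext => k; rewrite exprDn mulr_suml.
rewrite (big_morph (fun r => pure r (d k v) : RM) (fun r r' => pureDl r r' _) (pure0l _ _)).
rewrite -(big_mkord xpredT (fun i => pure (s ^+ (k - i) * t ^+ i *+ 'C(k, i) * r) (d k v))).
apply: eq_big_nat => i /andP[_ ik]; rewrite d_comp subnK // mulrA bin_sub //.
by rewrite (addfMn (@pureBr R M _)) mulrnAl -[in RHS]mulr_natl -[in RHS]pureZ scaler_nat.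
Qed.

Lemma exp_tensor_bij t : bijective (exp_tensor t).
Proof.
exists (exp_tensor (- t)) => x; rewrite exp_tensorD ?addNr ?subrr exp_tensor0 //.
Qed.

Variable S : vertex_ops M.
Hypotheses (zva : is_zva S) (d_vac : forall k, (0 < k)%N -> d k (vac S) = 0).
Hypothesis d_leibniz : forall k u n v, d k (nprod S u n v) =
  \sum_(0 <= i < k.+1) nprod S (d i u) n (d (k - i)%N v).
Local Notation B := (base_change R S).

Lemma exp_tensor_vac t : exp_tensor t (vac B) = vac B.
Proof.
rewrite exp_tensor_pure (@fsum1 _ _ 0%N) => [|i i0]; first by rewrite mul1r d0.
by rewrite d_vac ?lt0n // (addf0 (@pureBr R M _)).
Qed.

(** The Leibniz rule for divided powers is the Cauchy product of the exponentials of the two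
    arguments. *)
Lemma exp_tensor_nprod t x n y :
  exp_tensor t (nprod B x n y) = nprod B (exp_tensor t x) n (exp_tensor t y).
Proof.
have al := bc_addl zva; have ar := bc_addr zva.
have ea := exp_tensor_addf t.
move: x; apply: tensor_ext => [||r u].
- exact: (addf_comp ea (al R n y)).
- exact: (addf_comp (al R n _) ea).
move: y; apply: tensor_ext => [||s v].
- exact: (addf_comp ea (ar R _ n)).
- exact: (addf_comp (ar R _ n) ea).
rewrite (bc_pure zva) !exp_tensor_pure (addf_fsum (al R n _)) //.
under [RHS]fsum_ext do rewrite (addf_fsum (ar R _ n)) //.
have [N hN] := d_nil u; have [N' hN'] := d_nil v.
rewrite (fsum_triangle (N := N + N')) => [|i j hij]; last first.
  rewrite (bc_pure zva); have [Ni|iN] := leqP N i.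
    by rewrite hN // (zva_np0l zva) (addf0 (@pureBr R M _)).
  by rewrite hN' ?(zva_np0r zva) ?(addf0 (@pureBr R M _)) //; lia.
apply: fsum_ext => k; rewrite d_leibniz (addf_sum (@pureBr R M _)).
apply: eq_big_nat => i /andP[_ ik]; rewrite (bc_pure zva) mulrACA -exprD subnKC //.
Qed.

Lemma exp_tensor_automorphism t : is_va_automorphism B (exp_tensor t).
Proof.
have ea := exp_tensor_addf t.
split.
- by move=> c x y; rewrite (addfD ea) exp_tensor_scale.
- exact: exp_tensor_bij.
- exact: exp_tensor_vac.
- move=> x; rewrite !(bc_transl zva) exp_tensor_nprod; congr (nprod B _ _ _).
  exact: exp_tensor_vac.
- exact: exp_tensor_nprod.
Qed.

End OneParameterGroup.
End ExponentialAutomorphisms.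

Lemma exp_tensor_map (R : comPzRingType) (M N : zmodType) (d : nat -> M -> M)
    (d' : nat -> N -> N) (f : M -> N) (t : R) :
  (forall k, addf (d k)) -> (forall v, vanishing (d^~ v)) ->
  (forall k, addf (d' k)) -> (forall v, vanishing (d'^~ v)) ->
  addf f -> (forall k v, f (d k v) = d' k (f v)) ->
  forall u, tens_map f (exp_tensor d t u) = exp_tensor d' t (tens_map f u).
Proof.
move=> da dn da' dn' fa fd.
apply: tensor_ext => [||r v].
- exact: (addf_comp (tens_map_addf fa) (exp_tensor_addf da dn t)).
- exact: (addf_comp (exp_tensor_addf da' dn' t) (tens_map_addf fa)).
rewrite (tens_map_pure fa) (exp_tensor_pure da' dn') (exp_tensor_pure da dn).
rewrite (addf_fsum (tens_map_addf fa)) => [|].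
  by apply: fsum_ext => k; rewrite (tens_map_pure fa) fd.
have [n hn] := dn v; exists n => i hi; by rewrite hn // (addf0 (@pureBr R M _)).
Qed.

(** * Vertex algebra automorphisms and extension of group actions *)

Section Automorphisms.
Variables (R : comPzRingType) (V : lmodType R) (S : vertex_ops V).
Local Notation aut := (is_va_automorphism S).

Lemma automorphism_addf phi : aut phi -> addf phi.
Proof.
by move=> h x y; rewrite addrC -scaleN1r (vaut_linear h) scaleN1r addrC.
Qed.

Lemma automorphism_id : aut id.
Proof. by split=> //; exists id. Qed.

Lemma automorphism_comp phi psi : aut phi -> aut psi -> aut (phi \o psi).
Proof.
move=> hf hg; split.
- by move=> c x y; rewrite /= (vaut_linear hg) (vaut_linear hf).
- exact: bij_comp (vaut_bij hf) (vaut_bij hg).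
- by rewrite /= (vaut_vac hg) (vaut_vac hf).
- by move=> x; rewrite /= (vaut_T hg) (vaut_T hf).
- by move=> a n b; rewrite /= (vaut_nprod hg) (vaut_nprod hf).
Qed.

Lemma automorphism_inv phi psi : aut phi -> cancel phi psi -> cancel psi phi -> aut psi.
Proof.
move=> hf pK qK; have inj := can_inj pK; split.
- by move=> c x y; apply: inj; rewrite (vaut_linear hf) !qK.
- by exists phi.
- by apply: inj; rewrite (vaut_vac hf) qK.
- by move=> x; apply: inj; rewrite (vaut_T hf) !qK.
- by move=> a n b; apply: inj; rewrite (vaut_nprod hf) !qK.
Qed.

End Automorphisms.

Section ExtendedActions.
Variables (R : comPzRingType) (N N1 : zmodType) (incl : N1 -> N) (O : vertex_ops N).

Definition extends (g : tensor R N1 -> tensor R N1) (phi : tensor R N -> tensor R N) :=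
  is_va_automorphism (base_change R O) phi /\
  forall u, phi (tens_map incl u) = tens_map incl (g u).

Lemma extends_id : extends id id.
Proof. by split=> //; apply: automorphism_id. Qed.

Lemma extends_comp g h phi psi :
  extends g phi -> extends h psi -> extends (g \o h) (phi \o psi).
Proof.
move=> [af ef] [ag eg]; split=> [|u]; first exact: automorphism_comp.
by rewrite /= eg ef.
Qed.

Lemma extends_inv g h phi : extends g phi -> cancel h g ->
  exists psi, extends h psi.
Proof.
move=> [af ef] hg; have [psi pK qK] := vaut_bij af.
exists psi; split=> [|u]; first exact: automorphism_inv af pK qK.
by apply: (can_inj pK); rewrite qK ef hg.
Qed.

(** Extensions are chosen element by element. The choice for g h and the composite of the choices
    for g and h extend the same map, so uniqueness makes the choice multiplicative whatever
    relations the generators satisfy. *)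
Lemma action_extension (G : (tensor R N1 -> tensor R N1) -> Prop) :
  (forall g phi psi, extends g phi -> extends g psi -> phi =1 psi) ->
  G id -> (forall g h, G g -> G h -> G (g \o h)) ->
  (forall g, G g -> exists phi, extends g phi) ->
  exists Phi, [/\ forall g, G g -> extends g (Phi g),
    forall x, Phi id x = x,
    forall g h, G g -> G h -> forall x, Phi (g \o h) x = Phi g (Phi h x) &
    forall Psi, (forall g, G g -> extends g (Psi g)) ->
      forall g, G g -> Psi g =1 Phi g].
Proof.
move=> uniq Gid Gcomp Gext.
have /choice [Phi hPhi] g : exists phi, G g -> extends g phi.
  have [/Gext [phi hphi]|nG] := pselect (G g); first by exists phi.
  by exists id.
exists Phi; split=> // [x|g h Gg Gh x|Psi hPsi g Gg].
- exact: (uniq _ _ _ (hPhi _ Gid) extends_id).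
- have := extends_comp (hPhi _ Gg) (hPhi _ Gh).
  by move/(uniq _ _ _ (hPhi _ (Gcomp _ _ Gg Gh))) => /(_ x).
- exact: uniq (hPsi _ Gg) (hPhi _ Gg).
Qed.

End ExtendedActions.

(** * Extension of one exponential, and its uniqueness, over an integral form *)

Section Extension.
Variables (K : numFieldType) (V : lmodType K) (S : vertex_ops V).
Variables (P P1 : zmodClosed V) (R : comPzRingType).
Hypotheses (zva : is_zva S) (Pvac : vac S \in P)
  (Pnp : forall a n b, a \in P -> b \in P -> nprod S a n b \in P).
Hypothesis P1P : forall v, v \in P1 -> v \in P.
Local Notation B := (base_change R (sub_ops P S)).
Local Notation aut := (is_va_automorphism B).
Let Pzva : is_zva (sub_ops P S) := sub_zva zva Pvac Pnp.

Definition sub_incl (v : subz P1) : subz P := to_sub P (\val v).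

Lemma val_sub_incl v : \val (sub_incl v) = \val v.
Proof. by apply: val_to_sub; apply: P1P; apply: valP. Qed.

Lemma sub_incl_addf : addf sub_incl.
Proof. by move=> u v; apply: val_inj; rewrite valB !val_sub_incl valB. Qed.

Section DividedPowerAutomorphism.
Hypothesis scaler : forall (c : K) a n b, nprod S a n (c *: b) = c *: nprod S a n b.
Variable d : V.
Local Notation dp := (div_pow S d).
Hypotheses (P_stable : forall k v, v \in P -> dp k v \in P)
  (P_nilp : forall v, v \in P -> vanishing (dp^~ v))
  (P1_stable : forall k v, v \in P1 -> dp k v \in P1).

Definition sub_div_pow (N : zmodClosed V) k (v : subz N) : subz N :=
  to_sub N (dp k (\val v)).

Section Stable.
Variable N : zmodClosed V.
Hypotheses (N_stable : forall k v, v \in N -> dp k v \in N) (NP : forall v, v \in N -> v \in P).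

Lemma val_sub_div_pow k (v : subz N) : \val (sub_div_pow k v) = dp k (\val v).
Proof. by apply/val_to_sub/N_stable/valP. Qed.

Lemma sub_div_pow_addf k : addf (sub_div_pow (N := N) k).
Proof.
by move=> u v; apply: val_inj; rewrite valB !val_sub_div_pow valB (div_pow_addf _ zva).
Qed.

Lemma sub_div_pow_vanishing (v : subz N) : vanishing (@sub_div_pow N ^~ v).
Proof.
have [n hn] := P_nilp (NP (valP v)); exists n => i hi.
by apply: val_inj; rewrite val_sub_div_pow hn.
Qed.
End Stable.

Lemma exp_extends (t : R) :
  extends sub_incl (sub_ops P S) (exp_tensor (@sub_div_pow P1) t) (exp_tensor (@sub_div_pow P) t).
Proof.
have addP := sub_div_pow_addf P_stable; have nilP := sub_div_pow_vanishing P_stable (fun _ h => h).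
split=> [|u].
  apply: exp_tensor_automorphism => //.
  - by move=> v; apply: val_inj; rewrite (val_sub_div_pow P_stable) div_pow0.
  - move=> i j v; apply: val_inj; rewrite (addfMn (@val_addf _ P)) !(val_sub_div_pow P_stable).
    exact: (div_pow_comp d scaler).
  - move=> k k0; apply: val_inj; rewrite (val_sub_div_pow P_stable) val_sub_vac //.
    exact: (div_pow_vac d zva).
  - move=> k u n v; apply: val_inj; rewrite (val_sub_div_pow P_stable) (val_sub_np Pnp).
    rewrite (div_pow_leibniz d zva scaler) (addf_sum (@val_addf _ P)).
    by apply: eq_bigr => i _; rewrite (val_sub_np Pnp) !(val_sub_div_pow P_stable).
apply/esym/exp_tensor_map => //.
- exact: sub_div_pow_addf.
- exact: (sub_div_pow_vanishing P1_stable P1P).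
- exact: sub_incl_addf.
- move=> k v; apply: val_inj; rewrite val_sub_incl (val_sub_div_pow P1_stable).
  by rewrite (val_sub_div_pow P_stable) val_sub_incl.
Qed.

End DividedPowerAutomorphism.

Section Uniqueness.
Hypothesis generated : forall W : V -> Prop,
  (forall u v, W u -> W v -> W (u - v)) ->
  (forall u n v, W u -> W v -> W (nprod S u n v)) ->
  W (vac S) -> (forall v, v \in P1 -> W v) -> forall v, v \in P -> W v.

Lemma extends_unique (g : tensor R (subz P1) -> tensor R (subz P1)) phi psi :
  extends sub_incl (sub_ops P S) g phi -> extends sub_incl (sub_ops P S) g psi ->
  phi =1 psi.
Proof.
move=> [af ef] [ag eg].
have toB u v : u \in P -> v \in P -> to_sub P (u - v) = to_sub P u - to_sub P v.
  by move=> hu hv; apply: val_inj; rewrite valB !val_to_sub ?rpredB.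
have toP u n v : u \in P -> v \in P ->
    to_sub P (nprod S u n v) = nprod (sub_ops P S) (to_sub P u) n (to_sub P v).
  by move=> hu hv; apply: val_inj; rewrite val_sub_np // !val_to_sub ?Pnp.
(* Generation is stated for predicates on V, so membership in P is made part of W; it ensures that
   [to_sub] commutes with differences and products. *)
pose W v := v \in P /\ phi (pure 1 (to_sub P v)) = psi (pure 1 (to_sub P v)).
have WP : forall v, v \in P -> W v.
  apply: generated.
  - move=> u v [hu eu] [hv ev]; split; first exact: rpredB.
    by rewrite toB // pureBr (automorphism_addf af) (automorphism_addf ag) eu ev.
  - move=> u n v [hu eu] [hv ev]; split; first exact: Pnp.
    have -> : pure 1 (to_sub P (nprod S u n v)) =
        nprod B (pure 1 (to_sub P u)) n (pure 1 (to_sub P v)).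
      by rewrite (bc_pure Pzva) mulr1 toP.
    by rewrite (vaut_nprod af) (vaut_nprod ag) eu ev.
  - by split=> //; rewrite (vaut_vac af : phi (pure _ _) = _) (vaut_vac ag : psi (pure _ _) = _).
  - move=> v hv; split; first exact: P1P.
    have -> : pure 1 (to_sub P v) = tens_map sub_incl (pure 1 (to_sub P1 v)) :> tensor R _.
      rewrite (tens_map_pure sub_incl_addf); congr (pure _ _); apply: val_inj.
      by rewrite val_sub_incl !val_to_sub // P1P.
    by rewrite ef eg.
apply: tensor_ext => [||r v]; [exact: automorphism_addf af|exact: automorphism_addf ag|].
have -> : pure r v = r *: pure 1 (to_sub P (\val v)) :> tensor R _.
  rewrite pureZ mulr1; congr (pure _ _); apply: val_inj; rewrite val_to_sub //.
  exact: valP.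
have sc f : aut f -> forall c x, f (c *: x) = c *: f x.
  by move=> h c x; rewrite -[c *: x]addr0 (vaut_linear h) (addf0 (automorphism_addf h)) addr0.
by rewrite !sc // (WP (\val v) (valP v)).2.
Qed.

End Uniqueness.

End Extension.

(** * The concrete Fock space *)

Section BasisVectors.
Variables (K : fieldType) (l : nat).

Lemma mcoeff_single (x : K) (b c : fock_index l) :
  (<< x *g b >> : VL K l)@_c = x *+ (b == c).
Proof. exact: (@mcoeffU (fock_index l) K b x c). Qed.

Lemma mcoeff_bvec b c : (bvec K b : VL K l)@_c = (b == c)%:R.
Proof. exact: mcoeff_single. Qed.

Lemma bvecZ (x : K) (b : fock_index l) : x *: bvec K b = << x *g b >> :> VL K l.
Proof.
apply/malgP => c; transitivity (x * (bvec K b)@_c).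
  exact: (@mcoeffZ (fock_index l) K x (bvec K b) c).
by rewrite /bvec [RHS]mcoeff_single [X in _ * X](mcoeff_single 1) mulrnAr mulr1.
Qed.
End BasisVectors.

Section LinearExtension.
Variables (K : fieldType) (l : nat).
Local Notation V := (VL K l).
Local Notation L := 'rV[int]_l.
Variable W : lmodType K.

Lemma linextEw (f : fock_index l -> W) (v : V) (d : {fset (fock_index l)}) :
  (msupp v `<=` d)%fset -> linext f v = \sum_(b <- d) v@_b *: f b.
Proof.
move=> vd; rewrite /linext; apply: big_fset_incl => // b _ /mcoeff_outdom ->.
by rewrite scale0r.
Qed.

Lemma linextP (f : fock_index l -> W) k (u v : V) :
  linext f (k *: u + v) = k *: linext f u + linext f v.
Proof.
pose d := (msupp u `|` msupp v)%fset.
rewrite !(@linextEw f _ d) ?fsubsetUl ?fsubsetUr //; last first.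
  apply: fsubset_trans (msuppD_le _ _) _; apply: fsetUSS => //.
  exact: msuppZ_le.
rewrite scaler_sumr -big_split /=; apply: eq_bigr => b _.
by rewrite mcoeffD mcoeffZ scalerDl scalerA.
Qed.

Lemma linext_bvec (f : fock_index l -> W) b : linext f (bvec K b) = f b.
Proof. by rewrite /linext /bvec msuppU oner_eq0 big_seq_fset1 mcoeff_bvec eqxx scale1r. Qed.

Lemma VL_span (P : V -> Prop) :
  (forall k u v, P u -> P v -> P (k *: u + v)) ->
  (forall b, P (bvec K b)) -> forall v, P v.
Proof.
move=> Plin Pb v; have P0 : P 0.
  by rewrite -(subrr (bvec K (mset0, 0))) addrC -scaleN1r; apply: Plin.
rewrite (monalgE v); elim/big_ind: _ => // [x y Px Py|b _].
  by rewrite -[x]scale1r; apply: Plin.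
by rewrite -bvecZ -[_ *: _]addr0; apply: Plin.
Qed.

End LinearExtension.

Section LatticeFock.
Variables (K : numFieldType) (l : nat) (A : 'M[int]_l).
Local Notation V := (VL K l).

Lemma VL_fock : is_fock A (@bvec K l) (@heis K l A) (@linext K l V).
Proof.
split.
- exact: linextP.
- exact: linext_bvec.
- exact: VL_span.
- by move=> i n; exact: linextP.
- by move=> i k m g; exact: linext_bvec.
- by move=> i m g; exact: linext_bvec.
- by move=> i k m g; exact: linext_bvec.
Qed.

Lemma pow_coefE (D : nat -> V -> V) p n v : pow_coef D p n v = gen_pow_coef D p n v.
Proof.
elim: p n v => [//|p IHp] n v; apply: eq_bigr => m _.
change (D m (pow_coef D p (n - m) v) = D m (gen_pow_coef D p (n - m) v)).
by rewrite IHp.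
Qed.

Lemma exp_coefE (D : nat -> V -> V) n v : exp_coef D n v = gen_exp_coef D n v.
Proof. by apply: eq_bigr => p _; rewrite pow_coefE. Qed.

End LatticeFock.

Section HeisenbergExponentials.
Variables (K : numFieldType) (l : nat) (A : 'M[int]_l) (V : lmodType K).
Hypothesis symA : forall i j, A i j = A j i.
Variables (bv : fock_index l -> V) (hs : 'I_l -> int -> V -> V).
Variable le : (fock_index l -> V) -> V -> V.
Hypothesis fock : is_fock A bv hs le.
Local Notation hv := (heisv hs).
Variable a : 'rV[int]_l.

Let cre m v : V := m%:R^-1 *: hv a (- m%:Z) v.
Let ann m v : V := - (m%:R^-1 *: hv a m%:Z v).

Let hvZ n c v : hv a n (c *: v) = c *: hv a n v.
Proof. exact: linear_mapZ (heisv_linear fock a n). Qed.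

Let hv_comm (m n : int) v : (m + n == 0) ==> (m == 0) -> hv a m (hv a n v) = hv a n (hv a m v).
Proof.
rewrite (heisv_heisv symA fock); case: eqP => [_ /= /eqP ->|_ _].
  by rewrite mul0r scale0r addr0.
by rewrite scale0r addr0.
Qed.

Lemma creation_exp_rec n v : gen_exp_coef cre n v *+ n =
  \sum_(1 <= m < n.+1) hv a (- m%:Z) (gen_exp_coef cre (n - m) v).
Proof.
rewrite gen_exp_rec => [||m k u].
- apply: eq_big_nat => m /andP[m0 _]; rewrite -scaler_nat /cre scalerA divff ?scale1r //.
  by rewrite pnatr_eq0; lia.
- by move=> m; apply/linear_map_scale/heisv_linear/fock.
rewrite /cre !hvZ !scalerA hv_comm; first by rewrite mulrC.
by apply/implyP => /eqP h; apply/eqP; lia.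
Qed.

Lemma annihilation_exp_rec n v : gen_exp_coef ann n v *+ n =
  \sum_(1 <= m < n.+1) - hv a m%:Z (gen_exp_coef ann (n - m) v).
Proof.
rewrite gen_exp_rec => [||m k u].
- apply: eq_big_nat => m /andP[m0 _]; rewrite -scaler_nat /ann scalerN scalerA divff ?scale1r //.
  by rewrite pnatr_eq0; lia.
- by move=> m; apply/linear_map_opp/linear_map_scale/heisv_linear/fock.
have hN := addfN (heisv_addf fock a _).
rewrite /ann !hN !hvZ !scalerN !opprK !scalerA hv_comm; first by rewrite mulrC.
by apply/implyP => /eqP h; apply/eqP; lia.
Qed.

End HeisenbergExponentials.

Section LatticeVertexAlgebra.
Variables (K : numFieldType) (l : nat) (A : 'M[int]_l).
Hypothesis symA : forall i j, A i j = A j i.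
Local Notation V := (VL K l).
Local Notation L := 'rV[int]_l.
Variable eps : L -> L -> bool.

Lemma schur0 a (v : V) : schur A a 0 v = v.
Proof. by rewrite /schur exp_coefE gen_exp0. Qed.

Lemma schur_rec a n (v : V) : schur A a n v *+ n =
  \sum_(1 <= m < n.+1) heisv (heis A) a (- m%:Z) (schur A a (n - m)%N v).
Proof.
rewrite /schur exp_coefE [LHS](creation_exp_rec symA (VL_fock K A) a n v).
by apply: eq_bigr => m _; rewrite exp_coefE.
Qed.

Lemma annih0 a (v : V) : annih A a 0 v = v.
Proof. by rewrite /annih exp_coefE gen_exp0. Qed.

Lemma annih_rec a n (v : V) : annih A a n v *+ n =
  \sum_(1 <= m < n.+1) - heisv (heis A) a m%:Z (annih A a (n - m)%N v).
Proof.
rewrite /annih exp_coefE [LHS](annihilation_exp_rec symA (VL_fock K A) a n v).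
by apply: eq_bigr => m _; rewrite exp_coefE.
Qed.

Lemma Yexp_linear a n : linear_map (Yexp A eps a n : V -> V).
Proof. exact: linextP. Qed.

Lemma Yexp_bvec a n m g : Yexp A eps a n (bvec K (m, g)) = (-1) ^+ eps a g *:
  fsum (fun j : nat => Sz (@schur K l A) a (j%:Z - n - 1 - lat_form A a g)
    (annih A a j (bvec K (m, a + g)))).
Proof. exact: linext_bvec. Qed.

Lemma coef_projE b (v : V) : coef_proj (@bvec K l) (@linext K l V) b v = v@_b *: bvec K b.
Proof.
move: v; apply: (linear_map_ext (VL_fock K A)) => [||b'].
- exact: coef_proj_linear (VL_fock K A) b.
- by move=> c u v; rewrite mcoeffD mcoeffZ scalerDl scalerA.
rewrite /coef_proj linext_bvec mcoeff_bvec; by case: eqP => [_|_]; rewrite ?scale1r ?scale0r.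
Qed.

Lemma coef_proj_inj_VL (v : V) :
  (forall b, coef_proj (@bvec K l) (@linext K l V) b v = 0) -> v = 0.
Proof.
move=> h; apply/malgP => b; rewrite mcoeff0.
have := congr1 (fun w : V => w@_b) (h b).
rewrite coef_projE mcoeff0 => <-.
rewrite [RHS](@mcoeffZ (fock_index l) K v@_b (bvec K b) b).
by rewrite [X in _ * X](mcoeff_bvec K b b) eqxx mulr1.
Qed.

Lemma bvec_neq0 (b : fock_index l) : bvec K b <> 0 :> V.
Proof.
move/(congr1 (fun w : V => w@_b)); rewrite (mcoeff_bvec K b b) mcoeff0 eqxx.
by move/eqP; rewrite oner_eq0.
Qed.

Lemma homogP n (v : V) :
  homog A n v <-> homogeneous A (@bvec K l) (@linext K l V) n v.
Proof.
split=> h b.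
  move=> hb; rewrite coef_projE mcoeff_outdom ?scale0r //.
  by apply: contraNN hb => /h ->.
rewrite -mcoeff_neq0; apply: contraNeq => /h.
by move/(congr1 (fun w : V => w@_b)); rewrite coef_projE mcoeff0
   [LHS](@mcoeffZ (fock_index l) K v@_b (bvec K b) b) [X in _ * X](mcoeff_bvec K b b) eqxx mulr1 => ->.
Qed.

End LatticeVertexAlgebra.

(** * The Chevalley group acting on the lattice vertex algebra *)

Section ChevalleyGroup.
Variables (K : numFieldType) (l : nat) (A : 'M[int]_l).
Hypotheses (symA : forall i j, A i j = A j i) (diagA : forall i, A i i = 2).
Local Notation V := (VL K l).
Local Notation L := 'rV[int]_l.
Variables (eps : L -> L -> bool) (epsP : is_cocycle A eps).
Local Notation S := (@VL_ops K l A eps).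
Local Notation IVp := (@IV_pred K l A : zmodClosed V).
Local Notation IV1p := (@IV1_pred K l A : zmodClosed V).
Local Notation IVz := (zspan (IVgen (@bvec K l) (@schur K l A))).
Local Notation fock := (VL_fock K A).
Local Notation s0 := (@schur0 K l A).
Local Notation sr := (@schur_rec K l A symA).
Local Notation a0 := (@annih0 K l A).
Local Notation ar := (@annih_rec K l A symA).
Local Notation yl := (@Yexp_linear K l A eps).
Local Notation yb := (@Yexp_bvec K l A eps).

Lemma VL_zva : is_zva S.
Proof. exact: (state_zva symA fock epsP s0 sr a0 ar yl yb). Qed.

Lemma VL_nprod_scaler (c : K) a n b : nprod S a n (c *: b) = c *: nprod S a n b.
Proof. exact: (state_scaler symA fock epsP s0 sr a0 ar yl yb). Qed.

Lemma IV_predP (v : V) : reflect (IVz v) (v \in IVp).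
Proof. exact: asboolP. Qed.

Lemma IV1_predP (v : V) : reflect (IVz v /\ homog A 1 v) (v \in IV1p).
Proof. exact: asboolP. Qed.

Lemma IV_pred_vac : vac S \in IVp.
Proof. exact/IV_predP/(IV_vac _ s0). Qed.

Lemma IV_pred_nprod a n b : a \in IVp -> b \in IVp -> nprod S a n b \in IVp.
Proof.
move=> /IV_predP ha /IV_predP hb; apply/IV_predP.
exact: (IV_state symA fock epsP s0 sr a0 ar yl yb).
Qed.

Lemma IV1_pred_sub (v : V) : v \in IV1p -> v \in IVp.
Proof. by move=> /IV1_predP [h _]; apply/IV_predP. Qed.

Lemma IV_pred_generated (W : V -> Prop) :
  (forall u v, W u -> W v -> W (u - v)) ->
  (forall u n v, W u -> W v -> W (nprod S u n v)) ->
  W (vac S) -> (forall v, v \in IV1p -> W v) -> forall v, v \in IVp -> W v.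
Proof.
move=> WB Wn Wvac W1 v /IV_predP hv.
have {}W1 u : weight_one A (@bvec K l) (@linext K l V) (@schur K l A) u -> W u.
  by move=> [h1 /homogP h2]; apply/W1/IV1_predP.
exact: (IV_generated_weight_one symA fock s0 sr a0 ar yl yb
  diagA WB Wn Wvac W1 hv).
Qed.

Variables (e : L -> V) (he : is_chevalley_basis A eps e).

Let ehom a (ra : is_root A a) :
  homogeneous A (@bvec K l) (@linext K l V) 1 (e a).
Proof. by apply/homogP; case: (chev_root_space he ra). Qed.

Let espan v : IVz v /\ homogeneous A (@bvec K l) (@linext K l V) 1 v <->
  zspan (fun w => (exists i, w = heis A i (-1) (bvec K (mset0, 0))) \/
                  (exists2 a, is_root A a & w = e a)) v.
Proof.
apply: iff_trans (chev_span he v); split=> [[h1 h2]|/IV1_predP [h1 h2]].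
  by apply/IV1_predP; split=> //; apply/homogP.
by split=> //; apply/homogP.
Qed.

Section Root.
Variables (a : L) (ra : is_root A a).

Lemma IV_pred_div_pow v : v \in IVp ->
  (forall k, div_pow S (e a) k v \in IVp) /\ vanishing ((div_pow S (e a))^~ v).
Proof.
move=> /IV_predP hv.
have [h1 h2] := IV_div_pow symA fock epsP s0 sr a0 ar yl yb
  (@coef_proj_inj_VL K l A) (@bvec_neq0 K l) diagA ehom
  (fun a ra => (chev_root_space he ra).2) (chev_coroot he) espan ra hv.
by split=> // k; apply/IV_predP.
Qed.

Lemma IV1_pred_div_pow k v : v \in IV1p -> div_pow S (e a) k v \in IV1p.
Proof.
move=> /IV1_predP [h1 /homogP h2].
have [h3 h4] := weight_one_div_pow symA fock epsP s0 sr a0 ar yl yb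
  (@coef_proj_inj_VL K l A) (@bvec_neq0 K l) diagA ehom
  (fun a ra => (chev_root_space he ra).2) (chev_coroot he) espan ra k (conj h1 h2).
by apply/IV1_predP; split=> //; apply/homogP.
Qed.
End Root.

Variable R : comPzRingType.

Lemma IV_base_change : is_vertex_algebra (base_change R (IV_ops K A eps)).
Proof. exact: (bc_vertex_algebra R (sub_zva VL_zva IV_pred_vac IV_pred_nprod)). Qed.

(** Holds by conversion: [ad_divpow] unfolds to the divided power of the zero mode of [e a] in
    [VL_ops], restricted to the weight one part. *)
Lemma x_rootE a (t : R) :
  @x_root K l A eps R e a t = exp_tensor (@sub_div_pow K V S (e a) IV1p) t.
Proof. reflexivity. Qed.

Let ext := extends (R := R) (@IV1_incl K l A) (IV_ops K A eps).

Let root_extends a t (ra : is_root A a) : exists phi, ext (@x_root K l A eps R e a t) phi.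
Proof.
rewrite x_rootE; exists (exp_tensor (@sub_div_pow K V S (e a) IVp) t).
exact: (exp_extends VL_zva IV_pred_vac IV_pred_nprod IV1_pred_sub VL_nprod_scaler
  (fun k v hv => (IV_pred_div_pow ra hv).1 k) (fun v hv => (IV_pred_div_pow ra hv).2)
  (IV1_pred_div_pow ra) t).
Qed.

Let ext_unique g phi psi : ext g phi -> ext g psi -> phi =1 psi.
Proof. exact: (extends_unique VL_zva IV_pred_vac IV_pred_nprod IV1_pred_sub IV_pred_generated). Qed.

Lemma chevalley_group_extends g : chevalley_group A eps R e g -> exists phi, ext g phi.
Proof.
elim=> {g} [a t||g h _ [phi hphi] _ [psi hpsi]|g h _ [phi hphi] _ hg].
- exact: root_extends.
- by exists id; apply: extends_id.
- by exists (phi \o psi); apply: extends_comp.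
exact: extends_inv hphi hg.
Qed.

Lemma chevalley_action : exists Phi, is_extended_action A eps R e Phi /\
    forall Psi, is_extended_action A eps R e Psi ->
      forall g, chevalley_group A eps R e g -> Psi g =1 Phi g.
Proof.
have [Phi [h1 h2 h3 h4]] := action_extension ext_unique
  (@ChevId K l A eps R e) (@ChevComp K l A eps R e) chevalley_group_extends.
exists Phi; split.
  split.
  - by move=> g /h1 [].
  - exact: h2.
  - exact: h3.
  - by move=> g /h1 [].
move=> Psi hPsi; apply: h4 => g hg; split; first exact: (ext_aut hPsi).
exact: (ext_extends hPsi).
Qed.

End ChevalleyGroup.

Lemma cartan_sym X i j : cartan X i j = cartan X j i.
Proof. by rewrite !mxE eq_sym orbC. Qed.

Lemma cartan_diag X i : cartan X i i = 2.
Proof. by rewrite mxE eqxx. Qed.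

Theorem theorem3p3 (Re : realType) (X : ade_type) (hX : ade_wf X)
    (eps : 'rV[int]_(ade_rank X) -> 'rV[int]_(ade_rank X) -> bool)
    (heps : is_cocycle (cartan X) eps)
    (e : 'rV[int]_(ade_rank X) -> VL Re[i] (ade_rank X))
    (he : is_chevalley_basis (cartan X) eps e)
    (R : comPzRingType) :
  is_vertex_algebra (base_change R (IV_ops Re[i] (cartan X) eps)) /\
  exists Phi, is_extended_action (cartan X) eps R e Phi /\
    forall Psi, is_extended_action (cartan X) eps R e Psi ->
      forall g, chevalley_group (cartan X) eps R e g -> Psi g =1 Phi g.
Proof.
split.
  exact: (IV_base_change Re[i] (@cartan_sym X) heps R).
exact: (chevalley_action (@cartan_sym X) (@cartan_diag X) heps he R).
Qed.
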